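(* Let $N_{50}=2430068453031180290203185942420933$. For all $1\leq\lambda<(2\cdot N_{50})^{1/100}\approx 2.17$, there exists a constant $0<\beta<1$ such that, with all but exponentially small probability, a configuration of $n$ particles drawn from the stationary distribution $\pi$ of the Markov chain $\mathcal{M}$ with bias parameter $\lambda$ is $\beta$-expanded; that is, there exist $n^*\ge0$ and $\gamma<1$ such that for all $n>n^*$, $\mathbb{P}(p(\sigma)\le\beta\cdot p_{max})<\gamma^{\sqrt n}$ for $\sigma\sim\pi$.
   Context: Let $\Gamma$ be the triangular lattice. A configuration of $n$ particles is a set of $n$ vertices (''locations'') of $\Gamma$, considered up to translation (rotated copies count as distinct). The configuration is connected if the subgraph of $\Gamma$ induced by the occupied locations is connected. A hole is a maximal finite connected set of unoccupied locations. ($N_{50}$ is the number of connected configurations of 50 particles with no holes.) For a connected configuration $\sigma$ with no holes, $p(\sigma)$ is the length of the closed walk around its single external boundary (an edge traversed twice is counted twice). $p_{max}=2n-2$; $\sigma$ is $\beta$-expanded if $p(\sigma)>\beta\cdot p_{max}$. The Markov chain $\mathcal{M}$ (bias $\lambda>0$) has state space $\Omega$, the set of connected configurations of $n$ particles with no holes. For a location $\ell$, $N(\ell)$ is the set of particles at locations adjacent to $\ell$. For adjacent $\ell,\ell'$, let $\mathbb{S}=N(\ell)\cap N(\ell')$ and $N(\ell\cup\ell')=(N(\ell)\cup N(\ell'))$ minus particles located at $\ell$ or $\ell'$. Property 1: $|\mathbb{S}|\in\{1,2\}$ and every particle in $N(\ell\cup\ell')$ is connected to a particle of $\mathbb{S}$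 by a lattice path all of whose vertices are particles of $N(\ell\cup\ell')$. Property 2: $|\mathbb{S}|=0$; each of $\ell,\ell'$ has at least one adjacent particle other than one located at the other location; the particles of $N(\ell)$ not at $\ell'$ are connected by paths within this set; the particles of $N(\ell')$ not at $\ell$ are connected by paths within this set. One step from $\sigma$: choose a particle $P$ uniformly (location $\ell$), a neighbor $\ell'$ of $\ell$ uniformly among six, and $q$ uniform in $(0,1)$. If $\ell'$ is occupied, do nothing. Otherwise let $t$ (resp. $t'$) be the number of triangular faces incident to $\ell$ (resp. $\ell'$) with all three vertices occupied when $P$ is at $\ell$ (resp. at $\ell'$); move $P$ to $\ell'$ if (1) $\ell$ does not have exactly five occupied neighbors, (2) $\ell,\ell'$ satisfy Property 1 or 2, and (3) $q<\lambda^{t'-t}$; else do nothing. $\pi$ is the stationary distribution of $\mathcal{M}$. *)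

(* Defs.v *)
From HB Require Import structures.
From mathcomp Require Import all_boot all_order all_algebra.
From mathcomp Require Import boolp reals exp.
Set Implicit Arguments. Unset Strict Implicit. Unset Printing Implicit Defensive.
Import Order.TTheory GRing.Theory Num.Theory.
Local Open Scope ring_scope.

(* A location is a pair of integers (x,y) standing for x*e1 + y*e2 with
   e1 = (1,0), e2 = (1/2, sqrt 3/2).  The six neighbours of a location are
   obtained by adding the six unit vectors below, listed in counterclockwise
   order (angles 0, 60, 120, 180, 240, 300 degrees). *)
Definition pt := (int * int)%type.

Definition dirs : seq pt :=
  [:: (1, 0); (0, 1); (-1, 1); (-1, 0); (0, -1); (1, -1)].

Definition dir (i : nat) : pt := nth (0, 0) dirs (i %% 6).

Definition addp (a b : pt) : pt := (a.1 + b.1, a.2 + b.2).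
Definition subp (a b : pt) : pt := (a.1 - b.1, a.2 - b.2).

Definition adj (a b : pt) : bool := subp b a \in dirs.

(* A configuration of n particles up to translation is represented by its
   unique translate whose minimal x-coordinate and minimal y-coordinate are 0.
   Since connected configurations of n particles have x- and y-extent at most
   n-1, this representative is a subset of the box 'I_n * 'I_n. *)
Definition B (n : nat) := ('I_n * 'I_n)%type.

Definition emb n (q : B n) : pt := ((q.1 : nat)%:Z, (q.2 : nat)%:Z).

Definition occ n (S : {set B n}) (p : pt) : bool := [exists q in S, emb q == p].

Definition canon n (S : {set B n}) : bool :=
  [exists q in S, (q.1 : nat) == 0%N] && [exists q in S, (q.2 : nat) == 0%N].

Definition connb n (S : {set B n}) : bool :=
  [forall x in S, forall y in S,
     connect (fun a b => [&& a \in S, b \in S & adj (emb a) (emb b)]) x y].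

(* A hole is a maximal finite connected set of unoccupied locations; i.e. an
   unoccupied location lies in a hole iff its connected component among the
   unoccupied locations is finite (equivalently bounded).  "No holes": every
   unoccupied location can reach arbitrarily far locations through
   unoccupied locations. *)
Definition noholes n (S : {set B n}) : Prop :=
  forall p : pt, ~~ occ S p ->
  forall N : nat, exists s : seq pt,
    [/\ path adj p s, all (fun x => ~~ occ S x) s &
        (N <= `|(last p s).1| + `|(last p s).2|)%N].

Definition inOmega n (S : {set B n}) : bool :=
  [&& #|S| == n, canon S, connb S & `[< noholes S >] ].

Definition Omega (n : nat) := {S : {set B n} | inOmega S}.

Definition boxpt n (p : pt) : option (B n) := [pick q : B n | emb q == p].

(* Darts (u, i) = edge from u to u + dir i.  Face-tracing map: after
   traversing the edge u -> v, leave v along the first occupied direction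
   counterclockwise after the direction pointing back to u (this keeps the
   traced face on the right). *)
Definition step n (S : {set B n}) (d : B n * 'I_6) : B n * 'I_6 :=
  let u := d.1 in let i := d.2 in
  match boxpt n (addp (emb u) (dir i)) with
  | Some v =>
      if v \in S then
        let b := (i + 3)%N in
        let k := find (fun k => occ S (addp (emb v) (dir (b + k)))) (iota 1 6) in
        (v, inord ((b + k.+1) %% 6))
      else d
  | None => d
  end.

(* the occupied location with largest x, then largest y, coordinate; its
   neighbours in directions 5, 0, 1 are unoccupied, so it lies on the
   external boundary *)
Definition start n (S : {set B n}) : option (B n) :=
  [pick u in S | [forall q in S,
      ((q.1 : nat) < u.1)%N || (((q.1 : nat) == u.1) && ((q.2 : nat) <= u.2)%N)]].

(* p(sigma): the length of the closed walk around the external boundary,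
   i.e. the length of the cycle of the face-tracing map through the dart
   leaving [start] along the first occupied direction counterclockwise after
   direction 1 (the external face is on its right). Length 0 for a single
   particle. *)
Definition perim n (S : {set B n}) : nat :=
  match start S with
  | Some u =>
      let k := find (fun k => occ S (addp (emb u) (dir (1 + k)))) (iota 1 6) in
      let j := ((1 + k.+1) %% 6)%N in
      if occ S (addp (emb u) (dir j)) then order (step S) (u, inord j) else 0%N
  | None => 0%N
  end.

Definition pmax (n : nat) : nat := (2 * n - 2)%N.

Definition nbrs (o : pt -> bool) (l : pt) : seq pt :=
  [seq addp l (dir i) | i <- iota 0 6 & o (addp l (dir i))].

Definition conn_in (A : seq pt) : Prop :=
  forall x y, x \in A -> y \in A ->
  exists s, [/\ path adj x s, all (mem A) s & last x s = y].

Definition Sset (o : pt -> bool) (l l' : pt) : seq pt :=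
  [seq p <- nbrs o l | p \in nbrs o l'].

Definition Nunion (o : pt -> bool) (l l' : pt) : seq pt :=
  [seq p <- undup (nbrs o l ++ nbrs o l') | (p != l) && (p != l')].

Definition prop1 (o : pt -> bool) (l l' : pt) : bool :=
  (size (Sset o l l') \in [:: 1%N; 2%N]) &&
  `[< forall x, x \in Nunion o l l' ->
        exists s, [/\ path adj x s, all (mem (Nunion o l l')) s &
                      last x s \in Sset o l l'] >].

Definition prop2 (o : pt -> bool) (l l' : pt) : bool :=
  let A := [seq p <- nbrs o l | p != l'] in
  let A' := [seq p <- nbrs o l' | p != l] in
  [&& size (Sset o l l') == 0%N, (0 < size A)%N, (0 < size A')%N,
      `[< conn_in A >] & `[< conn_in A' >] ].

(* number of triangular faces incident to l with all three vertices occupied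
   (l itself being occupied) *)
Definition tri (o : pt -> bool) (l : pt) : nat :=
  count (fun i => o (addp l (dir i)) && o (addp l (dir i.+1))) (iota 0 6).

Definition moved (o : pt -> bool) (l l' : pt) : pt -> bool :=
  fun p => (p == l') || ((p != l) && o p).

Definition moveok (o : pt -> bool) (l l' : pt) : bool :=
  [&& ~~ o l', size (nbrs o l) != 5%N & prop1 o l l' || prop2 o l l'].

Definition sameconf n (T : {set B n}) (o' : pt -> bool) : bool :=
  `[< exists v : pt, forall p, occ T p = o' (addp p v) >].

(* transition probability P(s, t) of M with bias lam: choose a particle
   (prob 1/n), a direction (prob 1/6), and accept a legal move with
   probability P(q < lam^(t'-t)) = min(1, lam^(t'-t)). *)
Definition Mkernel (R : realType) (lam : R) n (s t : Omega n) : R :=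
  \sum_(q in val s) \sum_(i < 6)
    ((6 * n)%:R)^-1 *
    (let o := occ (val s) in
     let l := emb q in
     let l' := addp l (dir i) in
     let o' := moved o l l' in
     let acc := Num.min 1 (lam ^ ((tri o' l')%:Z - (tri o l)%:Z)) in
     if moveok o l l' then acc * (sameconf (val t) o')%:R + (1 - acc) * (s == t)%:R
     else (s == t)%:R).

Definition stationary (R : realType) (lam : R) n (pi : Omega n -> R) : Prop :=
  [/\ forall s, 0 <= pi s, \sum_s pi s = 1 &
      forall t, \sum_s pi s * Mkernel lam s t = pi t].

Definition N50 (R : ringType) : R :=
  foldl (fun acc d => acc * 10%:R + d%:R) 0
    [:: 2;4;3;0;0;6;8;4;5;3;0;3;1;1;8;0;2;9;0;2;0;3;1;8;5;9;4;2;4;2;0;9;3;3]%N.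

(* Main.v *)
(* Moves preserve the number of particles, connectivity and the absence of holes, they are
   reversible, and any configuration can be moved to a vertical line by emptying its lowest
   rows one after another into columns. Hence the chain is irreducible on its states, and
   detailed balance and the maximum principle give pi(s) = lam^T(s) / Z, where T(s) <= 2n is the
   number of occupied triangles.

   The boundary walk meets every particle with an empty neighbour, so it determines the
   configuration, and at most n^2 6^k configurations have perimeter at most k. On the other hand
   Z >= K c^n lam^(2n) for some c > 1: stacks of rows of length at most 3 already suffice,
   because for lam <= 11/5 the transfer matrix of their weights lam^(T - 2n) has an eigenvalue
   larger than 1. The constant N50 enters only through (2 N50)^(1/100) < 11/5. Therefore the
   probability of perimeter at most beta (2n - 2) is at most n^2 6^(2 beta n) / (K c^n), which
   decays exponentially for small beta. *)
Require Import Defs.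
From HB Require Import structures.
From mathcomp Require Import all_boot all_order all_algebra finmap.
From mathcomp Require Import zify ring lra.
From mathcomp Require Import boolp reals exp.
Set Implicit Arguments. Unset Strict Implicit. Unset Printing Implicit Defensive.
Import Order.TTheory GRing.Theory Num.Theory.
Local Open Scope fset_scope.
Local Open Scope ring_scope.

(** * The lattice *)

(** Two obstacles shape the proof. A particle of the lowest row to be emptied may sit in a
    120-degree corner where neither climbing nor filling the notch is legal; such corners can be
    nested, and [ray] frees them recursively. And that one closed walk meets the whole boundary is a
    topological fact; a mod 2 potential on the lattice takes the place of a Jordan curve argument.
    The constants fit together as follows. A missing triangle costs a factor 1/lam, which is at
    least r = 5/11, so one estimate serves every lam. The transfer matrix grows by c^3 per row with
    c = 51/50, a row having at most three particles. The number e = 201/200 satisfies e^3 <= c and 6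
    <= e^600. With beta = 1/1200 the walk codes for n + 1 particles number at most (n+1)^2 e^n,
    against a denominator of order e^(3n); of the remaining e^(-2n), one factor absorbs the
    polynomial and the other is the claimed decay. The bound obtained is exponential in n, stronger
    than gamma^(sqrt n). *)

Lemma addpE (a b : pt) : addp a b = a + b. Proof. by []. Qed.
Lemma dir_modr i k : dir (i + k) = dir (i %% 6 + k).
Proof. by rewrite /dir modnDml. Qed.

Lemma dir_mod i : dir i = dir (i %% 6).
Proof. by rewrite /dir modn_mod. Qed.

(** Directions matter only modulo 6, so this rule reduces identities between them to six
    evaluations; periodicity of [dir] discharges the first premise. *)
Lemma dir6 (P : nat -> Prop) :
  (forall i, P (i %% 6)%N -> P i) -> P 0%N -> P 1%N -> P 2%N -> P 3%N -> P 4%N -> P 5%N ->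
  forall i, P i.
Proof.
move=> Pm P0 P1 P2 P3 P4 P5 i; apply: Pm.
by move: (ltn_mod i 6); case: (i %% 6)%N => [|[|[|[|[|[|]]]]]].
Qed.

Ltac dir_cases i :=
  pattern i; apply: dir6 => [{}i||||||];
  [by rewrite ?(dir_modr i) ?(dir_mod i)|by []|by []|by []|by []|by []|by []].

Lemma dirD6 i : dir (i + 6) = dir i.
Proof. by rewrite /dir modnDr. Qed.

Lemma dir_opp i : dir (i + 3) = - dir i.
Proof. dir_cases i. Qed.

Lemma dir_step i : dir i + dir (i + 2) = dir (i + 1).
Proof. dir_cases i. Qed.

Lemma dir_neq0 i : dir i != 0.
Proof. dir_cases i. Qed.

Lemma mem_dirs i : dir i \in dirs.
Proof. dir_cases i. Qed.

Lemma dirsP (v : pt) : reflect (exists2 i, (i < 6)%N & v = dir i) (v \in dirs).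
Proof.
apply: (iffP idP) => [vd|[i _ ->]]; last exact: mem_dirs.
exists (index v dirs); first by rewrite -index_mem in vd.
by rewrite /dir modn_small ?nth_index // -[6%N]/(size dirs) index_mem.
Qed.

Lemma adjE (a b : pt) : adj a b = (b - a \in dirs). Proof. by []. Qed.

Lemma adjP (a b : pt) : reflect (exists2 i, (i < 6)%N & b = a + dir i) (adj a b).
Proof.
rewrite adjE; apply: (iffP (dirsP _)) => -[i i6 e]; exists i => //.
  by rewrite -e addrC subrK.
by rewrite e addrC addKr.
Qed.

Lemma adj_dir (a : pt) i : adj a (a + dir i).
Proof. by rewrite adjE addrC addKr mem_dirs. Qed.

Lemma adj_sym : symmetric adj.
Proof.
move=> a b; apply/adjP/adjP => -[i _ ->];
 exists ((i + 3) %% 6)%N; rewrite ?ltn_mod // -dir_mod dir_opp addrK //.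
Qed.

Lemma adj_irr (a : pt) : adj a a = false.
Proof. by rewrite adjE subrr. Qed.

Lemma adj_add (a b v : pt) : adj (a + v) (b + v) = adj a b.
Proof. by rewrite !adjE opprD addrACA subrr addr0. Qed.

(** As in [conn_in] and [noholes], only the vertices after the start are constrained; hence the
    hypothesis [P x] in [conn_sym]. *)
Definition conn (P : pred pt) (x y : pt) : Prop :=
  exists s, [/\ path adj x s, all P s & last x s = y].

Lemma conn_refl P x : conn P x x. Proof. by exists [::]. Qed.

Lemma conn1 (P : pred pt) x y : adj x y -> P y -> conn P x y.
Proof. by move=> xy Py; exists [:: y]; rewrite /= xy Py. Qed.

Lemma conn_trans P y x z : conn P x y -> conn P y z -> conn P x z.
Proof.
move=> [s [ps Ps <-]] [t [pt Pt <-]]; exists (s ++ t).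
by rewrite cat_path ps all_cat Ps last_cat.
Qed.

Lemma conn_sym (P : pred pt) x y : P x -> conn P x y -> conn P y x.
Proof.
move=> Px [s [ps Ps <-]]; elim: s x Px ps Ps => [|z s IH] x Px /=.
  by move=> *; exact: conn_refl.
case/andP=> xz ps /andP[Pz Ps]; apply: conn_trans (IH _ Pz ps Ps) _.
by apply: conn1; rewrite // adj_sym.
Qed.

Lemma conn_mono (P Q : pred pt) x y : (forall z, P z -> Q z) -> conn P x y -> conn Q x y.
Proof. by move=> PQ [s [ps Ps e]]; exists s; split => //; apply: sub_all Ps. Qed.

Lemma conn_ind (P : pred pt) (K : pt -> Prop) x y :
  (forall u v, K u -> P v -> adj u v -> K v) -> K x -> conn P x y -> K y.
Proof.
move=> KP + [s [ps Ps <-]]; elim: s x ps Ps => [|z s IH] x //=.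
by case/andP=> xz ps /andP[Pz Ps] Kx; apply: IH => //; apply: KP xz.
Qed.

(* A path through [z] is repaired by joining the neighbours of [z] inside [Q]. *)
Lemma conn_reroute (P Q : pred pt) z :
  (forall x, P x -> x != z -> Q x) ->
  (forall x y, P x -> P y -> adj z x -> adj z y -> conn Q x y) ->
  forall x y, P x -> x != z -> y != z -> conn P x y -> conn Q x y.
Proof.
move=> PQ Pz x y Px xz yz [s [ps Ps e]].
have [m] := ubnP (size s); elim: m s x Px xz ps Ps e => // m IH [|v s] x Px xz /=.
  by move=> _ _ <- _; exact: conn_refl.
case/andP=> xv ps /andP[Pv Ps] e; rewrite ltnS => sm.
have [vz|vz] := eqVneq v z; last first.
  apply: conn_trans (conn1 xv (PQ _ Pv vz)) _.
  by apply: (IH s).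
subst v; case: s ps Ps e sm => [|w s] /=; first by move=> _ _ e; rewrite e eqxx in yz.
case/andP=> zw ps /andP[Pw Ps] e sm.
have wz : w != z by apply: contraTneq zw => ->; rewrite adj_irr.
apply: conn_trans (Pz x w Px Pw _ zw) _; first by rewrite adj_sym.
by apply: (IH s) => //; apply: ltnW.
Qed.

(* The eight locations around the edge from [l] to [l + dir i], in cyclic order;
   0 and 4 are the two common neighbours, 1-3 are the others of [l + dir i], 5-7 those of [l]. *)
Definition ring8 (l : pt) i k : pt :=
  nth 0 [:: l + dir (i + 1); l + dir i + dir (i + 1); l + dir i + dir i;
            l + dir i + dir (i + 5); l + dir (i + 5);
            l + dir (i + 4); l + dir (i + 3); l + dir (i + 2)] k.

Lemma ring8_adj l i k : (k < 7)%N -> adj (ring8 l i k) (ring8 l i k.+1).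
Proof.
have H (a b v : pt) : adj a b -> adj (v + a) (v + b) by rewrite ![v + _]addrC adj_add.
case: k => [|[|[|[|[|[|[|]]]]]]] //= _; rewrite /ring8 /=.
- by rewrite -!addrA H // adjE addrK mem_dirs.
- by apply: H; elim/dir6: i => // i; rewrite (dir_modr i) (dir_mod i).
- by apply: H; elim/dir6: i => // i; rewrite (dir_modr i) (dir_mod i).
- by rewrite -!addrA H // adj_sym adjE addrK mem_dirs.
- by apply: H; elim/dir6: i => // i; rewrite !(dir_modr i).
- by apply: H; elim/dir6: i => // i; rewrite !(dir_modr i).
- by apply: H; elim/dir6: i => // i; rewrite !(dir_modr i).
Qed.

Lemma ring8_adj0 l i : adj (ring8 l i 7) (ring8 l i 0).
Proof.
rewrite /ring8 /= ![l + _]addrC adj_add.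
dir_cases i.
Qed.

Lemma mem_nbrs o l p : (p \in nbrs o l) = adj l p && o p.
Proof.
rewrite /nbrs; apply/mapP/andP => [[j]|[/adjP[j j6 ->] op]].
  by rewrite mem_filter => /andP[oj _] ->; rewrite addpE adj_dir.
by exists j; rewrite // mem_filter mem_iota op.
Qed.

Lemma uniq_nbrs o l : uniq (nbrs o l).
Proof.
rewrite /nbrs map_inj_in_uniq ?filter_uniq ?iota_uniq // => j k.
rewrite !mem_filter !mem_iota /= => /andP[_ j6] /andP[_ k6] /addrI.
rewrite /dir !modn_small // => /eqP; rewrite nth_uniq //; first by move/eqP.
Qed.

Lemma size_nbrs (o : pt -> bool) (l : pt) i :
  size (nbrs o l) = (o (l + dir i)%R + o (l + dir (i + 1))%R + o (l + dir (i + 2))%R +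
    o (l + dir (i + 3))%R + o (l + dir (i + 4))%R + o (l + dir (i + 5))%R)%N.
Proof.
rewrite size_map size_filter; pattern i; apply: dir6 => [{}i||||||].
  by rewrite !(dir_modr i) (dir_mod i).
all: rewrite /= !addpE /dir /=; lia.
Qed.

Lemma adj_ring_l l i p :
  adj l p -> p = l + dir i \/ exists2 k, k \in [:: 0; 4; 5; 6; 7]%N & p = ring8 l i k.
Proof.
case/adjP=> j j6 ->.
have [k k6 ->] : exists2 k, (k < 6)%N & dir j = dir (i + k).
  (* The index of [dir j] relative to [i]; the added 6 keeps the natural subtraction from
     truncating. *)
  exists ((j + 6 - i %% 6) %% 6)%N; first by rewrite ltn_mod.
  rewrite /dir modnDmr; congr nth; rewrite -[((i + _) %% 6)%N]modnDml.
  have := ltn_mod i 6; move: (i %% 6)%N => i' i6; rewrite subnKC; last by lia.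
  by rewrite modnDr.
case: k k6 => [|[|[|[|[|[|]]]]]] // _; first by left; rewrite addn0.
all: right.
- by exists 0%N.
- by exists 7%N.
- by exists 6%N.
- by exists 5%N.
- by exists 4%N.
Qed.

Lemma adj_ring_r l i p :
  adj (l + dir i) p -> p = l \/ exists2 k, k \in [:: 0; 1; 2; 3; 4]%N & p = ring8 l i k.
Proof.
case/adjP=> j j6 ->.
have [k k6 ->] : exists2 k, (k < 6)%N & dir j = dir (i + k).
  exists ((j + 6 - i %% 6) %% 6)%N; first by rewrite ltn_mod.
  rewrite /dir modnDmr; congr nth; rewrite -[((i + _) %% 6)%N]modnDml.
  have := ltn_mod i 6; move: (i %% 6)%N => i' i6; rewrite subnKC; last by lia.
  by rewrite modnDr.
have e4 : dir i + dir (i + 4) = dir (i + 5).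
  move: i => i0; clear -i0; dir_cases i0.
case: k k6 => [|[|[|[|[|[|]]]]]] // _.
- by right; exists 2%N; rewrite //= addn0.
- by right; exists 1%N.
- by right; exists 0%N; rewrite // -addrA dir_step.
- by left; rewrite dir_opp addrK.
- by right; exists 4%N; rewrite // -addrA e4.
- by right; exists 3%N.
Qed.

Lemma ring8_l l i k : k \in [:: 0; 4; 5; 6; 7]%N -> adj l (ring8 l i k).
Proof.
by rewrite !inE => /or4P[|||/orP[]] /eqP ->; rewrite /ring8 /= adj_dir.
Qed.

Lemma ring8_r l i k : k \in [:: 0; 1; 2; 3; 4]%N -> adj (l + dir i) (ring8 l i k).
Proof.
have e4 : dir i + dir (i + 4) = dir (i + 5).
  dir_cases i.
rewrite !inE => /or4P[|||/orP[]] /eqP ->; rewrite /ring8 /= ?adj_dir //.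
  by rewrite -dir_step addrA adj_dir.
by rewrite -e4 addrA adj_dir.
Qed.

Lemma ring8_neq_l l i k : (k < 8)%N -> ring8 l i k != l.
Proof.
move=> k8; have [/ring8_l e|] := boolP (k \in [:: 0; 4; 5; 6; 7]%N).
  by have := e l i; apply: contraTneq => ->; rewrite adj_irr.
have ne (v w : pt) : v + w != 0 -> l + v + w != l.
  by move=> vw; rewrite -addrA -subr_eq0 (addrC l) addrK.
case: k k8 => [|[|[|[|[|[|[|[|]]]]]]]] // _ _; apply: ne.
- dir_cases i.
- dir_cases i.
- dir_cases i.
Qed.

Lemma ring8_neq_r l i k : (k < 8)%N -> ring8 l i k != l + dir i.
Proof.
move=> k8; have [/ring8_r e|] := boolP (k \in [:: 0; 1; 2; 3; 4]%N).
  by have := e l i; apply: contraTneq => ->; rewrite adj_irr.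
have ne (v w : pt) : v != w -> l + v != l + w by rewrite (inj_eq (addrI l)).
case: k k8 => [|[|[|[|[|[|[|[|]]]]]]]] // _ _; apply: ne;
  dir_cases i.
Qed.

Lemma ring8_inj04 l i : ring8 l i 0 != ring8 l i 4.
Proof.
rewrite /ring8 /= (inj_eq (addrI l)).
dir_cases i.
Qed.

Lemma ring8_common l i k : (k < 8)%N ->
  adj l (ring8 l i k) -> adj (l + dir i) (ring8 l i k) -> (k == 0%N) || (k == 4%N).
Proof.
have A (v w : pt) : adj l (l + v + w) = (v + w \in dirs) by rewrite adjE addrC -(addrA l) addKr.
have C (v w : pt) : adj (l + v) (l + w) = (w - v \in dirs).
  by rewrite ![l + _]addrC adj_add adjE.
case: k => [|[|[|[|[|[|[|[|]]]]]]]] //= _; rewrite /ring8 /= ?A ?C.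
- dir_cases i.
- dir_cases i.
- dir_cases i.
- by move=> _; elim/dir6: i => // i; rewrite !(dir_modr i) (dir_mod i).
- by move=> _; elim/dir6: i => // i; rewrite !(dir_modr i) (dir_mod i).
- by move=> _; elim/dir6: i => // i; rewrite !(dir_modr i) (dir_mod i).
Qed.

(** * Legal moves *)

Lemma chain_conn (P : pred pt) (p : nat -> pt) k n :
  (forall j, (k <= j < k + n)%N -> adj (p j) (p j.+1)) ->
  (forall j, (k <= j <= k + n)%N -> P (p j)) -> conn P (p k) (p (k + n)%N).
Proof.
elim: n => [|n IH] ap Pp; first by rewrite addn0; apply: conn_refl.
apply: (conn_trans (y := p (k + n)%N)).
  by apply: IH => j jk; [apply: ap | apply: Pp]; lia.
by rewrite addnS; apply: conn1; [apply: ap | apply: Pp]; lia.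
Qed.

Lemma chain_conn_sym (P : pred pt) (p : nat -> pt) k m :
  (forall j, (j < 4)%N -> adj (p j) (p j.+1)) -> (k <= m <= 4)%N ->
  (forall j, (k <= j <= m)%N -> P (p j)) -> conn P (p k) (p m) /\ conn P (p m) (p k).
Proof.
move=> ap km Pp; have C : conn P (p k) (p m).
  rewrite -(subnKC (_ : k <= m)%N); last by lia.
  by apply: chain_conn => j jk; [apply: ap | apply: Pp]; lia.
by split=> //; apply: conn_sym C; apply: Pp; lia.
Qed.

(* The bits [b k] say which locations [ring8 l i k] around a move along an edge are occupied.
   [side_ok] reads those around one endpoint in the order 0..4: each occupied one is joined to a
   common neighbour. The two disjuncts of [ring_ok] are Properties 1 and 2. *)
Definition side_ok (b : nat -> bool) :=
  [&& b 1 ==> b 0 || [&& b 2, b 3 & b 4],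
      b 2 ==> (b 1 && b 0) || (b 3 && b 4) &
      b 3 ==> b 4 || [&& b 2, b 1 & b 0]]%N.

Definition arc_ok (b : nat -> bool) :=
  [&& ~~ b 0, ~~ b 4, [|| b 1, b 2 | b 3] & ~~ [&& b 1, ~~ b 2 & b 3]]%N.

(** A property of five bits is settled by evaluating it on all 32 lists, which replaces case
    analyses on occupied and empty locations below. *)
Lemma all_bits (Q : (nat -> bool) -> bool) :
  all (fun b0 => all (fun b1 => all (fun b2 => all (fun b3 => all (fun b4 =>
    Q (nth false [:: b0; b1; b2; b3; b4])) [:: true; false]) [:: true; false])
    [:: true; false]) [:: true; false]) [:: true; false] ->
  forall b, Q (nth false [:: b 0; b 1; b 2; b 3; b 4])%N.
Proof.
have B (c : bool) : c \in [:: true; false] by case: c.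
move=> /allP H b.
by move: H => /(_ _ (B (b 0%N)))/allP/(_ _ (B (b 1%N)))/allP/(_ _ (B (b 2%N)))/allP
  /(_ _ (B (b 3%N)))/allP/(_ _ (B (b 4%N))).
Qed.

Definition for5 (Q : nat -> nat -> bool) := all (fun k => all (Q k) (iota 0 5)) (iota 0 5).

Lemma for5P Q k m : for5 Q -> (k <= 4)%N -> (m <= 4)%N -> Q k m.
Proof. by move=> /allP H k4 m4; apply: (allP (H k _)); rewrite mem_iota. Qed.

Lemma nth_bits (b : nat -> bool) k : (k <= 4)%N ->
  nth false [:: b 0; b 1; b 2; b 3; b 4]%N k = b k.
Proof. by case: k => [|[|[|[|[|]]]]]. Qed.

Lemma all_nth_bits (b : nat -> bool) k m (f : bool -> bool) : (k + m <= 5)%N ->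
  all (fun j => f (nth false [:: b 0; b 1; b 2; b 3; b 4]%N j)) (iota k m) =
  all (fun j => f (b j)) (iota k m).
Proof. by move=> km; apply: eq_in_all => j; rewrite mem_iota => jm; rewrite nth_bits //; lia. Qed.

(** The arc around [l], read from one common neighbour to the other like the arc 0..4 around the
    other endpoint, so that each lemma on arcs serves both. *)
Definition otherside (k : nat) : nat := nth 0%N [:: 0; 7; 6; 5; 4]%N k.

Definition ring_ok (b : nat -> bool) :=
  [&& b 0 || b 4, side_ok b, side_ok (b \o otherside) & ~~ [&& b 0, b 4, b 5, b 6 & b 7]]%N
  || arc_ok b && arc_ok (b \o otherside).

Section Chain.
Variables (P : pred pt) (p : nat -> pt).
Hypothesis ap : forall j, (j < 4)%N -> adj (p j) (p j.+1).

(** [side_ok] forces all locations between an occupied one and some end of the arc to be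
    occupied. *)
Lemma side_conn k : side_ok (P \o p) -> (k <= 4)%N -> P (p k) ->
  P (p 0%N) /\ conn P (p k) (p 0%N) \/ P (p 4%N) /\ conn P (p k) (p 4%N).
Proof.
move=> ok k4 Pk.
have : (all (P \o p) (iota 0 k.+1)) || (all (P \o p) (iota k (5 - k))).
  have := all_bits (Q := fun b => for5 (fun k m =>
    [==> side_ok b, b k => all b (iota 0 k.+1) || all b (iota k (5 - k))])) isT (P \o p).
  move=> /for5P - /(_ k 0%N k4 isT); rewrite !nth_bits // !(all_nth_bits (P \o p) id); [|lia..].
  by move=> /implyP/(_ ok)/implyP/(_ Pk).
case/orP=> /allP aP.
  left; split; first by apply: aP; rewrite mem_iota.
  by apply: (chain_conn_sym (k := 0) (m := k) ap _ _).2 => [|j jk]; [lia | apply: aP; rewrite mem_iota; lia].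
right; split; first by apply: aP; rewrite mem_iota; lia.
by apply: (chain_conn_sym (k := k) (m := 4) ap _ _).1 => [|j jk]; [lia | apply: aP; rewrite mem_iota; lia].
Qed.

(** The occupied locations are among the three inner ones, and the pattern missing only the middle
    one is excluded, so they form an interval. *)
Lemma arc_conn k m : arc_ok (P \o p) -> (k <= 4)%N -> (m <= 4)%N ->
  P (p k) -> P (p m) -> conn P (p k) (p m).
Proof.
move=> ok.
wlog km : k m / (k <= m)%N.
  move=> W k4 m4 Pk Pm; have [km|mk] := leqP k m; first exact: W.
  by apply: conn_sym => //; apply: W => //; apply: ltnW.
move=> k4 m4 Pk Pm.
have /allP aP : all (P \o p) (iota k (m - k).+1).
  have := all_bits (Q := fun b => for5 (fun k m =>
    [==> arc_ok b, b k, b m => all b (iota k (m - k).+1)])) isT (P \o p).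
  move=> /for5P - /(_ k m k4 m4); rewrite !nth_bits // (all_nth_bits (P \o p) id); last lia.
  by move=> /implyP/(_ ok)/implyP/(_ Pk)/implyP/(_ Pm).
by apply: (chain_conn_sym (k := k) (m := m) ap _ _).1 => [|j jk];
  [lia | apply: aP; rewrite mem_iota; lia].
Qed.

(** The counterpart for empty locations. Under Property 1 the occupied ones fill an initial and a
    final segment, so the empty ones form an interval. Under Property 2 the empty ones form two end
    segments, joined through [z], which will be the vacated location. *)
Lemma gap_conn (b : nat -> bool) z k m :
  (forall j, (j <= 4)%N -> ~~ b j -> P (p j)) ->
  (b 0%N || b 4%N) && side_ok b \/ arc_ok b /\ [/\ P z, adj (p 0%N) z & adj z (p 4%N)] ->
  (k <= 4)%N -> (m <= 4)%N -> ~~ b k -> ~~ b m -> conn P (p k) (p m).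
Proof.
move=> bP ok.
wlog km : k m / (k <= m)%N.
  move=> W k4 m4 Pk Pm; have [km|mk] := leqP k m; first exact: W.
  by apply: conn_sym; [exact: bP | apply: W => //; apply: ltnW].
move=> k4 m4 bk bm.
have [aE|naE] := boolP (all (predC b) (iota k (m - k).+1)).
  apply: (chain_conn_sym (k := k) (m := m) ap _ _).1 => [|j jk]; first lia.
  by apply: bP; [lia | move/allP: aE; apply; rewrite mem_iota; lia].
case: ok => [ok|[ok [Pz z0 z4]]].
  exfalso; have := all_bits (Q := fun b => for5 (fun k m =>
    [==> (b 0%N || b 4%N) && side_ok b, ~~ b k, ~~ b m => all (fun j => ~~ b j) (iota k (m - k).+1)]))
    isT b.
  move=> /for5P - /(_ k m k4 m4); rewrite !nth_bits // (all_nth_bits b negb); last lia.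
  by move=> /implyP/(_ ok)/implyP/(_ bk)/implyP/(_ bm); apply/negP.
have : all (predC b) (iota 0 k.+1 ++ iota m (5 - m)).
  have := all_bits (Q := fun b => for5 (fun k m =>
    [==> arc_ok b, ~~ b k, ~~ b m, (k <= m)%N, ~~ all (fun j => ~~ b j) (iota k (m - k).+1)
       => all (fun j => ~~ b j) (iota 0 k.+1) && all (fun j => ~~ b j) (iota m (5 - m))])) isT b.
  move=> /for5P - /(_ k m k4 m4); rewrite !nth_bits // !(all_nth_bits b negb); [|lia..].
  rewrite all_cat.
  by move=> /implyP/(_ ok)/implyP/(_ bk)/implyP/(_ bm)/implyP/(_ km)/implyP/(_ naE).
move=> /allP aE; apply: (conn_trans (y := p 0%N)).
  apply: (chain_conn_sym (k := 0) (m := k) ap _ _).2 => [|j jk]; first lia.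
  by apply: bP; [lia | apply: aE; rewrite mem_cat !mem_iota; lia].
apply: conn_trans (conn1 z0 Pz) _; apply: (conn_trans (y := p 4%N)).
  by apply: conn1 z4 _; apply: bP => //; apply: aE; rewrite mem_cat !mem_iota; lia.
apply: (chain_conn_sym (k := m) (m := 4) ap _ _).2 => [|j jk]; first lia.
by apply: bP; [lia | apply: aE; rewrite mem_cat !mem_iota; lia].
Qed.

End Chain.

Lemma otherside_adj l i j : (j < 4)%N ->
  adj (ring8 l i (otherside j)) (ring8 l i (otherside j.+1)).
Proof.
by case: j => [|[|[|[|]]]] // _; rewrite adj_sym /otherside /=; [exact: ring8_adj0|apply: ring8_adj..].
Qed.

Lemma mem_Sset o l i p : (p \in Sset o l (l + dir i)) =
  o p && ((p == ring8 l i 0) || (p == ring8 l i 4)).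
Proof.
rewrite /Sset mem_filter !mem_nbrs; apply/idP/idP.
  case/andP => /andP[al op] /andP[al' _]; rewrite op.
  case: (adj_ring_l i al') => [e|[k k8 e]]; first by rewrite e adj_irr in al.
  move: k8 al al'; rewrite e => k8 al al'.
  have k8' : (k < 8)%N by move: k8; rewrite !inE => /or4P[|||/orP[]] /eqP ->.
  by case/orP: (ring8_common k8' al' al) => /eqP ->; rewrite eqxx ?orbT.
by case/andP=> -> /orP[] /eqP ->; rewrite ?ring8_l ?ring8_r.
Qed.

Lemma size_Sset o l i : size (Sset o l (l + dir i)) = (o (ring8 l i 0) + o (ring8 l i 4))%N.
Proof.
have E : perm_eq (Sset o l (l + dir i)) [seq p <- [:: ring8 l i 0; ring8 l i 4] | o p].
  apply: uniq_perm.
  - by rewrite filter_uniq // uniq_nbrs.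
  - by rewrite filter_uniq //= inE ring8_inj04.
  - by move=> p; rewrite mem_Sset mem_filter !inE.
by rewrite (perm_size E) /=; case: (o _); case: (o _).
Qed.

Lemma mem_Nunion o l i p : p \in Nunion o l (l + dir i) -> o p /\ exists2 k, (k < 8)%N & p = ring8 l i k.
Proof.
rewrite /Nunion mem_filter mem_undup mem_cat !mem_nbrs => /andP[/andP[cells pl']].
case/orP => /andP[a op]; split=> //.
  case: (adj_ring_l i a) => [e|[k k8 e]]; first by rewrite e eqxx in pl'.
  by exists k => //; move: k8; rewrite !inE => /or4P[|||/orP[]] /eqP ->.
case: (adj_ring_r a) => [e|[k k8 e]]; first by rewrite e eqxx in cells.
by exists k => //; move: k8; rewrite !inE => /or4P[|||/orP[]] /eqP ->.
Qed.

Lemma Nunion_ring8 (o : pt -> bool) l i k :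
  (k < 8)%N -> o (ring8 l i k) -> ring8 l i k \in Nunion o l (l + dir i).
Proof.
move=> k8 ok; rewrite /Nunion mem_filter mem_undup mem_cat !mem_nbrs ok ring8_neq_l // ring8_neq_r //.
by move: k8; clear ok; case: k => [|[|[|[|[|[|[|[|]]]]]]]] // _;
  first [by rewrite ring8_l | by rewrite ring8_r // orbT].
Qed.

Lemma ring_side k : (k < 8)%N -> (k <= 4)%N \/ exists2 j, (j <= 4)%N & k = otherside j.
Proof.
case: k => [|[|[|[|[|[|[|[|]]]]]]]] // _; try by left.
- by right; exists 3%N.
- by right; exists 2%N.
- by right; exists 1%N.
Qed.

Lemma ring_ok_moveok (o : pt -> bool) l i :
  ~~ o (l + dir i) -> ring_ok (fun k => o (ring8 l i k)) -> moveok o l (l + dir i).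
Proof.
move=> nol'; rewrite /moveok nol' /= (size_nbrs o l i) (negbTE nol') add0n.
have E k : (k < 5)%N -> o (l + dir (i + k.+1)) = o (ring8 l i (nth 0%N [:: 0; 7; 6; 5; 4]%N k)).
  by case: k => [|[|[|[|[|]]]]].
rewrite !E //=; move=> ok; apply/andP; split.
  (* Both disjuncts of [ring_ok] rule out five occupied neighbours of [l]; this is checked on all
     values of the bits. *)
  move: ok; rewrite /ring_ok /arc_ok /side_ok /=.
  do 8!case: (o _) => //.
case/orP: ok => [/and4P[S s1 s2 _]|/andP[a1 a2]]; apply/orP.
  left; rewrite /prop1 size_Sset; apply/andP; split.
    by move: S; case: (o _); case: (o _).
  set N := Nunion _ _ _.
  have NE k : (k < 8)%N -> (ring8 l i k \in N) = o (ring8 l i k).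
    move=> k8; apply/idP/idP => [/mem_Nunion[]//|]; exact: Nunion_ring8.
  apply/asboolP => x xN; have [ox [k k8 ex]] := mem_Nunion xN.
  pose P : pred pt := fun p => p \in N.
  have Pr j : (j < 8)%N -> P (ring8 l i j) = o (ring8 l i j) by exact: NE.
  have : exists2 y, (y == ring8 l i 0) || (y == ring8 l i 4) & P y /\ conn P x y.
    case: (ring_side k8) => [k4|[j j4 ek]].
      have := @side_conn P (ring8 l i) (fun j j4 => ring8_adj l i (leq_trans j4 (isT : 4 <= 7)%N)) k.
      rewrite -ex; case=> //.
      - by move: s1; rewrite /side_ok /= !Pr.
      - by case=> ? ?; exists (ring8 l i 0); rewrite ?eqxx.
      - by case=> ? ?; exists (ring8 l i 4); rewrite ?eqxx ?orbT.
    have := @side_conn P (ring8 l i \o otherside) (@otherside_adj l i) j.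
    rewrite /= -ek -ex; case=> //.
    - by move: s2; rewrite /side_ok /= !Pr.
    - by case=> ? ?; exists (ring8 l i 0); rewrite ?eqxx.
    - by case=> ? ?; exists (ring8 l i 4); rewrite ?eqxx ?orbT.
  case=> y ye [yP [s [ps Ps ls]]]; exists s; split=> //.
  by rewrite ls mem_Sset ye andbT; have [] := mem_Nunion yP.
right; rewrite /prop2 size_Sset.
case/and4P: (a1) => /= /negbTE n0 /negbTE n4 ne1 _.
case/and4P: (a2) => /= _ _ ne2 _.
have S (w l2 : pt) (k : nat) :
  ring8 l i k != w -> adj l2 (ring8 l i k) -> o (ring8 l i k) ->
  ring8 l i k \in [seq p <- nbrs o l2 | p != w] by rewrite mem_filter mem_nbrs => -> -> ->.
have gt0 (s : seq pt) x : x \in s -> (0 < size s)%N by case: s.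
apply/and5P; split.
- by rewrite n0 n4.
- by case/or3P: ne2 => b; eapply gt0; apply: S b; rewrite ?ring8_neq_r // ring8_l.
- by case/or3P: ne1 => b; eapply gt0; apply: S b; rewrite ?ring8_neq_l // ring8_r.
- apply/asboolP => x y; rewrite !mem_filter !mem_nbrs => /and3P[xl' /(adj_ring_l i) ax ox].
  move=> /and3P[yl' /(adj_ring_l i) ay oy].
  case: ax xl' => [->|[k kr ex] _]; first by rewrite eqxx.
  case: ay yl' => [->|[m mr ey] _]; first by rewrite eqxx.
  pose P : pred pt := fun p => p \in [seq p <- nbrs o l | p != l + dir i].
  have PE j : j \in [:: 0; 4; 5; 6; 7]%N -> P (ring8 l i j) = o (ring8 l i j).
    move=> jr; rewrite /P mem_filter mem_nbrs ring8_l // ring8_neq_r //.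
    by move: jr; rewrite !inE => /or4P[|||/orP[]] /eqP ->.
  have O j : j \in [:: 0; 4; 5; 6; 7]%N -> exists2 j', (j' <= 4)%N & j = otherside j'.
    rewrite !inE => /or4P[|||/orP[]] /eqP ->; [by exists 0%N|by exists 4%N|by exists 3%N|
      by exists 2%N|by exists 1%N].
  have [k' k4 ek] := O _ kr; have [m' m4 em] := O _ mr.
  have : conn P x y.
    rewrite ex ey ek em; apply: (@arc_conn P (ring8 l i \o otherside)) => //=.
    + exact: otherside_adj.
    + by move: a2; rewrite /arc_ok /= !PE.
    + by rewrite -ek PE // -ex.
    + by rewrite -em PE // -ey.
  by case=> s [? ? ?]; exists s.
- apply/asboolP => x y; rewrite !mem_filter !mem_nbrs => /and3P[xl' /adj_ring_r ax ox].
  move=> /and3P[yl' /adj_ring_r ay oy].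
  case: ax xl' => [->|[k kr ex] _]; first by rewrite eqxx.
  case: ay yl' => [->|[m mr ey] _]; first by rewrite eqxx.
  pose P : pred pt := fun p => p \in [seq p <- nbrs o (l + dir i) | p != l].
  have PE j : j \in [:: 0; 1; 2; 3; 4]%N -> P (ring8 l i j) = o (ring8 l i j).
    move=> jr; rewrite /P mem_filter mem_nbrs ring8_r // ring8_neq_l //.
    by move: jr; rewrite !inE => /or4P[|||/orP[]] /eqP ->.
  have O j : j \in [:: 0; 1; 2; 3; 4]%N -> (j <= 4)%N.
    by rewrite !inE => /or4P[|||/orP[]] /eqP ->.
  have : conn P x y.
    rewrite ex ey; apply: (@arc_conn P (ring8 l i)) => //=.
    + by move=> j j4; apply: ring8_adj; apply: leq_trans j4 _.
    + by move: a1; rewrite /arc_ok /= !PE.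
    + exact: O.
    + exact: O.
    + by rewrite PE // -ex.
    + by rewrite PE // -ey.
  by case=> s [? ? ?]; exists s.
Qed.

(** * Legal moves preserve connectivity and the absence of holes *)

Definition connected (A : {fset pt}) :=
  forall x y, x \in A -> y \in A -> conn (fun p => p \in A) x y.

Definition norm1 (p : pt) : nat := (`|p.1| + `|p.2|)%N.

Arguments norm1 p%_R.

Definition holefree (A : {fset pt}) := forall p, p \notin A ->
  forall N, exists2 q, conn (fun p => p \notin A) p q & (N <= norm1 q)%N.

Definition swap (A : {fset pt}) (l l' : pt) : {fset pt} := l' |` (A `\ l).

Lemma in_swap A l l' p : (p \in swap A l l') = (p == l') || ((p != l) && (p \in A)).
Proof. by rewrite /swap in_fset1U in_fsetD1. Qed.

Section Preserve.
Variables (A : {fset pt}) (l : pt) (i : nat).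
Let l' := l + dir i.
Hypotheses (lA : l \in A) (l'A : l' \notin A).
Hypothesis ok : ring_ok (fun k => ring8 l i k \in A).

Let Q : pred pt := fun p => p \in swap A l l'.

Let ll' : l != l'. Proof. by apply: contraNneq l'A => <-. Qed.

Let ring_swap k : (k < 8)%N -> Q (ring8 l i k) = (ring8 l i k \in A).
Proof. by move=> k8; rewrite /Q in_swap (negbTE (ring8_neq_r _ _ k8)) ring8_neq_l. Qed.

Let Ql : Q l = false. Proof. by rewrite /Q in_swap eqxx (negbTE ll'). Qed.

Let adj8 j : (j < 4)%N -> adj (ring8 l i j) (ring8 l i j.+1).
Proof. by move=> j4; apply: ring8_adj; apply: leq_trans j4 _. Qed.

Let nbr_l x : adj l x -> x != l' -> exists2 j, (j <= 4)%N & x = ring8 l i (otherside j).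
Proof.
case/(adj_ring_l i) => [->|[k kr ->]]; first by rewrite eqxx.
move=> _; move: kr; rewrite !inE => /or4P[|||/orP[]] /eqP ->;
  [by exists 0%N|by exists 4%N|by exists 3%N|by exists 2%N|by exists 1%N].
Qed.

Let nbr_l' x : adj l' x -> x != l -> exists2 j, (j <= 4)%N & x = ring8 l i j.
Proof.
case/adj_ring_r => [->|[k kr ->]]; first by rewrite eqxx.
by move=> _; exists k => //; move: kr; rewrite !inE => /or4P[|||/orP[]] /eqP ->.
Qed.

Let os8 j : (j <= 4)%N -> (otherside j < 8)%N.
Proof. by case: j => [|[|[|[|[|]]]]]. Qed.

Let detour x y : x \in A -> y \in A -> adj l x -> adj l y -> conn Q x y.
Proof.
move=> xA yA lx ly.
have xl' : x != l' by apply: contraNneq l'A => <-.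
have yl' : y != l' by apply: contraNneq l'A => <-.
have [j j4 ex] := nbr_l lx xl'; have [m m4 ey] := nbr_l ly yl'.
case/orP: ok => [/and4P[_ _ s2 _]|/andP[_ a2]]; last first.
  rewrite ex ey; apply: (@arc_conn Q (ring8 l i \o otherside)) => //.
  - exact: otherside_adj.
  - by move: a2; rewrite /arc_ok /= !ring_swap.
  - by rewrite /= ring_swap ?os8 // -ex.
  - by rewrite /= ring_swap ?os8 // -ey.
(* Property 1: every occupied neighbour of [l] reaches a common neighbour, and common neighbours are
   joined through the particle now at [l']. *)
have toS n : (n <= 4)%N -> ring8 l i (otherside n) \in A ->
   exists2 z, [/\ adj l' z, Q z & z \in A] & conn Q (ring8 l i (otherside n)) z.
  move=> n4 nA.
  case: (@side_conn Q (ring8 l i \o otherside) (@otherside_adj l i) n) => //=.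
  - by move: s2; rewrite /side_ok /= !ring_swap.
  - by rewrite ring_swap ?os8.
  - case=> Q0 c; exists (ring8 l i 0) => //; split=> //; first exact: ring8_r.
    by rewrite -ring_swap.
  - case=> Q4 c; exists (ring8 l i 4) => //; split=> //; first exact: ring8_r.
    by rewrite -ring_swap.
have [z [lz Qz zA] cz] := toS j j4 (ltac:(by rewrite -ex)).
have [w [lw Qw wA] cw] := toS m m4 (ltac:(by rewrite -ey)).
rewrite ex; apply: conn_trans cz _.
apply: (conn_trans (y := l')).
  by apply: conn1; rewrite ?(adj_sym z) // /Q in_swap eqxx.
apply: conn_trans (conn1 lw Qw) _; rewrite ey; apply: conn_sym => //.
by rewrite ring_swap ?os8 // -ey.
Qed.

(** A path through the vacated [l] is repaired by [detour]; all particles, the moved one included,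
    are linked to one neighbour [n0] of [l']. *)
Lemma swap_connected : connected A -> connected (swap A l l').
Proof.
move=> cA.
have [n0 [n0A l'n0 n0l]] : exists n0, [/\ n0 \in A, adj l' n0 & n0 != l].
  have [k k4 kA] : exists2 k, (k <= 4)%N & ring8 l i k \in A.
    case/orP: ok => [/and4P[/orP[b|b] _ _ _]|/andP[/and4P[_ _ /or3P[b|b|b] _] _]].
    - by exists 0%N. - by exists 4%N. - by exists 1%N. - by exists 2%N. - by exists 3%N.
  exists (ring8 l i k); split=> //; last by rewrite ring8_neq_l // (leq_ltn_trans k4).
  by apply: ring8_r; move: k4; rewrite !inE; case: k {kA} => [|[|[|[|[|]]]]].
have Qn0 : Q n0 by rewrite /Q in_swap n0l n0A orbT.
have toN x : Q x -> conn Q x n0.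
  rewrite {1}/Q in_swap => /orP[/eqP->|/andP[xl xA]]; first exact: conn1.
  apply: (@conn_reroute (fun p => p \in A) Q l _ detour) => //; last exact: cA.
  by move=> y yA yl; rewrite /Q in_swap yl yA orbT.
move=> x y Qx Qy; apply: conn_trans (toN x Qx) _.
by apply: conn_sym; [exact: Qy | exact: toN].
Qed.

(** Dual to [swap_connected]: an escape path through the newly filled [l'] is rerouted around it by
    [fill], and [l] escapes through an empty neighbour other than [l'], which [ring_ok] provides. *)
Lemma swap_holefree : holefree A -> holefree (swap A l l').
Proof.
move=> hA.
pose P : pred pt := fun p => p \notin A.
pose R : pred pt := fun p => p \notin swap A l l'.
have RE : forall p, R p = ~~ Q p by [].
have PR x : P x -> x != l' -> R x.
  by move=> Px xl'; rewrite RE /Q in_swap (negbTE xl') (negbTE Px) andbF.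
have fill x y : P x -> P y -> adj l' x -> adj l' y -> conn R x y.
  move=> Px Py l'x l'y.
  have xl : x != l by apply: contraNneq Px => ->.
  have yl : y != l by apply: contraNneq Py => ->.
  have [j j4 ex] := nbr_l' l'x xl; have [m m4 ey] := nbr_l' l'y yl.
  rewrite ex ey; apply: (@gap_conn R (ring8 l i) adj8 (fun k => ring8 l i k \in A) l) => //.
  - by move=> k k4; rewrite RE ring_swap // (leq_ltn_trans k4).
  - case/orP: ok => [/and4P[S s1 _ _]|/andP[a1 _]]; first by left; apply/andP.
    right; split=> //; rewrite RE Ql; split=> //; first by rewrite adj_sym ring8_l.
    exact: ring8_l.
  - by rewrite -ex.
  - by rewrite -ey.
have main x : P x -> x != l' -> forall N, exists2 q, conn R x q & (N <= norm1 q)%N.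
  (* The larger bound keeps the endpoint [q] away from [l'], as [conn_reroute] requires. *)
  move=> Px xl' N; have [q cq Nq] := hA x Px (N + (norm1 l').+1)%N.
  have ql' : q != l' by apply: contraTneq Nq => ->; rewrite -ltnNge; lia.
  exists q; last by lia.
  exact: (@conn_reroute P R l').
move=> p; rewrite in_swap negb_or negb_and negbK => /andP[pl' /orP[/eqP-> N|pA]]; last first.
  exact: main.
have [k kr kA] : exists2 k, k \in [:: 0; 4; 5; 6; 7]%N & ring8 l i k \notin A.
  case/orP: ok => [/and4P[_ _ _]|/andP[/and4P[b0 _ _ _] _]]; last by exists 0%N.
  rewrite !negb_and => /or4P[b|b|b|/orP[b|b]].
  - by exists 0%N. - by exists 4%N. - by exists 5%N. - by exists 6%N. - by exists 7%N.
have k8 : (k < 8)%N by move: kr; rewrite !inE => /or4P[|||/orP[]] /eqP ->.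
have [q cq Nq] := main _ kA (ring8_neq_r l i k8) N.
exists q => //; apply: conn_trans cq; apply: conn1; first exact: ring8_l.
by apply: PR => //; apply: ring8_neq_r.
Qed.

Lemma card_swap : #|` swap A l l'| = #|` A|.
Proof.
rewrite /swap cardfsU1 in_fsetD1 (negbTE l'A) andbF /= (cardfsD1 l A) lA //.
Qed.

End Preserve.

Definition valid n (A : {fset pt}) := [/\ #|` A| = n, connected A & holefree A].

(** Moves are made on untranslated finite sets; representatives enter only in [moves_pos]. Each step
    stores the validity of its result, with the particle number read off the starting set. *)
Inductive reach : {fset pt} -> {fset pt} -> Prop :=
| reach_refl A : reach A A
| reach_step A B l i : reach A B -> l \in B -> l + dir i \notin B ->
    ring_ok (fun k => ring8 l i k \in B) -> valid #|` A| (swap B l (l + dir i)) ->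
    reach A (swap B l (l + dir i)).

Lemma reach_card (A B : {fset pt}) : reach A B -> #|` A| = #|` B|.
Proof. by elim=> // A' B' l i _ -> _ _ _ [-> _ _]. Qed.

Lemma reach_trans A B C : reach A B -> reach B C -> reach A C.
Proof.
move=> + BC; elim: BC A => [//|A1 B1 l i r1 IH lB lB' ok v] A rA.
by apply: reach_step (IH _ rA) lB lB' ok _; rewrite (reach_card rA).
Qed.

Lemma reach_valid n A B : valid n A -> reach A B -> valid n B.
Proof. by move=> + r; elim: r => // A' B' l i _ _ _ _ _ v [<- _ _]. Qed.

Lemma reach_ring_ok n (A : {fset pt}) l i : valid n A -> l \in A -> l + dir i \notin A ->
  ring_ok (fun k => ring8 l i k \in A) -> reach A (swap A l (l + dir i)).
Proof.
move=> [_ cA hA] lA l'A ok; apply: (reach_step (reach_refl A) lA l'A ok).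
split; [by rewrite (card_swap lA l'A) | exact: swap_connected | exact: swap_holefree].
Qed.

(** Naming the eight occupation bits lets [ring_ok] be decided by computation in each application;
    undetermined ones remain membership tests. *)
Lemma reach_bits n (A : {fset pt}) l i l' b0 b1 b2 b3 b4 b5 b6 b7 :
  valid n A -> l \in A -> l' = l + dir i -> l' \notin A ->
  (l + dir (i + 1) \in A) = b0 -> (l' + dir (i + 1) \in A) = b1 ->
  (l' + dir i \in A) = b2 -> (l' + dir (i + 5) \in A) = b3 ->
  (l + dir (i + 5) \in A) = b4 -> (l + dir (i + 4) \in A) = b5 ->
  (l + dir (i + 3) \in A) = b6 -> (l + dir (i + 2) \in A) = b7 ->
  ring_ok (nth false [:: b0; b1; b2; b3; b4; b5; b6; b7]) -> reach A (swap A l l').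
Proof.
move=> vA lA -> l'A e0 e1 e2 e3 e4 e5 e6 e7 ok; apply: reach_ring_ok vA lA l'A _.
by move: ok; rewrite -e0 -e1 -e2 -e3 -e4 -e5 -e6 -e7.
Qed.

Lemma has_nbr (A : {fset pt}) x y : connected A -> x \in A -> y \in A -> x != y ->
  exists2 z, z \in A & adj x z.
Proof.
move=> cA xA yA xy; have [[|z s] [/= ps As e]] := cA _ _ xA yA; first by rewrite e eqxx in xy.
by case/andP: ps => xz _; case/andP: As => zA _; exists z.
Qed.

Lemma dirD4 i : dir i + dir (i + 4) = dir (i + 5). Proof. dir_cases i. Qed.
Lemma dirD3 i : dir i + dir (i + 3) = 0. Proof. by rewrite dir_opp subrr. Qed.

(** * Irreducibility *)

(** Outside the one-sided ray from [a], its origin included; this records which locations [ray]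
    leaves untouched. *)
Definition off (i : nat) (a p : pt) := forall j, p != a + dir i *+ j.

Lemma mulrn_pt (p : pt) j : p *+ j = (p.1 *+ j, p.2 *+ j).
Proof. by elim: j => // j IH; rewrite !mulrS IH. Qed.

(** Determinant in lattice coordinates: a nonzero value against [dir i] certifies that a
    displacement leaves the line in direction [i]. *)
Definition cross (p q : pt) : int := p.1 * q.2 - p.2 * q.1.

Lemma off_cross i (a w : pt) : cross (dir i) w != 0 -> off i a (a + w).
Proof.
move=> c j; apply: contraNneq c => /addrI ->.
by rewrite /cross mulrn_pt /= !mulrnAr mulrC subrr.
Qed.

Lemma crossDr p q r : cross p (q + r) = cross p q + cross p r.
Proof. rewrite /cross /=; lia. Qed.

Lemma cross_dir i : (cross (dir i) (dir i) = 0) * (cross (dir i) (dir (i + 1)) = 1) *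
 (cross (dir i) (dir (i + 2)) = 1) * (cross (dir i) (dir (i + 3)) = 0) *
 (cross (dir i) (dir (i + 4)) = -1) * (cross (dir i) (dir (i + 5)) = -1).
Proof. dir_cases i. Qed.

Lemma dir_mulS_neq0 i j : dir i *+ j.+1 != 0.
Proof.
move: i; apply: dir6 => [i||||||]; first by rewrite (dir_mod i).
all: rewrite mulrn_pt -pair_eqE /pair_eq /dir /=. all: by rewrite ?mulNrn ?mul0rn ?natz; lia.
Qed.

Lemma ray_bound (A : {fset pt}) (a : pt) i : exists k, forall j, (k < j)%N -> a + dir i *+ j \notin A.
Proof.
exists (norm1 a + \sum_(p <- A) norm1 p)%N => j kj; apply/negP => jA.
have : (norm1 (a + dir i *+ j) <= \sum_(p <- A) norm1 p)%N.
  by rewrite (big_fsetD1 _ jA) leq_addr.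
have : (j <= norm1 a + norm1 (a + dir i *+ j))%N.
  have E (v : pt) : norm1 (a + v) = (absz (a.1 + v.1)%R + absz (a.2 + v.2)%R)%N by [].
  rewrite E /norm1 mulrn_pt /=; move: i {jA}; apply: dir6 => [i||||||];
    [by rewrite (dir_mod i) | by rewrite /dir /= ?mulNrn ?mul0rn ?natz; lia..].
by move: kj; move: (\sum_(p <- A) _)%N (norm1 _) => u v; lia.
Qed.

(* Along the ray from a corner [a] whose arms leave at 120 degrees, particles with three
   consecutive empty locations facing [a] are nested; the innermost one can move, and then
   the others one after another. *)
Lemma ray n (A : {fset pt}) (a : pt) i : valid n A -> a \in A ->
  a + dir (i + 2) \notin A -> a + dir (i + 3) \notin A -> a + dir (i + 4) \notin A ->
  a + dir (i + 1) \in A -> a + dir (i + 5) \in A -> a + dir i \notin A ->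
  exists B, [/\ reach A B, (forall p, off i a p -> (p \in B) = (p \in A)) &
                a \notin B \/ a \in B /\ a + dir i \in B].
Proof.
have [k] := ray_bound A a i.
have [m] := ubnP k; elim: m k a => // m IH k a km kA vA aA f2 f3 f4 x1 x3 x2.
pose z2 := a + dir i + dir i.
have ez1 : z2 + dir (i + 2) = a + dir i + dir (i + 1) by rewrite /z2 -addrA dir_step.
have ez3 : z2 + dir (i + 4) = a + dir i + dir (i + 5) by rewrite /z2 -addrA dirD4.
have ezx : z2 + dir (i + 3) = a + dir i by rewrite /z2 -addrA dirD3 addr0.
(* If [z2], two steps ahead of [a], is empty or attached to an arm of the corner, then [a] slides
   into the notch [a + dir i] by Property 1. *)
have shift (B : {fset pt}) : valid n B -> (forall p, off i a p -> (p \in B) = (p \in A)) ->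
    a \in B -> a + dir i \notin B ->
    (z2 \in B -> (z2 + dir (i + 2) \in A) || (z2 + dir (i + 4) \in A)) ->
    exists C, [/\ reach B C, (forall p, off i a p -> (p \in C) = (p \in A)) &
                a \notin C \/ a \in C /\ a + dir i \in C].
  move=> vB BA aB x2B z2B.
  exists (swap B a (a + dir i)); split.
  - have offB j v : a + v + dir j \in B = (a + v + dir j \in A) \/
        cross (dir i) (v + dir j) = 0.
      case: (eqVneq (cross (dir i) (v + dir j)) 0) => [|c]; [by right | left].
      by rewrite BA // -addrA; apply: off_cross.
    have offB0 j : cross (dir i) (dir j) != 0 -> (a + dir j \in B) = (a + dir j \in A).
      by move=> c; rewrite BA //; apply: off_cross.
    apply: (reach_bits (i := i) (b0 := true) (b4 := true) (b5 := false) (b6 := false) (b7 := false) vB aB erefl x2B).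
    + by rewrite offB0 ?cross_dir.
    + by case: (offB (i + 1)%N (dir i)) => [->|]; [reflexivity | rewrite crossDr !cross_dir].
    + reflexivity.
    + by case: (offB (i + 5)%N (dir i)) => [->|]; [reflexivity | rewrite crossDr !cross_dir].
    + by rewrite offB0 ?cross_dir.
    + by rewrite offB0 ?cross_dir // (negbTE f4).
    + rewrite BA ?(negbTE f3) // => j;
       rewrite (inj_eq (addrI a)) dir_opp eq_sym -subr_eq0 opprK -mulrSr.
      exact: dir_mulS_neq0.
    + by rewrite offB0 ?cross_dir // (negbTE f2).
    + move: z2B; rewrite ez1 ez3 -/z2; case: (z2 \in B) => [/(_ isT)|_];
      by case: (_ \in A); case: (_ \in A).
  - move=> p op; rewrite in_swap BA //.
    have /negbTE -> : p != a by have := op 0%N; rewrite addr0.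
    by have /negbTE -> := op 1%N.
  - left; rewrite in_swap eqxx /= orbF.
    by rewrite eq_sym -subr_eq0 addrC addKr dir_neq0.
have [z13|] := boolP ((z2 \notin A) || (z2 + dir (i + 2) \in A) || (z2 + dir (i + 4) \in A)).
  apply: (shift A vA) => // z2A; case/orP: z13 => [|->]; last by rewrite orbT.
  by rewrite z2A /= => ->.
rewrite !negb_or negbK => /andP[/andP[z2A z1A] z3A].
have k2 : (1 < k)%N.
  rewrite ltnNge; apply/negP => k1; have := kA 2%N; rewrite ltnS k1 => /(_ isT).
  by rewrite mulr2n addrA z2A.
have ray2 j : a + dir i *+ (j + 2) = z2 + dir i *+ j.
  by rewrite addnC mulrnDr mulr2n !addrA.
have off_z p : off i a p -> off i z2 p by move=> op j; rewrite -ray2.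
have off_a2 : off i z2 a.
  move=> j; rewrite -ray2 addnS -{1}(addr0 a) (inj_eq (addrI a)) eq_sym; exact: dir_mulS_neq0.
have off_x2 : off i z2 (a + dir i).
  move=> j; rewrite -ray2 addnS mulrS addnS (inj_eq (addrI a)) -{1}(addr0 (dir i)).
  by rewrite (inj_eq (addrI _)) eq_sym; exact: dir_mulS_neq0.
(* Otherwise [z2] crosses to the notch by Property 2, unless it is itself a corner with both arms
   occupied and its own notch empty. *)
have jump (B : {fset pt}) : reach A B -> (forall p, off i z2 p -> (p \in B) = (p \in A)) ->
    z2 \in B -> (z2 + dir i \in B) || ~~ ((z2 + dir (i + 1) \in B) && (z2 + dir (i + 5) \in B)) ->
    exists C, [/\ reach A C, (forall p, off i a p -> (p \in C) = (p \in A)) &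
                a \notin C \/ a \in C /\ a + dir i \in C].
  move=> AB BA z2B y2.
  have vB := reach_valid vA AB.
  have aB : a \in B by rewrite BA //; exact: off_a2.
  have x2B : a + dir i \notin B by rewrite BA //; exact: off_x2.
  have x1B : a + dir (i + 1) \in B by rewrite BA //; apply: off_z; apply: off_cross; rewrite cross_dir.
  have x3B : a + dir (i + 5) \in B by rewrite BA //; apply: off_z; apply: off_cross; rewrite cross_dir.
  have z1B : z2 + dir (i + 2) \notin B.
    by rewrite BA //; apply: off_cross; rewrite cross_dir.
  have z3B : z2 + dir (i + 4) \notin B.
    by rewrite BA //; apply: off_cross; rewrite cross_dir.
  have y123 : [|| z2 + dir (i + 1) \in B, z2 + dir i \in B | z2 + dir (i + 5) \in B].
    have [_ cB _] := vB; have := has_nbr cB z2B aB; case=> [|z zB].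
      by have := off_a2 0%N; rewrite addr0 eq_sym.
    case/(adj_ring_l i) => [e|[j jr e]]; first by rewrite -e zB orbT.
    move: jr zB; rewrite e !inE => /or4P[|||/orP[]] /eqP ->; rewrite /ring8 /=.
    - by move=> ->.
    - by move=> ->; rewrite !orbT.
    - by rewrite (negbTE z3B).
    - by rewrite ezx (negbTE x2B).
    - by rewrite (negbTE z1B).
  exists (swap B z2 (a + dir i)); split.
  - apply: reach_trans AB _.
    have e8 : dir (i + 3 + 5) = dir (i + 2) by rewrite -addnA -[(3 + 5)%N]/(2 + 6)%N addnA dirD6.
    have e7 : dir (i + 3 + 4) = dir (i + 1) by rewrite -addnA -[(3 + 4)%N]/(1 + 6)%N addnA dirD6.
    have e6 : dir (i + 3 + 3) = dir i by rewrite -addnA dirD6.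
    have e5 : dir (i + 3 + 2) = dir (i + 5) by rewrite -addnA.
    have e4 : dir (i + 3 + 1) = dir (i + 4) by rewrite -addnA.
    apply: (reach_bits (i := (i + 3)%N) (b0 := false) (b1 := true) (b2 := true) (b3 := true)
      (b4 := false) (b5 := z2 + dir (i + 1) \in B) (b6 := z2 + dir i \in B)
      (b7 := z2 + dir (i + 5) \in B) vB z2B (esym ezx) x2B); rewrite ?e4 ?e5 ?e6 ?e7 ?e8 //.
    + exact/negbTE.
    + by rewrite -addrA dirD4.
    + by rewrite -addrA dirD3 addr0.
    + by rewrite -addrA dir_step.
    + exact/negbTE.
    + move: y2 y123; rewrite /ring_ok /arc_ok /=.
      by case: (_ \in B); case: (_ \in B); case: (_ \in B).
  - move=> p op; rewrite in_swap.
    have /negbTE -> : p != a + dir i by have := op 1%N.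
    have -> : p != z2 by have := op 2%N; rewrite mulr2n addrA.
    by rewrite BA //; exact: off_z.
  - right; rewrite !in_swap eqxx aB andbT; split=> //.
    by have := off_a2 0%N; rewrite addr0 => ->; rewrite orbT.
have [] := boolP ((z2 + dir i \in A) || ~~ ((z2 + dir (i + 1) \in A) && (z2 + dir (i + 5) \in A))).
  by apply: jump => //; exact: reach_refl.
rewrite negb_or negbK => /andP[y2 /andP[y1 y3]].
have km2 : (k - 2 < m)%N by clear - km k2; lia.
have kA2 j : (k - 2 < j)%N -> z2 + dir i *+ j \notin A.
  by move=> kj; rewrite -ray2; apply: kA; clear - kj k2; lia.
(* The same corner shape recurs at [z2], two steps along the ray. The recursion either removes [z2],
   so that [a] can shift, or fills the notch of [z2], so that [z2] can jump. *)
have [|B [AB BA o]] := IH (k - 2)%N z2 km2 kA2 vA z2A z1A _ z3A y1 y3 y2; first by rewrite ezx.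
have vB := reach_valid vA AB.
case: o => [z2B|[z2B y2B]]; last by apply: (jump B AB BA); rewrite ?z2B ?y2B.
have [|||C [BC CA o]] := shift B vB _ _ _ (fun h => False_ind _ (negP z2B h)).
- by move=> p op; apply: BA; exact: off_z.
- by rewrite BA //; exact: off_a2.
- by rewrite BA //; exact: off_x2.
by exists C; split=> //; exact: reach_trans AB BC.
Qed.

(** * Moving single particles and columns *)

Lemma in_swap2 A (x y x' y' u v : int) :
  ((u, v) \in swap A (x, y) (x', y')) =
  ((u == x') && (v == y')) || (~~ ((u == x) && (v == y)) && ((u, v) \in A)).
Proof. by rewrite in_swap !xpair_eqE. Qed.

Lemma ptD (x y u v : int) : (x, y) + (u, v) = (x + u, y + v) :> pt.
Proof. by []. Qed.

(** The particle rolls over [(x + 1, y - 1)], a common neighbour of both positions; the hypotheses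
    force [ring_ok] whatever the other occupations are. *)
Lemma move_right n A (x y : int) : valid n A -> (x, y) \in A -> (x + 1, y) \notin A ->
  (x + 1, y + 1) \notin A -> ((x + 2, y) \in A -> (x + 2, y - 1) \in A) ->
  (x + 1, y - 1) \in A -> (x - 1, y) \notin A -> (x - 1, y + 1) \notin A ->
  reach A (swap A (x, y) (x + 1, y)).
Proof.
move=> vA l l' b1 b23 b4 b6 b7.
apply: (reach_bits (i := 0) (b0 := (x, y + 1) \in A) (b1 := false) (b2 := (x + 2, y) \in A)
  (b3 := (x + 2, y - 1) \in A) (b4 := true) (b5 := (x, y - 1) \in A) (b6 := false) (b7 := false)
  vA l); rewrite /dir //= ?ptD ?addr0 ?add0r //; try exact/negbTE.
- by rewrite -addrA.
- by rewrite -addrA.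
move/implyP: b23; rewrite /ring_ok /side_ok /=.
by do 4!case: (_ \in A).
Qed.

Lemma move_up n A (x y : int) : valid n A -> (x, y) \in A -> (x, y + 1) \notin A ->
  (x - 1, y + 1) \notin A -> (x - 1, y + 2) \notin A -> (x, y + 2) \notin A ->
  (x + 1, y) \in A -> ((x, y - 1) \in A -> (x + 1, y - 1) \in A) -> (x - 1, y) \notin A ->
  reach A (swap A (x, y) (x, y + 1)).
Proof.
move=> vA l l' b0 b1 b2 b4 b65 b7.
apply: (reach_bits (i := 1) (b0 := false) (b1 := false) (b2 := false)
  (b3 := (x + 1, y + 1) \in A) (b4 := true) (b5 := (x + 1, y - 1) \in A)
  (b6 := (x, y - 1) \in A) (b7 := false)
  vA l); rewrite /dir //= ?ptD ?addr0 ?add0r //; try exact/negbTE.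
- by rewrite -addrA; exact/negbTE.
- by rewrite -addrA; exact/negbTE.
move/implyP: b65; rewrite /ring_ok /side_ok /=.
by do 3!case: (_ \in A).
Qed.

(* The rows up to height [h] are emptied into the part above, where every column is an
   interval standing on row [h]. *)
Definition heaped (h : int) (A : {fset pt}) := forall x y, h < y -> (x, y) \in A -> (x, y - 1) \in A.

Lemma heaped_down h A x y z : heaped h A -> (x, y) \in A -> h <= z <= y -> (x, z) \in A.
Proof.
move=> HA xy /andP[hz zy]; have [k ek] : exists k : nat, y = z + k%:Z.
  by exists `|y - z|%N; lia.
elim: k y xy zy ek => [|k IH] y xy zy ek; first by rewrite addr0 in ek; rewrite -ek.
apply: (IH (y - 1)); [|lia..]; apply: HA xy; lia.
Qed.

Ltac eq_dec :=
  rewrite ?in_swap2; repeat match goal with |- context [@eq_op ?T ?u ?v] =>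
    first [rewrite (_ : @eq_op T u v = false); [|by apply/eqP; lia]
          |rewrite (_ : @eq_op T u v = true); [|by apply/eqP; lia]] end;
  rewrite ?andbF ?andbT ?orbF ?orbT /=.

Lemma swap_swap A (p q r : pt) : q \notin A -> p != q -> swap (swap A p q) q r = swap A p r.
Proof.
move=> qA pq; apply/fsetP => z; rewrite !in_swap.
have [->|zq] := eqVneq z q; last by [].
by rewrite (negbTE qA) /= !andbF.
Qed.

(** The particle goes straight up with column [a + 1] as support on its right, and the last move
    takes it onto the top of that column. *)
Lemma climb n k A (a y : int) : valid n A -> (a, y) \in A ->
  (forall z, y <= z -> (a - 1, z) \notin A) -> (forall z, y < z -> (a, z) \notin A) ->
  ((a, y - 1) \in A -> (a + 1, y - 1) \in A) ->
  (forall z, y <= z <= y + k%:Z -> (a + 1, z) \in A) ->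
  (forall z, y + k%:Z < z -> (a + 1, z) \notin A) ->
  ((a + 2, y + k%:Z + 1) \in A -> (a + 2, y + k%:Z) \in A) ->
  reach A (swap A (a, y) (a + 1, y + k%:Z + 1)).
Proof.
elim: k A y => [|k IH] A y vA P left0 up0 low col top right.
  have r1 : reach A (swap A (a, y) (a, y + 1)).
    apply: move_up vA P _ _ _ _ _ low _; try by [apply: up0; lia|apply: left0; lia].
    by apply: col; lia.
  have v1 := reach_valid vA r1; apply: reach_trans r1 _.
  rewrite addr0 in top right *.
  rewrite -(@swap_swap A (a, y) (a, y + 1) (a + 1, y + 1)); [|by apply: up0; lia|by apply/eqP => -[]; lia].
  apply: (move_right v1); eq_dec => //.
  - by apply: top; lia.
  - by apply: top; lia.
  - by rewrite -[in X in _ -> X]addrA subrr addr0.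
  - by rewrite -addrA subrr addr0; apply: col; lia.
  - by apply: left0; lia.
  - by apply: left0; lia.
have r1 : reach A (swap A (a, y) (a, y + 1)).
  apply: move_up vA P _ _ _ _ _ low _; try by [apply: up0; lia|apply: left0; lia].
  by apply: col; lia.
have v1 := reach_valid vA r1; apply: reach_trans r1 _.
rewrite -(@swap_swap A (a, y) (a, y + 1) (a + 1, y + k.+1%:Z + 1)); [|by apply: up0; lia|by apply/eqP => -[]; lia].
have e : y + k.+1%:Z = y + 1 + k%:Z by lia.
rewrite e in top right *; apply: IH v1 _ _ _ _ _ _ _.
- by eq_dec.
- by move=> z yz; eq_dec; apply: left0; lia.
- by move=> z yz; eq_dec; apply: up0; lia.
- by rewrite addrK; eq_dec.
- by move=> z yz; eq_dec; apply: col; lia.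
- by move=> z yz; eq_dec; apply: top; lia.
- by eq_dec.
Qed.

Definition colshift (A B : {fset pt}) (a y0 y1 : int) := forall x y,
  ((x, y) \in B) = if (y0 <= y <= y1) && (x == a) then false
                   else ((y0 <= y <= y1) && (x == a + 1)) || ((x, y) \in A).

Lemma shear_bool (m : nat) (x y y0 a : int) (b : bool) :
  (if (y0 + 1 <= y <= y0 + 1 + m%:Z) && (x == a) then false
   else (y0 + 1 <= y <= y0 + 1 + m%:Z) && (x == a + 1)
     || ((x == a + 1) && (y == y0) || ~~ ((x == a) && (y == y0)) && b)) =
  (if (y0 <= y <= y0 + 1 + m%:Z) && (x == a) then false
   else (y0 <= y <= y0 + 1 + m%:Z) && (x == a + 1) || b).
Proof.
have [->|yy] := eqVneq y y0.
  rewrite (_ : (y0 <= y0 <= y0 + 1 + m%:Z) = true); last by lia.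
  rewrite (_ : (y0 + 1 <= y0 <= y0 + 1 + m%:Z) = false); last by lia.
  by rewrite !andbT /=; case: (eqVneq x a) => [->|_] //; rewrite (_ : (a == a + 1) = false) //; lia.
rewrite (_ : (y0 <= y <= y0 + 1 + m%:Z) = (y0 + 1 <= y <= y0 + 1 + m%:Z)); last by lia.
by rewrite !andbF.
Qed.

(** The bottom particle moves first, rolling over [(a + 1, y0 - 1)], and then supports the one above
    it in the same way. *)
Lemma shear n m A (a y0 : int) : valid n A ->
  (forall z, y0 <= z <= y0 + m%:Z -> (a, z) \in A) -> (a, y0 + m%:Z + 1) \notin A ->
  (forall z, y0 <= z <= y0 + m%:Z + 1 -> (a + 1, z) \notin A) ->
  (a + 1, y0 - 1) \in A ->
  (forall z, y0 <= z <= y0 + m%:Z + 1 -> (a - 1, z) \notin A) ->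
  (forall z, y0 <= z <= y0 + m%:Z -> (a + 2, z) \in A -> (a + 2, z - 1) \in A) ->
  exists2 B, reach A B & colshift A B a y0 (y0 + m%:Z).
Proof.
elim: m A y0 => [|m IH] A y0 vA col top right low left0 far.
  exists (swap A (a, y0) (a + 1, y0)).
    apply: (move_right vA) => //;
      by [apply: col; lia | apply: right; lia | apply: left0; lia | apply: far; lia].
  move=> x y.
  rewrite in_swap2 addr0; have [ey|ny] := eqVneq y y0; last first.
    by rewrite !andbF /= (_ : (y0 <= y <= y0) = false) //; lia.
  rewrite ey lexx !andbT /=; have [->|xa] := eqVneq x a; last by [].
  by rewrite (_ : (a == a + 1) = false) //; lia.
have r1 : reach A (swap A (a, y0) (a + 1, y0)).
  apply: (move_right vA) => //;
    by [apply: col; lia | apply: right; lia | apply: left0; lia | apply: far; lia].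
have v1 := reach_valid vA r1.
have e : y0 + m.+1%:Z = y0 + 1 + m%:Z by lia.
rewrite e in col top right left0 far *.
have [||||||B AB sB] := IH (swap A (a, y0) (a + 1, y0)) (y0 + 1) v1.
- by move=> z yz; eq_dec; apply: col; lia.
- by eq_dec.
- by move=> z yz; eq_dec; apply: right; lia.
- by rewrite addrK; eq_dec.
- by move=> z yz; eq_dec; apply: left0; lia.
- by move=> z yz; eq_dec; apply: far; lia.
exists B; first exact: reach_trans r1 AB.
move=> x y; rewrite sB in_swap2.
exact: shear_bool.
Qed.

(** The sizes of [lows], [level] and [bads] form, in this order, the lexicographic measure of
    [to_line]. *)
Definition lows (h : int) (A : {fset pt}) := [fset p in A | p.2 <= h].
Definition level (h : int) (A : {fset pt}) := [fset p in A | p.2 == h].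
Definition bads (h : int) (A : {fset pt}) := [fset p in A | (p.2 == h) && ((p.1, h - 1) \notin A)].

Definition highs (h : int) (A : {fset pt}) := [fset p in A | h < p.2].

Lemma in_lows h A p : (p \in lows h A) = (p \in A) && (p.2 <= h).
Proof. by rewrite /lows !inE. Qed.
Lemma in_level h A p : (p \in level h A) = (p \in A) && (p.2 == h).
Proof. by rewrite /level !inE. Qed.
Lemma in_bads h A p : (p \in bads h A) = [&& p \in A, p.2 == h & (p.1, h - 1) \notin A].
Proof. by rewrite /bads !inE. Qed.

Lemma seq_max (T : eqType) (f : T -> int) (s : seq T) p0 : p0 \in s ->
  exists2 p, p \in s & forall q, q \in s -> f q <= f p.
Proof.
elim: s p0 => // x s IH p0 _; case: s IH => [_|y s /(_ y (mem_head _ _)) [p ps pm]].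
  by exists x; rewrite ?mem_head // => q; rewrite inE => /eqP ->.
have [fx|fx] := lerP (f x) (f p).
  exists p; first by rewrite inE ps orbT.
  by move=> q; rewrite inE => /orP[/eqP->|/pm].
exists x; first exact: mem_head.
by move=> q; rewrite inE => /orP[/eqP->|/pm /le_trans] //; apply; apply: ltW.
Qed.

Lemma fset_max (A : {fset pt}) (P : pred pt) (f : pt -> int) (p0 : pt) : p0 \in A -> P p0 ->
  exists p : pt, [/\ p \in A, P p & forall q : pt, q \in A -> P q -> f q <= f p].
Proof.
move=> pA Pp; have [|p] := @seq_max _ f [seq p <- A | P p] p0; first by rewrite mem_filter Pp.
rewrite mem_filter => /andP[{}Pp {}pA] pm; exists p; split=> // q qA Pq.
by apply: pm; rewrite mem_filter Pq.
Qed.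

Lemma column_top (A : {fset pt}) (h x : int) : (x, h) \in A ->
  exists2 t : nat, (x, h + t%:Z) \in A & forall z, h + t%:Z < z -> (x, z) \notin A.
Proof.
move=> xA; have [[x' y] [yA /eqP /= ex m]] :=
  @fset_max A (fun p => p.1 == x) (fun p => p.2) _ xA (eqxx _).
subst x'; have hy : h <= y by have := m _ xA (eqxx _).
exists `|y - h|%N; first by rewrite (_ : h + _ = y) //; lia.
move=> z hz; apply/negP => zA; have := m _ zA (eqxx _) => /=; lia.
Qed.

Lemma lows_eq (h : int) (A B : {fset pt}) : (forall p : pt, p.2 <= h -> (p \in B) = (p \in A)) ->
  lows h B = lows h A /\ level h B = level h A.
Proof.
move=> E; split; apply/fsetP => p; rewrite ?in_lows ?in_level.
  by have [ph|] := boolP (p.2 <= h); rewrite ?andbF // E.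
by have [/eqP ph|] := boolP (p.2 == h); rewrite ?andbF // E // ph.
Qed.

Lemma lows_card (h : int) (A B : {fset pt}) : #|` A| = #|` B| ->
  (forall p : pt, h < p.2 -> (p \in B) = (p \in A)) -> #|` lows h B| = #|` lows h A|.
Proof.
have S C : #|` lows h C| = (#|` C| - #|` highs h C|)%N.
  rewrite -[in RHS](cardfsID (highs h C) C).
  rewrite (_ : C `&` _ = highs h C); last first.
    by apply/fsetP => p; rewrite !inE /= andbA andbb.
  rewrite addKn; congr #|` _|; apply/fsetP => p; rewrite !inE /= leNgt.
  by case: (p \in C) => //=; rewrite andbT.
move=> e E; rewrite !S e; congr (_ - #|` _|)%N; apply/fsetP => p; rewrite !inE /=.
by have [/E->|] := boolP (h < p.2); rewrite ?andbF.
Qed.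

Section Levels.
Variables (n : nat) (h : int).

Lemma climb_column A (a : int) (t : nat) : valid n A -> heaped h A ->
  (a - 1, h) \notin A -> (a, h + t%:Z) \in A -> (forall z, h + t%:Z < z -> (a, z) \notin A) ->
  (a + 1, h + t%:Z) \in A ->
  ((a, h + t%:Z - 1) \in A -> (a + 1, h + t%:Z - 1) \in A) ->
  exists k : nat, let B := swap A (a, h + t%:Z) (a + 1, h + t%:Z + k%:Z + 1) in
    reach A B /\ heaped h B.
Proof.
move=> vA HA left0 aA atop a1A low.
have [k kA ktop] := column_top a1A; exists k; split.
  apply: (climb vA aA) => //.
  - by move=> z hz; apply: contra left0 => zA; apply: heaped_down HA zA _; lia.
  - by move=> z zk; apply: heaped_down HA kA _; lia.
  - by move=> zA; rewrite -[_ + k%:Z](addrK 1); apply: HA zA; lia.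
move=> x y hy; rewrite !in_swap2 => /orP[/andP[/eqP-> /eqP->]|/andP[ne xyA]].
  rewrite addrK kA; apply/orP; right; rewrite andbT; lia.
rewrite (HA _ _ hy xyA) andbT; apply/orP; right; apply/negP => /andP[/eqP ex /eqP ey].
by move: xyA; rewrite ex; apply/negP/atop; lia.
Qed.

Lemma shear_heaped A B (a : int) (s t : nat) : heaped h A -> (a + 1, h + s%:Z) \in A ->
  (forall z, h + t%:Z < z -> (a, z) \notin A) -> (s < t)%N ->
  colshift A B a (h + s%:Z + 1) (h + t%:Z) -> heaped h B.
Proof.
move=> HA a1 atop st sB x y hy; rewrite !sB.
have [->|xa] := eqVneq x a.
  rewrite (_ : (a == a + 1) = false); last by lia.
  rewrite !andbT !andbF /=; case: ifP => // yr yA.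
  have -> : (h + s%:Z + 1 <= y - 1 <= h + t%:Z) = false.
    apply/negP => yr2; have : h + t%:Z < y by clear - yr yr2; lia.
    by move/atop/negP; apply.
  exact: HA.
rewrite !andbF /=; have [->|xa1] := eqVneq x (a + 1); last by rewrite !andbF /=; apply: HA.
rewrite !andbT; have [yr _|yr /= yA] := boolP (h + s%:Z + 1 <= y <= h + t%:Z).
  have [e|ne] := eqVneq y (h + s%:Z + 1); first by rewrite e addrK a1 orbT.
  by apply/orP; left; clear - yr ne; lia.
by rewrite (HA _ _ hy yA) orbT.
Qed.

End Levels.

Lemma row_low (A B : {fset pt}) (h : int) x : x \in A ->
  lows h B = lows h A `\ x -> x.2 <= h -> (#|` lows h B| < #|` lows h A|)%N.
Proof.
move=> xA -> xh; rewrite [X in (_ < X)%N](cardfsD1 x) in_lows xA xh.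
exact: ltnSn.
Qed.

Lemma climb_low (A : {fset pt}) (h a : int) k : (a, h) \in A ->
  (#|` lows h (swap A (a, h) (a + 1, h + k%:Z + 1)%R)| < #|` lows h A|)%N.
Proof.
move=> aA; apply: (row_low aA) => //; apply/fsetP => -[x y].
rewrite in_fsetD1 !in_lows in_swap2 xpair_eqE /=.
have [yh|] := boolP (y <= h); rewrite ?andbF // !andbT.
by rewrite (_ : (y == h + k%:Z + 1) = false) ?andbF //; clear - yh; lia.
Qed.

(** Induction on the height of the leftmost column of a run in row [h]. Where it overtops the next
    column it is sheared over it; otherwise its top climbs onto the next column. Once only [(a, h)]
    is left it climbs too, if necessary after [ray] has been applied. *)
Lemma shrink_run n h A (a : int) : valid n A -> heaped h A ->
  (a, h) \in A -> (a + 1, h) \in A -> (a - 1, h) \notin A ->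
  exists B, [/\ reach A B, heaped h B, (a + 1, h) \in B &
    (#|` lows h B| < #|` lows h A|)%N \/
    #|` lows h B| = #|` lows h A| /\ (#|` level h B| < #|` level h A|)%N].
Proof.
move=> vA HA aA; have [t tA ttop] := column_top aA.
have [m] := ubnP t; elim: m t A vA HA aA tA ttop => // m IH t A vA HA aA tA ttop tm a1A left0.
case: t tA ttop tm => [|t] tA ttop tm.
  rewrite addr0 in tA ttop; have key B : reach A B -> heaped h B -> (a - 1, h) \notin B ->
      (a, h) \in B -> (forall z, h < z -> (a, z) \notin B) -> (a + 1, h) \in B ->
      ((a, h - 1) \in B -> (a + 1, h - 1) \in B) -> #|` lows h B| = #|` lows h A| ->
      exists B, [/\ reach A B, heaped h B, (a + 1, h) \in B &
        (#|` lows h B| < #|` lows h A|)%N \/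
        #|` lows h B| = #|` lows h A| /\ (#|` level h B| < #|` level h A|)%N].
    move=> AB HB lB aB topB a1B lowB cB.
    have := @climb_column n h B a 0%N (reach_valid vA AB) HB lB.
    rewrite addr0 => /(_ aB topB a1B lowB) [k [BC HC]].
    eexists; split; [exact: reach_trans AB BC | exact: HC | | ].
      rewrite in_swap2 a1B andbT; apply/orP; right; clear; lia.
    by left; rewrite -cB; exact: climb_low.
  (* In this case the first upward move is illegal: [(a, h)] is a corner with arms [(a + 1, h)] and
     [(a, h - 1)], so [ray] is applied in direction 5. *)
  have [thin|ok] := boolP (((a, h - 1) \in A) && ((a + 1, h - 1) \notin A)); last first.
    apply: (key A) => //; first exact: reach_refl.
    by move=> low; move: ok; rewrite low /= negbK.
  case/andP: thin => x3 x2.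
  (* Direction 5 descends, so the ray meets the rows from [h] upwards only in its origin. *)
  have offh (x y : int) : h <= y -> (x, y) != (a, h) -> off 5 (a, h) (x, y).
    move=> hy ne [|j]; first by rewrite addr0.
    rewrite mulrn_pt /dir /= mulNrn natz ptD xpair_eqE negb_and; apply/orP; right.
    by clear - hy; lia.
  have [||||||B [AB BA o]] := @ray n A (a, h) 5 vA aA.
  - by rewrite /dir /= ptD addr0; apply: ttop; lia.
  - by rewrite /dir /= ptD; apply: contra left0 => zA; apply: heaped_down HA zA _; lia.
  - by rewrite /dir /= ptD addr0.
  - by rewrite /dir /= ptD addr0.
  - by rewrite /dir /= ptD addr0.
  - by rewrite /dir /= ptD.
  have BAh (x y : int) : h <= y -> (x, y) != (a, h) -> ((x, y) \in B) = ((x, y) \in A).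
    by move=> hy ne; apply: BA; exact: offh.
  have HB : heaped h B.
    move=> x y hy; rewrite BAh ?(ltW hy) //; last first.
      by rewrite xpair_eqE negb_and; apply/orP; right; clear - hy; lia.
    move=> xyA; rewrite BAh; [exact: HA | clear - hy; lia |].
    rewrite xpair_eqE negb_and; have [ex|//] := eqVneq x a.
    by apply: contraTN xyA => /eqP ey; rewrite ex; apply: ttop.
  have cB : #|` lows h B| = #|` lows h A|.
    apply: lows_card; first exact: reach_card.
    move=> [x y] /= hy; apply: BAh; first exact: ltW.
    by rewrite xpair_eqE negb_and; apply/orP; right; clear - hy; lia.
  have a1B : (a + 1, h) \in B.
    by rewrite BAh // xpair_eqE negb_and; apply/orP; left; clear; lia.
  case: o => [aB|[aB x2B]]; last first.
    apply: (key B) => //.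
    + by rewrite BAh // xpair_eqE negb_and; apply/orP; left; clear; lia.
    + move=> z hz; rewrite BAh; [exact: ttop | exact: ltW |].
      by rewrite xpair_eqE negb_and; apply/orP; right; clear - hz; lia.
  exists B; split=> //; right; split=> //.
  rewrite [X in (_ < X)%N](cardfsD1 (a, h)) in_level aA /= eqxx ltnS.
  apply: fsubset_leq_card; apply/fsubsetP => -[x y]; rewrite in_fsetD1 !in_level /=.
  case/andP=> xB /eqP ey; rewrite ey eqxx andbT; move: xB; rewrite ey.
  by have [e|ne] := eqVneq (x, h) (a, h); [rewrite e (negbTE aB)|rewrite BAh].
have [a1t|a1t] := boolP ((a + 1, h + t.+1%:Z) \in A).
  have [|k [AB HB]] := climb_column vA HA left0 tA ttop a1t.
    by move=> _; apply: HA a1t; clear; lia.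
  set B := swap _ _ _ in AB HB.
  have BA (p : pt) : p.2 <= h + t%:Z -> (p \in B) = (p \in A).
    case: p => x y /= yh; rewrite in_swap2.
    have -> : (y == h + t.+1%:Z) = false by clear - yh; lia.
    have -> : (y == h + t.+1%:Z + k%:Z + 1) = false by clear - yh; lia.
    by rewrite !andbF.
  have [eM eR] : lows h B = lows h A /\ level h B = level h A.
    by apply: lows_eq => p ph; apply: BA; clear - ph; lia.
  have ht : h <= h + t%:Z by clear; lia.
  have aB : (a, h) \in B by rewrite BA.
  have a1B : (a + 1, h) \in B by rewrite BA.
  have lB : (a - 1, h) \notin B by rewrite BA.
  have tB : (a, h + t%:Z) \in B by rewrite BA //; apply: heaped_down HA tA _; clear; lia.
  have [|C [BC HC a1C o]] := IH t B (reach_valid vA AB) HB aB tB _ tm a1B lB.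
    move=> z hz; rewrite in_swap2; apply/negP => /orP[/andP[/eqP ez _]|/andP[ne zA]].
      by clear - ez; lia.
    have [ez|nz] := eqVneq z (h + t.+1%:Z); first by rewrite ez !eqxx in ne.
    by have /ttop/negP : h + t.+1%:Z < z by [clear - nz hz; lia]; apply.
  by exists C; split=> //; [exact: reach_trans AB BC | rewrite -eM -eR].
have [s sA stop] := column_top a1A.
have st : (s < t.+1)%N.
  rewrite ltnNge; apply/negP => ts; case/negP: a1t; apply: heaped_down HA sA _.
  by clear - ts; lia.
have e : h + s%:Z + 1 + (t.+1 - s.+1)%N%:Z = h + t.+1%:Z by clear - st; lia.
have [||||||B AB sB] := @shear n (t.+1 - s.+1)%N A a (h + s%:Z + 1) vA; rewrite ?e.
- by move=> z hz; apply: heaped_down HA tA _; clear - hz; lia.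
- by apply: ttop; clear; lia.
- by move=> z hz; apply: stop; clear - hz; lia.
- by rewrite addrK.
- by move=> z hz; apply: contra left0 => zA; apply: heaped_down HA zA _; clear - hz; lia.
- by move=> z hz; apply: HA; clear - hz; lia.
rewrite e in sB; have HB := shear_heaped HA sA ttop st sB.
have BA (p : pt) : p.2 <= h + s%:Z -> (p \in B) = (p \in A).
  case: p => x y /= yh; rewrite sB.
  by have -> : (h + s%:Z + 1 <= y <= h + t.+1%:Z) = false by clear - yh; lia.
have [eM eR] : lows h B = lows h A /\ level h B = level h A.
  by apply: lows_eq => p ph; apply: BA; clear - ph; lia.
have hs : h <= h + s%:Z by clear; lia.
have aB : (a, h) \in B by rewrite BA.
have a1B : (a + 1, h) \in B by rewrite BA.
have lB : (a - 1, h) \notin B by rewrite BA.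
have tB : (a, h + s%:Z) \in B by rewrite BA //; apply: heaped_down HA tA _; clear - st; lia.
have [|C [BC HC a1C o]] := IH s B (reach_valid vA AB) HB aB tB _ (leq_trans st tm) a1B lB.
  move=> z hz; rewrite sB eqxx andbT; case: ifP => // zr.
  rewrite (_ : (a == a + 1) = false) ?andbF; last by clear; lia.
  by apply: ttop; clear - zr hz; lia.
by exists C; split=> //; [exact: reach_trans AB BC | rewrite -eM -eR].
Qed.

Definition isline (A : {fset pt}) := exists (x0 y0 : int) (t : nat),
  forall x y : int, ((x, y) \in A) = (x == x0) && (y0 <= y <= y0 + t%:Z).

Lemma adj_pt (x y u v : int) : adj (x, y) (u, v) =
  [|| (u == x + 1) && (v == y), (u == x) && (v == y + 1), (u == x - 1) && (v == y + 1),
      (u == x - 1) && (v == y), (u == x) && (v == y - 1) | (u == x + 1) && (v == y - 1)].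
Proof.
have E (a b c : int) : (a - b == c) = (a == b + c) by rewrite subr_eq addrC.
rewrite adjE (_ : (u, v) - (x, y) = (u - x, v - y)) // /dirs !inE !xpair_eqE !E !addr0.
by [].
Qed.

(** The neighbouring columns have no foot in row [h], so by heapedness they are empty from there
    upwards; with both locations under the foot empty too, nothing is attached to this column. *)
Lemma isolated_column h A (x : int) : connected A -> heaped h A -> (x, h) \in A ->
  (forall z, (z, h) \in A -> (z + 1, h) \notin A) ->
  (x, h - 1) \notin A -> (x + 1, h - 1) \notin A ->
  forall p, p \in A -> p.1 = x /\ h <= p.2.
Proof.
move=> cA HA xA noP l1 l2 p pA.
apply: (@conn_ind (fun p => p \in A) (fun p => p.1 = x /\ h <= p.2)) (cA _ _ xA pA) => //=.
move=> [u v] [u' v'] /= [-> hv] zA; rewrite adj_pt.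
have right z : h <= z -> (x + 1, z) \notin A.
  by move=> hz; apply: contra (noP x xA) => zA'; apply: heaped_down HA zA' _; rewrite lexx.
have left z : h <= z -> (x - 1, z) \notin A.
  move=> hz; apply/negP => zA'; have /noP : (x - 1, h) \in A.
    by apply: heaped_down HA zA' _; rewrite lexx.
  by rewrite subrK xA.
have hv1 : h <= v + 1 by clear - hv; lia.
case/or4P => [| | |/or3P[]] /andP[/eqP eu /eqP ev]; subst u' v'.
- by rewrite (negbTE (right _ hv)) in zA.
- by [].
- by rewrite (negbTE (left _ hv1)) in zA.
- by rewrite (negbTE (left _ hv)) in zA.
- split=> //; have [e|ne] := eqVneq v h; first by rewrite e (negbTE l1) in zA.
  by clear - hv ne; lia.
- have [e|ne] := eqVneq v h; first by rewrite e (negbTE l2) in zA.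
  have hv2 : h <= v - 1 by clear - hv ne; lia.
  by rewrite (negbTE (right _ hv2)) in zA.
Qed.

(** The foot of the column moves within row [h] and comes to stand on [(x + 1, h - 1)], so it leaves
    [bads]. *)
Lemma lean_measure A B (h x : int) (t : nat) : colshift A B x h (h + t%:Z) -> (x, h) \in A ->
  (x + 1, h) \notin A -> (x, h - 1) \notin A -> (x + 1, h - 1) \in A ->
  [/\ #|` lows h B| = #|` lows h A|, #|` level h B| = #|` level h A| &
     (#|` bads h B| < #|` bads h A|)%N].
Proof.
move=> sB xA x1A lowA low1A.
have BE (u v : int) : v <= h -> ((u, v) \in B) = ((u, v) \in swap A (x, h) (x + 1, h)).
  move=> vh; rewrite sB in_swap2.
  have -> : (h <= v <= h + t%:Z) = (v == h) by clear - vh; lia.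
  have [ev|nv] := eqVneq v h; rewrite ?andbF ?andbT //=.
  have [->|ux] := eqVneq u x; last by [].
  by have -> : (x == x + 1) = false by clear; lia.
have swap_card (C : {fset pt}) : (x, h) \in C -> (x + 1, h) \notin C ->
    #|` swap C (x, h) (x + 1, h)| = #|` C|.
  by move=> xC x1C; have := @card_swap C (x, h) 0 xC; rewrite /dir /= ptD addr0; apply.
have lB : lows h B = swap (lows h A) (x, h) (x + 1, h).
  apply/fsetP => -[u v]; rewrite in_lows /= in_swap2 in_lows /=.
  have [vh|vh] := boolP (v <= h); first by rewrite BE // in_swap2 !andbT.
  have -> : (v == h) = false by clear - vh; lia.
  by rewrite !andbF.
have rB : level h B = swap (level h A) (x, h) (x + 1, h).
  apply/fsetP => -[u v]; rewrite in_level /= in_swap2 in_level /=.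
  by have [->|nv] := eqVneq v h; rewrite ?andbF //= BE // in_swap2 eqxx !andbT.
split.
- by rewrite lB swap_card // in_lows ?xA ?(negbTE x1A) //= lexx.
- by rewrite rB swap_card // in_level ?xA ?(negbTE x1A) //= eqxx.
rewrite [X in (_ < X)%N](cardfsD1 (x, h)) in_bads xA /= eqxx lowA ltnS.
apply: fsubset_leq_card; apply/fsubsetP => -[u v]; rewrite in_fsetD1 !in_bads /= xpair_eqE.
case/and3P => uB /eqP ev; subst v.
have hh : h - 1 <= h by clear; lia.
rewrite BE // in_swap2 eqxx !andbT in uB *; move: uB; rewrite BE // in_swap2.
have -> : (h - 1 == h) = false by clear; lia.
rewrite !andbF /= => /orP[/eqP->|/andP[-> ->] //]; first by rewrite low1A.
Qed.

(** Lexicographic descent. A run in row [h] is shrunk. Without runs, an unsupported column leans to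
    the right, unless it is the whole configuration; if every particle of the row is supported, [h]
    drops by one. *)
Theorem to_line n h A x : valid n A -> heaped h A -> (x, h) \in A ->
  exists B, reach A B /\ isline B.
Proof.
have [m] := ubnP #|` lows h A|; elim: m h A x => // m IHm h A x.
have [r] := ubnP #|` level h A|; elim: r A x => // r IHr A x.
have [b] := ubnP #|` bads h A|; elim: b A x => // b IHb A x bA rA mA vA HA xA.
have [P|noP] := pselect (exists z, (z, h) \in A /\ (z + 1, h) \in A).
  have [z [zA z1A]] := P.
  have [[a y] [aA /andP[/eqP /= ey a1A] amin]] := @fset_max A
    (fun p => (p.2 == h) && ((p.1 + 1, h) \in A)) (fun p => - p.1) _ zA (ltac:(by rewrite /= eqxx)).
  subst y; have left0 : (a - 1, h) \notin A.
    apply/negP => lA; have := amin _ lA; rewrite /= subrK eqxx aA => /(_ isT).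
    by clear; lia.
  have [B [AB HB a1B o]] := shrink_run vA HA aA a1A left0.
  have vB := reach_valid vA AB.
  have [C [BC lC]] : exists C, reach B C /\ isline C.
    case: o => [lt|[eM lt]].
      by apply: IHm vB HB a1B; rewrite (leq_trans lt).
    by apply: IHr vB HB a1B; rewrite ?eM // (leq_trans lt).
  by exists C; split=> //; exact: reach_trans AB BC.
have {}noP z : (z, h) \in A -> (z + 1, h) \notin A.
  by move=> zA; apply/negP => z1A; apply: noP; exists z.
have [cA] : connected A /\ True by case: vA.
move=> _; have [bad|nobad] := pselect (exists z, (z, h) \in A /\ (z, h - 1) \notin A); last first.
  have {}nobad z : (z, h) \in A -> (z, h - 1) \in A.
    by move=> zA; apply/negP => z1A; apply: nobad; exists z; split=> //; apply/negP.
  apply: (IHm (h - 1) A x _ vA _ (nobad _ xA)).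
    move: mA; rewrite ltnS; apply: leq_trans; rewrite [X in (_ < X)%N](cardfsD1 (x, h)) in_lows xA /= lexx ltnS.
    apply: fsubset_leq_card; apply/fsubsetP => -[u v]; rewrite in_fsetD1 !in_lows /= xpair_eqE.
    by case/andP=> -> vh /=; clear - vh; lia.
  move=> u v hv uA; have [e|ne] := eqVneq v h; first by rewrite e in uA *; exact: nobad.
  by apply: HA uA; clear - hv ne; lia.
have [z [zA zl]] := bad.
(* Taking the rightmost unsupported particle ensures that a column at [a + 2] is supported, as
   [shear] requires. *)
have [[a y] [aA /andP[/eqP /= ey al] amax]] := @fset_max A
    (fun p => (p.2 == h) && ((p.1, h - 1) \notin A)) (fun p => p.1) _ zA (ltac:(by rewrite /= eqxx)).
subst y; have [t tA ttop] := column_top aA.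
have [a1l|a1l] := boolP ((a + 1, h - 1) \in A); last first.
  exists A; split; first exact: reach_refl.
  exists a, h, t => u v; have iso := isolated_column cA HA aA noP al a1l.
  apply/idP/idP => [uA|/andP[/eqP -> vr]]; last exact: heaped_down HA tA vr.
  have [/= eu hv] := iso _ uA; rewrite eu eqxx hv /=; rewrite leNgt; apply/negP => /ttop.
  by rewrite -eu uA.
have [||||||B AB sB] := @shear n t A a h vA.
- by move=> w hw; apply: heaped_down HA tA _; clear - hw; lia.
- by apply: ttop; clear; lia.
- move=> w hw; apply: contra (noP _ aA) => wA; apply: heaped_down HA wA _; clear - hw; lia.
- exact: a1l.
- move=> w hw; apply/negP => wA; have /noP : (a - 1, h) \in A.
    by apply: heaped_down HA wA _; clear - hw; lia.
  by rewrite subrK aA.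
- move=> w hw wA; have [e|ne] := eqVneq w h; last by apply: HA wA; clear - hw ne; lia.
  rewrite e in wA *; apply/negP => /negP wl.
  have := amax _ wA; rewrite /= eqxx wl => /(_ isT); clear; lia.
have vB := reach_valid vA AB.
have [eM eR lt] := lean_measure sB aA (noP _ aA) al a1l.
have HB : heaped h B.
  move=> u v hv; rewrite !sB.
  have [->|ua] := eqVneq u a.
    have -> : (a == a + 1) = false by clear; lia.
    rewrite !andbT !andbF /=; case: ifP => // vr vA'.
    have /ttop/negP : h + t%:Z < v by clear - vr hv; lia.
    by rewrite vA'.
  rewrite !andbF /=; have [->|ua1] := eqVneq u (a + 1); last by rewrite !andbF /=; apply: HA.
  rewrite !andbT; have [vr _|vr /= vA'] := boolP (h <= v <= h + t%:Z).
    by apply/orP; left; clear - vr hv; lia.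
  by rewrite (HA _ _ hv vA') orbT.
have a1B : (a + 1, h) \in B.
  rewrite sB eqxx andbT; have -> : (a + 1 == a) = false by clear; lia.
  by rewrite andbF /=; apply/orP; left; clear; lia.
have [C [BC lC]] : exists C, reach B C /\ isline C.
  by apply: IHb vB HB a1B; rewrite ?eM ?eR // (leq_trans lt).
by exists C; split=> //; exact: reach_trans AB BC.
Qed.

Theorem reach_line n A : valid n A -> (0 < n)%N -> exists B, reach A B /\ isline B.
Proof.
move=> vA n0; have [p pA] : exists p, p \in A.
  by case: vA => cA _ _; apply/fset0Pn; rewrite -cardfs_gt0 cA.
have [[x h] [xA _ m]] := @fset_max A (fun=> true) (fun p => p.2) p pA isT.
apply: (to_line vA _ xA) => u v hv uA; have := m _ uA isT => /=; clear - hv; lia.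
Qed.

(** * Configurations up to translation *)

Lemma emb_inj n : injective (@emb n).
Proof.
by move=> [a b] [c d] [/= e1 e2]; congr pair; apply: val_inj.
Qed.

Definition cells n (S : {set B n}) : {fset pt} := [fset emb q | q in S].

Lemma mem_cells n (S : {set B n}) p : (p \in cells S) = occ S p.
Proof.
apply/imfsetP/existsP => [[q /= qS ->]|[q /andP[qS /eqP <-]]]; exists q => //.
by rewrite qS eqxx.
Qed.

Lemma emb_cells n (S : {set B n}) q : (emb q \in cells S) = (q \in S).
Proof. by rewrite mem_imfset //; exact: emb_inj. Qed.

Lemma card_cells n (S : {set B n}) : #|` cells S| = #|S|.
Proof.
rewrite /cells card_imfset /=; last exact: emb_inj.
by rewrite -cardE.
Qed.

Definition rel_in n (S : {set B n}) : rel (B n) :=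
  fun a b => [&& a \in S, b \in S & adj (emb a) (emb b)].

Lemma connect_conn n (S : {set B n}) (A : {fset pt}) (v : pt) :
  (forall q, (q \in S) = (emb q + v \in A)) ->
  (forall p, p \in A -> exists q : B n, p = emb q + v) ->
  connb S <-> connected A.
Proof.
move=> SA AS; split=> [cS x y xA yA|cA].
  have [a ea] := AS _ xA; have [b eb] := AS _ yA; subst x y; rewrite -!SA in xA yA.
  move/forallP: cS => /(_ a)/implyP/(_ xA)/forallP/(_ b)/implyP/(_ yA)/connectP [p pp eb].
  exists [seq emb q + v | q <- p]; rewrite eb (last_map (fun q => emb q + v)); split=> //.
  - rewrite (path_map (f := fun q => emb q + v)); apply: sub_path pp => c d /and3P[_ _].
    by rewrite /relpre /= adj_add.
  - rewrite all_map; apply/allP => q qp /=; rewrite -SA.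
    elim: p a pp qp {eb xA} => //= c p IH a /andP[/and3P[_ cS _] pp].
    by rewrite inE => /orP[/eqP->|]; [|exact: IH pp].
apply/forallP => a; apply/implyP => aS; apply/forallP => b; apply/implyP => bS.
have [aA bA] : emb a + v \in A /\ emb b + v \in A by rewrite -!SA.
have [c [cS ec cc]] : exists c, [/\ c \in S, emb b + v = emb c + v & connect (rel_in S) a c].
  apply: (@conn_ind (fun p => p \in A)
    (fun p => exists c, [/\ c \in S, p = emb c + v & connect (rel_in S) a c]) _ _ _ _ (cA _ _ aA bA)).
    move=> u w [c [cS eu cc]] wA uw; have [d ed] := AS _ wA; exists d.
    have dS : d \in S by rewrite SA -ed.
    split=> //; apply: connect_trans cc _; apply: connect1.
    by rewrite /rel_in cS dS /=; move: uw; rewrite eu ed adj_add.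
  by exists a; split=> //; apply: connect0.
by move/addIr: ec => /emb_inj ->.
Qed.

Lemma noholes_holefree n (S : {set B n}) : noholes S <-> holefree (cells S).
Proof.
split=> H p pS N.
  rewrite mem_cells in pS; have [s [ps Ps ls]] := H p pS N.
  exists (last p s) => //; exists s; split=> //.
  by apply: sub_all Ps => z; rewrite mem_cells.
rewrite -mem_cells in pS; have [q [s [ps Ps <-]] Nq] := H p pS N.
by exists s; split=> //; apply: sub_all Ps => z; rewrite mem_cells.
Qed.

Lemma Omega_valid n (s : Omega n) : valid n (cells (val s)).
Proof.
have /and4P[/eqP cS _ conS /asboolP hS] := valP s; split.
- by rewrite card_cells.
- by apply/(@connect_conn n (val s) (cells (val s)) 0) => // [q|p];
    rewrite ?addr0 ?emb_cells // => /imfsetP[q /= _ ->]; exists q; rewrite addr0.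
- exact/noholes_holefree.
Qed.

Lemma holefree_translate A (v : pt) : holefree A -> holefree [fset p + v | p in A].
Proof.
have E (p : pt) : (p \in [fset p + v | p in A]) = (p - v \in A).
  apply/imfsetP/idP => [[q /= qA ->]|pA]; first by rewrite addrK.
  by exists (p - v); rewrite ?subrK.
move=> hA p; rewrite E => pA N.
have [q [s [ps Ps e]] Nq] := hA _ pA (N + norm1 v)%N.
exists (q + v); last first.
  have : (norm1 q <= norm1 (q + v) + norm1 v)%N.
    by rewrite /norm1; have -> : (q + v).1 = q.1 + v.1 by []; have -> : (q + v).2 = q.2 + v.2 by []; lia.
  by clear -Nq; lia.
exists [seq z + v | z <- s]; split.
- rewrite -{1}(subrK v p) (path_map (f := fun z => z + v)); apply: sub_path ps => a b.
  by rewrite /relpre /= adj_add.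
- by rewrite all_map; apply: sub_all Ps => z /=; rewrite E addrK.
- by rewrite -{1}(subrK v p) (last_map (fun z => z + v)) e.
Qed.

Definition rep n (s : Omega n) (A : {fset pt}) :=
  exists v : pt, forall p, (p \in cells (val s)) = (p + v \in A).

(** Discrete intermediate value theorem: [f] takes every value between [f a] and [f b]. Applied to
    the coordinates, it fits [n] connected particles into an [n] by [n] box. *)
Lemma interval_card (A : {fset pt}) (f : pt -> int) (a b : pt) : connected A ->
  (forall p q, adj p q -> `|f q - f p| <= 1) -> a \in A -> b \in A -> f a <= f b ->
  f b - f a < #|` A|%:Z.
Proof.
move=> cA fL aA bA ab.
have hit (k : nat) : f a + k%:Z <= f b -> exists2 q, q \in A & f q = f a + k%:Z.
  move=> kb; have [//|] := pselect (exists2 q, q \in A & f q = f a + k%:Z) => no; exfalso.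
  have : f b < f a + k%:Z.
    apply: (@conn_ind (fun p => p \in A) (fun p => f p < f a + k%:Z)) (cA _ _ aA bA).
      move=> u w fu wA /fL; have [e|ne] := eqVneq (f w) (f a + k%:Z).
        by exfalso; apply: no; exists w.
      by clear - fu ne; lia.
    case: k kb no => [|k] kb no; last by clear; lia.
    by exfalso; apply: no; exists a; rewrite ?addr0.
  by clear - kb; lia.
pose d := `|f b - f a|%N.
have : (d.+1 <= #|` [fset f q | q in A]|)%N.
  rewrite -(size_iota 0 d.+1) -(size_map (fun k : nat => f a + k%:Z)).
  apply: uniq_leq_size; first by rewrite map_inj_uniq ?iota_uniq // => i j /addrI [].
  move=> z /mapP[k]; rewrite mem_iota => /andP[_ kd] ->.
  have [|q qA e] := hit k; first by clear - kd ab; rewrite /d in kd; lia.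
  by apply/imfsetP; exists q.
have H : (#|` [fset f q | q in A]| <= #|` A|)%N by exact: leq_imfset_card.
by move=> /leq_trans/(_ H); clear - ab; rewrite /d; lia.
Qed.

Lemma rep_exists n A : valid n A -> (0 < n)%N -> exists s : Omega n, rep s A.
Proof.
move=> vA n0; have [cardA cA hA] := vA.
have [p0 p0A] : exists p : pt, p \in A by apply/fset0Pn; rewrite -cardfs_gt0 cardA.
have [px [pxA _ mx]] := @fset_max A (fun=> true) (fun p => - p.1) _ p0A isT.
have [py [pyA _ my]] := @fset_max A (fun=> true) (fun p => - p.2) _ p0A isT.
pose v : pt := (px.1, py.2).
have box (p : pt) : p \in A -> 0 <= p.1 - px.1 < n%:Z /\ 0 <= p.2 - py.2 < n%:Z.
  move=> pA; have hx : px.1 <= p.1 by rewrite -lerN2; exact: mx.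
  have hy : py.2 <= p.2 by rewrite -lerN2; exact: my.
  have H1 := @interval_card A (fun p => p.1) px p cA _ pxA pA hx.
  have H2 := @interval_card A (fun p => p.2) py p cA _ pyA pA hy.
  rewrite cardA in H1 H2; split; apply/andP; split; rewrite ?subr_ge0 //;
    [apply: H1 | apply: H2]; move=> [a b] [c d]; rewrite adj_pt /=; clear; lia.
pose S := [set q : B n | emb q + v \in A].
have SA q : (q \in S) = (emb q + v \in A) by rewrite inE.
have AS p : p \in A -> exists q : B n, p = emb q + v.
  move=> pA; have [/andP[x0 xn] /andP[y0 yn]] := box p pA.
  have xi : (absz (p.1 - px.1)%R < n)%N by rewrite -ltz_nat gez0_abs.
  have yi : (absz (p.2 - py.2)%R < n)%N by rewrite -ltz_nat gez0_abs.
  exists (Ordinal xi, Ordinal yi); rewrite /emb /= /v ptD.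
  by rewrite [LHS]surjective_pairing; congr pair => /=; rewrite gez0_abs ?subrK.
have plE p : (p \in cells S) = (p + v \in A).
  apply/imfsetP/idP => [[q /= qS ->]|/[dup] /AS [q /addIr ->] qA]; first by rewrite -SA.
  by exists q; rewrite //= SA.
have ok : inOmega S.
  apply/and4P; split.
  - have e : cells S = [fset p - v | p in A].
      apply/fsetP => p; rewrite plE; apply/idP/imfsetP => [pA|[q /= qA ->]]; last by rewrite subrK.
      by exists (p + v); rewrite ?addrK.
    by rewrite -card_cells e card_imfset /= ?cardA //; exact: addIr.
  - have [qx eqx] := AS _ pxA; have [qy eqy] := AS _ pyA; apply/andP; split; apply/existsP.
      exists qx; rewrite SA -eqx pxA /=; have : px.1 = (qx.1 : nat)%:Z + px.1 by rewrite {1}eqx.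
      by clear; lia.
    exists qy; rewrite SA -eqy pyA /=; have : py.2 = (qy.2 : nat)%:Z + py.2 by rewrite {1}eqy.
    by clear; lia.
  - exact/(connect_conn SA AS).
  - apply/asboolP/noholes_holefree.
    rewrite (_ : cells S = [fset p + (- v) | p in A]); first exact: holefree_translate.
    apply/fsetP => p; rewrite plE; apply/idP/imfsetP => [pA|[q /= qA ->]]; last by rewrite subrK.
    by exists (p + v); rewrite ?addrK.
by exists (exist _ S ok), v.
Qed.

(** A canonical set has both minimal coordinates 0, so both [w] and [- w] have nonnegative
    coordinates. *)
Lemma canon_translate n (s t : Omega n) (w : pt) :
  (forall p, (p \in cells (val s)) = (p + w \in cells (val t))) -> w = 0.
Proof.
move=> E.
have half (s' t' : Omega n) (w' : pt) :
  (forall p, (p \in cells (val s')) = (p + w' \in cells (val t'))) -> 0 <= w'.1 /\ 0 <= w'.2.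
  move=> E'; have /and4P[_ /andP[/existsP[q /andP[qS /eqP q0]] /existsP[q' /andP[q'S /eqP q'0]]] _ _] := valP s'.
  rewrite -emb_cells E' in qS; rewrite -emb_cells E' in q'S.
  have {qS} /imfsetP[r /= _ er] := qS; have {q'S} /imfsetP[r' /= _ er'] := q'S.
  have e1 : (q.1 : nat)%:Z + w'.1 = (r.1 : nat)%:Z := congr1 fst er.
  have e2 : (q'.2 : nat)%:Z + w'.2 = (r'.2 : nat)%:Z := congr1 snd er'.
  by rewrite q0 in e1; rewrite q'0 in e2; move: e1 e2; clear; lia.
have [h1 h2] := half s t w E.
have [h3 h4] : 0 <= (- w).1 /\ 0 <= (- w).2 by apply: (half t s) => p; rewrite E subrK.
rewrite [LHS]surjective_pairing; congr pair; [move: h1 h3 | move: h2 h4].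
  by have -> : (- w).1 = - w.1 by []; clear; lia.
by have -> : (- w).2 = - w.2 by []; clear; lia.
Qed.

Lemma rep_unique n (s t : Omega n) A : rep s A -> rep t A -> s = t.
Proof.
move=> [v Ev] [w Ew].
have E p : (p \in cells (val s)) = (p + (v - w) \in cells (val t)).
  by rewrite Ev Ew -addrA subrK.
have vw := canon_translate E; apply: val_inj; apply/setP => q.
by rewrite -!emb_cells E vw addr0.
Qed.

Lemma rep_self n (s : Omega n) : rep s (cells (val s)).
Proof. by exists 0 => p; rewrite addr0. Qed.

(** * The Gibbs distribution *)

Lemma dir_neq (l : pt) i : (l + dir i == l) = false.
Proof. by rewrite -subr_eq0 addrC addKr (negbTE (dir_neq0 i)). Qed.

(** Every occupied face is counted once, at the vertex from which the other two lie in directions 0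
    and 1 or in directions 1 and 2; hence at most two faces per particle. *)
Definition ntri (A : {fset pt}) : nat :=
  (\sum_(p <- A) (((p + dir 0)%R \in A) && ((p + dir 1)%R \in A) +
                  ((p + dir 1)%R \in A) && ((p + dir 2)%R \in A)))%N.

Lemma ntri_le (A : {fset pt}) : (ntri A <= 2 * #|` A|)%N.
Proof.
rewrite /ntri cardfE mulnC -sum1_card big_seq_fsetE /= big_distrl /=.
apply: leq_sum => p _; do 2!case: (_ && _) => //.
Qed.

Lemma sum_pred1 (s : seq pt) (c : pt) (b : pt -> bool) : uniq s ->
  (\sum_(p <- s) ((p == c) && b p) = (c \in s) && b c)%N.
Proof.
elim: s => [|x s IH] /=; first by rewrite big_nil.
case/andP=> xs us; rewrite big_cons IH // inE eq_sym.
have [->|_] //= := eqVneq c x; by rewrite (negbTE xs) addn0.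
Qed.

Lemma ntri_add (A : {fset pt}) l : l \notin A -> ntri (l |` A) = (ntri A + tri (fun p => p \in A) l)%N.
Proof.
move=> lA; rewrite /ntri big_fsetU1 //= addnC.
have nl i : (l + dir i \in l |` A) = (l + dir i \in A).
  by rewrite in_fset1U dir_neq.
rewrite !nl.
(* A face gained at [p] other than [l] has [l] in direction [i] or [j] from [p]; [k] and [m] are the
   opposite directions, which lead from [l] back to [p]. *)
have split2 (i j k m : nat) (p : pt) : (forall q : pt, (q + dir i == l) = (q == l + dir k)) ->
    (forall q : pt, (q + dir j == l) = (q == l + dir m)) -> dir i != dir j ->
  (((p + dir i)%R \in l |` A) && ((p + dir j)%R \in l |` A) =
    (((p + dir i)%R \in A) && ((p + dir j)%R \in A)) +
    ((p == l + dir k)%R && ((p + dir j)%R \in A)) +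
    ((p == l + dir m)%R && ((p + dir i)%R \in A)) :> nat)%N.
  move=> ei ej ij; rewrite !in_fset1U ei ej -ei -ej.
  have [e1|] := eqVneq (p + dir i)%R l; have [e2|] := eqVneq (p + dir j)%R l => /=.
  - by case/eqP: ij; apply: (addrI p); rewrite e1.
  - by rewrite e1 (negbTE lA); case: (_ \in A).
  - by rewrite e2 (negbTE lA) andbF; case: (_ \in A).
  - by rewrite !addn0.
have back i k : dir i + dir k = 0 -> forall q : pt, (q + dir i == l) = (q == l + dir k).
  move=> e q; rewrite -(inj_eq (addIr (dir k))) -addrA e addr0 //.
rewrite (eq_bigr (fun p : pt =>
  (((p + dir 0)%R \in A) && ((p + dir 1)%R \in A) + ((p + dir 1)%R \in A) && ((p + dir 2)%R \in A)) +
  (((p == l + dir 3)%R && ((p + dir 1)%R \in A)) + ((p == l + dir 4)%R && ((p + dir 0)%R \in A)) +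
   (((p == l + dir 4)%R && ((p + dir 2)%R \in A)) + ((p == l + dir 5)%R && ((p + dir 1)%R \in A)))))%N); last first.
  move=> p _; rewrite (split2 0 1 3 4)%N ?(split2 1 2 4 5)%N //; try exact: back.
  by move: (_ && _ : nat) (_ && _ : nat) (_ && _ : nat) => *; lia.
rewrite !big_split /= !sum_pred1 ?fset_uniq // -!addrA.
have -> : dir 3 + dir 1 = dir 2 by [].
have -> : dir 4 + dir 0 = dir 5 by [].
have -> : dir 4 + dir 2 = dir 3 by [].
have -> : dir 5 + dir 1 = dir 0 by [].
rewrite /tri /= !addpE.
move: (l + dir 0 \in A) (l + dir 1 \in A) (l + dir 2 \in A) (l + dir 3 \in A)
  (l + dir 4 \in A) (l + dir 5 \in A) (\sum_(i <- A) _)%N (\sum_(i <- A) _)%N => b0 b1 b2 b3 b4 b5 u w.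
by clear; case: b0; case: b1; case: b2; case: b3; case: b4; case: b5 => /=; lia.
Qed.

Lemma eq_tri o o' l : (forall i, o (l + dir i) = o' (l + dir i)) -> tri o l = tri o' l.
Proof. by move=> e; rewrite /tri; apply: eq_count => i; rewrite !addpE !e. Qed.

Lemma ntri_swap (A : {fset pt}) l l' : l \in A -> l' \notin A ->
  (ntri (swap A l l') + tri (fun p => p \in A) l =
   ntri A + tri (fun p => p \in swap A l l') l')%N.
Proof.
move=> lA l'A; have ll' : l' != l by apply: contraNneq l'A => ->.
have lD : l \notin A `\ l by rewrite in_fsetD1 eqxx.
have l'D : l' \notin A `\ l by rewrite in_fsetD1 (negbTE l'A) andbF.
have eA : ntri A = (ntri (A `\ l) + tri (fun p => p \in A `\ l) l)%N.
  by rewrite -(ntri_add lD) fsetD1K.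
rewrite eA /swap (ntri_add l'D).
have -> : tri (fun p => p \in l' |` A `\ l) l' = tri (fun p => p \in A `\ l) l'.
  by apply: eq_tri => i; rewrite in_fset1U dir_neq.
have -> : tri (fun p => p \in A) l = tri (fun p => p \in A `\ l) l.
  by apply: eq_tri => i; rewrite in_fsetD1 dir_neq.
by rewrite addnAC.
Qed.

Lemma ntri_translate (A A' : {fset pt}) (v : pt) : (forall p, (p \in A') = (p + v \in A)) ->
  ntri A' = ntri A.
Proof.
move=> E; rewrite /ntri.
have P : perm_eq A [seq p + v | p <- A'].
  apply: uniq_perm; rewrite ?fset_uniq ?map_inj_uniq ?fset_uniq //; first exact: addIr.
  move=> p; apply/idP/mapP => [pA|[q qA ->]]; last by rewrite -E.
  by exists (p - v); rewrite ?E subrK.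
rewrite (perm_big _ P) big_map; apply: eq_bigr => p _.
by rewrite !E -!addrA !(addrC v).
Qed.

(** Properties 1 and 2 are symmetric in the two locations and ignore their occupation, so only an
    empty target and the five-neighbour condition have to be assumed; [v] accounts for the change of
    representative. *)
Lemma moveok_reverse (o o2 : pt -> bool) (v l l' : pt) :
  (forall p, p != l -> p != l' -> o2 (p - v) = o p) -> ~~ o2 (l - v) ->
  size (nbrs o2 (l' - v)) != 5 -> moveok o l l' -> moveok o2 (l' - v) (l - v).
Proof.
move=> E o2l n5 /and3P[ol' _ P]; rewrite /moveok o2l n5 /=.
have adjv a b : adj (a - v) (b - v) = adj a b by exact: adj_add.
have ShE p : (p - v \in Sset o2 (l' - v) (l - v)) = (p \in Sset o l l').
  rewrite /Sset !mem_filter !mem_nbrs !adjv.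
  have [->|cells] := eqVneq p l; first by rewrite adj_irr /= andbF.
  have [->|pl'] := eqVneq p l'; first by rewrite adj_irr /= !andbF.
  by rewrite E //; case: (adj l p); case: (adj l' p); case: (o p).
have NhE p : (p - v \in Nunion o2 (l' - v) (l - v)) = (p \in Nunion o l l').
  rewrite /Nunion !mem_filter !mem_undup !mem_cat !mem_nbrs !adjv.
  rewrite !(inj_eq (addIr (- v))).
  have [->|cells] := eqVneq p l; first by rewrite /= andbF.
  have [->|pl'] := eqVneq p l'; first by rewrite /=.
  by rewrite E //= orbC.
have AhE p : (p - v \in [seq p <- nbrs o2 (l' - v) | p != l - v]) = (p \in [seq p <- nbrs o l' | p != l]).
  rewrite !mem_filter !mem_nbrs !adjv (inj_eq (addIr (- v))).
  have [->|cells] //= := eqVneq p l.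
  have [->|pl'] := eqVneq p l'; first by rewrite adj_irr.
  by rewrite E.
have AhE' p : (p - v \in [seq p <- nbrs o2 (l - v) | p != l' - v]) = (p \in [seq p <- nbrs o l | p != l']).
  rewrite !mem_filter !mem_nbrs !adjv (inj_eq (addIr (- v))).
  have [->|cells] //= := eqVneq p l'.
  have [->|pl'] := eqVneq p l; first by rewrite adj_irr.
  by rewrite E.
have sz (s s2 : seq pt) : uniq s -> uniq s2 -> (forall p, (p - v \in s2) = (p \in s)) -> size s2 = size s.
  move=> us us2 e; rewrite -(size_map (fun p => p - v) s); apply/esym/perm_size/uniq_perm => //.
    by rewrite map_inj_uniq //; exact: addIr.
  move=> p; rewrite -[p](addrK v) (mem_map (addIr (- v))) -e addrK //.
have shift (s s2 : seq pt) x y : (forall p, (p - v \in s2) = (p \in s)) ->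
    (exists t, [/\ path adj x t, all (mem s) t & last x t = y]) ->
    exists t, [/\ path adj (x - v) t, all (mem s2) t & last (x - v) t = y - v].
  move=> e [t [pt at_ <-]]; exists [seq p - v | p <- t]; split.
  - by rewrite (path_map (f := fun p => p - v)); apply: sub_path pt => a b /=; rewrite adjv.
  - by rewrite all_map; apply: sub_all at_ => p /=; rewrite e.
  - by rewrite (last_map (fun p => p - v)).
have uS o' a b : uniq (Sset o' a b) by rewrite filter_uniq // uniq_nbrs.
have Ssz := sz _ _ (uS o l l') (uS o2 (l' - v) (l - v)) ShE.
case/orP: P => [/andP[S1 /asboolP P1]|/and5P[S0 A0 A0' /asboolP cA /asboolP cA']]; apply/orP.
  left; rewrite /prop1 Ssz S1 /=; apply/asboolP => x; rewrite -{1}[x](addrK v) NhE => /P1 [s [ps Ps ls]].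
  have [|t [pt At lt]] := @shift _ _ (x + v) (last (x + v) s) NhE; first by exists s.
  rewrite addrK in pt lt; exists t; split=> //.
  by rewrite lt ShE.
have uA o' a b : uniq [seq p <- nbrs o' a | p != b] by rewrite filter_uniq // uniq_nbrs.
right; rewrite /prop2 Ssz S0 (sz _ _ (uA _ _ _) (uA _ _ _) AhE) A0' (sz _ _ (uA _ _ _) (uA _ _ _) AhE') A0 /=.
apply/andP; split; apply/asboolP => x y; rewrite -{1}[x](addrK v) -{1}[y](addrK v).
  rewrite !AhE => xA yA; have := shift _ _ _ _ AhE (cA' _ _ xA yA).
  by rewrite !addrK.
rewrite !AhE' => xA yA; have := shift _ _ _ _ AhE' (cA _ _ xA yA).
by rewrite !addrK.
Qed.

Definition moves n (s t : Omega n) : {set B n * 'I_6} :=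
  [set x : B n * 'I_6 | [&& x.1 \in val s,
     moveok (occ (val s)) (emb x.1) (addp (emb x.1) (dir x.2)) &
     sameconf (val t) (moved (occ (val s)) (emb x.1) (addp (emb x.1) (dir x.2)))]].

Lemma moved_swap n (s : Omega n) l l' p : moved (occ (val s)) l l' p = (p \in swap (cells (val s)) l l').
Proof. by rewrite in_swap mem_cells. Qed.

Lemma sameconf_rep n (t : Omega n) (o : pt -> bool) (A : {fset pt}) :
  (forall p, o p = (p \in A)) -> sameconf (val t) o -> rep t A.
Proof. by move=> oA /asboolP[v E]; exists v => p; rewrite mem_cells E oA. Qed.

Lemma moves_tri n (s t : Omega n) x : x \in moves s t ->
  let l := emb x.1 in let l' := addp l (dir x.2) in let o := occ (val s) in
  (tri (moved o l l') l')%:Z - (tri o l)%:Z = (ntri (cells (val t)))%:Z - (ntri (cells (val s)))%:Z.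
Proof.
rewrite inE => /and3P[xs /and3P[l'A _ _] sc] /=; set l := emb x.1; set l' := addp l _.
have lA : l \in cells (val s) by rewrite emb_cells.
have l'A' : l' \notin cells (val s) by rewrite mem_cells.
have := ntri_swap lA l'A'.
have -> : tri (fun p => p \in cells (val s)) l = tri (occ (val s)) l.
  by apply: eq_tri => i; rewrite mem_cells.
have -> : tri (fun p => p \in swap (cells (val s)) l l') l' = tri (moved (occ (val s)) l l') l'.
  by apply: eq_tri => i; rewrite -moved_swap.
have [v E] : rep t (swap (cells (val s)) l l').
  by apply: sameconf_rep sc => p; exact: moved_swap.
rewrite (ntri_translate (v := v) (A' := cells (val t)) (A := swap (cells (val s)) l l')) //.
by move: (tri _ _) (tri _ _) (ntri _) (ntri _); clear; lia.
Qed.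

Lemma holefree_nbr A p : holefree A -> p \notin A -> exists2 z, z \notin A & adj p z.
Proof.
move=> hA pA; have [q [[|z s] [/= ps As e]] Nq] := hA p pA (norm1 p).+1.
  by rewrite -e ltnn in Nq.
by case/andP: ps => pz _; case/andP: As => zA _; exists z.
Qed.

Definition reverses n (s t : Omega n) (x y : B n * 'I_6) : Prop :=
  y.2 = inord ((x.2 + 3) %% 6)%N /\ (exists v : pt,
    (forall p : pt, occ (val t) p = moved (occ (val s)) (emb x.1) (emb x.1 + dir x.2) (p + v)) /\
    emb y.1 + v = emb x.1 + dir x.2).

Lemma dir_inord k : dir (inord (k %% 6)%N : 'I_6) = dir k.
Proof. by rewrite inordK ?ltn_mod // -dir_mod. Qed.

Lemma reverses_moves n (s t : Omega n) x : x \in moves s t ->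
  exists2 y, y \in moves t s & reverses s t x y.
Proof.
case: x => q i; rewrite inE /= => /and3P[qs mok /asboolP[v E]].
set l := emb q; set l' := l + dir i.
have mok' : moveok (occ (val s)) l l' := mok.
have /and3P[l's _ _] := mok'.
have ll' : (l == l') = false by rewrite eq_sym dir_neq.
have E' p : occ (val t) p = (p + v == l') || (p + v != l) && occ (val s) (p + v) by exact: E.
have /[dup] l't : occ (val t) (l' - v) by rewrite E' subrK eqxx.
rewrite -mem_cells => /imfsetP[q' /= q't eq'].
exists (q', inord ((i + 3) %% 6)%N); last first.
  by split=> //=; exists v; split=> //; rewrite -eq' subrK.
have ed : emb q' + dir (inord ((i + 3) %% 6)%N : 'I_6) = l - v.
  by rewrite dir_inord dir_opp -eq' /l' addrAC addrK.
rewrite inE /= q't /= addpE ed -eq'; apply/andP; split.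
  apply: moveok_reverse mok'.
  - move=> p cells pl'; rewrite E' subrK (negbTE pl') cells //.
  - by rewrite E' subrK ll' eqxx.
  (* As [s] has no holes, [l'] has an empty neighbour [z] before the move; after it [l] is empty as
     well, and two empty neighbours exclude five occupied ones. *)
  - have [_ _ hs] := Omega_valid s; have [_ _ ht] := Omega_valid t.
    have [z zs l'z] : exists2 z, z \notin cells (val s) & adj l' z.
      by apply: holefree_nbr => //; rewrite mem_cells.
    have zl : z != l by apply: contraNneq zs => ->; rewrite emb_cells.
    have zl' : z != l' by apply: contraTneq l'z => ->; rewrite adj_irr.
    rewrite (size_nbrs _ _ (i + 3)%N).
    have n0 : occ (val t) (l' - v + dir (i + 3)) = false.
      by rewrite dir_opp -addrA (addrC (- v)) addrA /l' addrK E' subrK ll' eqxx.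
    rewrite n0; have [k k6 ez] : exists2 k, (k < 6)%N & z = l' + dir (i + 3 + k).
      case/adjP: l'z => j j6 ->; exists ((j + 6 - (i + 3) %% 6) %% 6)%N; first by rewrite ltn_mod.
      rewrite (dir_modr (i + 3)); congr (_ + _).
      have := ltn_mod (i + 3) 6; move: ((i + 3) %% 6)%N => i' i6.
      by rewrite /dir modnDmr subnKC; [rewrite modnDr | clear - i6; lia].
    have zt : occ (val t) (l' - v + dir (i + 3 + k)) = false.
      rewrite -addrA (addrC (- v)) addrA -ez E' subrK (negbTE zl) (negbTE zl') /=.
      by rewrite -mem_cells (negbTE zs).
    case: k k6 zt ez => [|k] k6 zt ez.
      by case/eqP: zl; rewrite ez addn0 dir_opp addrK.
    by case: k k6 zt {ez} => [|[|[|[|[|]]]]] // _ ->; do !case: (occ _ _).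
apply/asboolP; exists (- v) => p; rewrite /moved.
rewrite !(inj_eq (addIr (- v))) E' subrK.
have [->|cells] := eqVneq p l; first by rewrite -mem_cells emb_cells.
by have [->|pl'] //= := eqVneq p l'; apply/negbTE.
Qed.

(** Undoing [y] recovers [s] up to a translation, which [canon_translate] makes unique; the moved
    particle is then determined. *)
Lemma reverses_inj n (s t : Omega n) x x' y : x \in moves s t -> x' \in moves s t ->
  reverses s t x y -> reverses s t x' y -> x = x'.
Proof.
case: x x' y => q i [q' i'] [r j]; rewrite !inE /= => /and3P[qs /and3P[l1 _ _] _].
move=> /and3P[q's /and3P[l2 _ _] _] [/= ej [v [E e]]] [/= ej' [v' [E' e']]].
have ii : i = i'.
  move: ej'; rewrite ej => /(congr1 (@nat_of_ord 6)); rewrite !inordK ?ltn_mod // => em.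
  by apply: val_inj => /=; move: (ltn_ord i) (ltn_ord i') em; clear; lia.
subst i'.
have key (u : pt) (c : B n) : c \in val s -> ~~ occ (val s) (emb c + dir i) ->
    (forall p, occ (val t) p = moved (occ (val s)) (emb c) (emb c + dir i) (p + u)) ->
    emb r + u = emb c + dir i ->
    forall p, occ (val s) (p + u) = (p == emb r - dir i) || (p != emb r) && occ (val t) p.
  move=> cs nl' Eu eu p; rewrite Eu /moved.
  have e1 : (p + u == emb c + dir i) = (p == emb r) by rewrite -eu (inj_eq (addIr u)).
  have e2 : (p + u == emb c) = (p == emb r - dir i).
    by rewrite -(inj_eq (addIr u) p) addrAC eu addrK.
  rewrite e1 e2; have [ep|_] /= := eqVneq p (emb r - dir i).
    have -> : p + u = emb c by rewrite ep addrAC eu addrK.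
    by rewrite -mem_cells emb_cells.
  have [ep|_] //= := eqVneq p (emb r).
  by rewrite ep eu; apply/negbTE.
have K1 := key v q qs l1 E e; have K2 := key v' q' q's l2 E' e'.
have vv : v' - v = 0.
  apply: (@canon_translate n s s) => p; rewrite !mem_cells.
  by rewrite -{1}(subrK v p) K1 -K2 addrA addrAC.
have {}vv : v' = v by apply/eqP; rewrite -subr_eq0 vv.
by move: e'; rewrite vv e => /addIr /emb_inj ->.
Qed.

Lemma card_le_rel (X Y : finType) (P : {set X}) (Q : {set Y}) (rl : X -> Y -> Prop) :
  (forall x, x \in P -> exists2 y, y \in Q & rl x y) ->
  (forall x x' y, x \in P -> x' \in P -> rl x y -> rl x' y -> x = x') -> (#|P| <= #|Q|)%N.
Proof.
move=> ex inj; have [->|[x0 x0P]] := set_0Vmem P; first by rewrite cards0.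
have [y0 _ _] := ex _ x0P.
pose f x := odflt y0 [pick y in Q | `[< rl x y >]].
have fP x : x \in P -> f x \in Q /\ rl x (f x).
  move=> xP; rewrite /f; case: pickP => [y /andP[yQ /asboolP]|no] //=.
  by have [y yQ rxy] := ex _ xP; have := no y; rewrite yQ /= => /asboolP.
rewrite -(@card_in_imset _ _ f).
  by apply/subset_leq_card/subsetP => _ /imsetP[x /fP[] ? _ ->].
by move=> x x' xP x'P e; apply: (inj _ _ (f x)) => //; [case: (fP _ xP)|rewrite e; case: (fP _ x'P)].
Qed.

(** Proposals are thus symmetric, and detailed balance concerns only the acceptance factors. *)
Lemma card_moves_sym n (s t : Omega n) : #|moves s t| = #|moves t s|.
Proof.
suff H (a b : Omega n) : (#|moves a b| <= #|moves b a|)%N by apply/eqP; rewrite eqn_leq !H.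
apply: (@card_le_rel _ _ _ _ (reverses a b)).
- by move=> x; apply: reverses_moves.
- by move=> x x' y; apply: reverses_inj.
Qed.

Lemma ring_ok_eq b b' : (forall k, (k < 8)%N -> b k = b' k) -> ring_ok b = ring_ok b'.
Proof. by move=> E; rewrite /ring_ok /side_ok /arc_ok /= !E. Qed.

Lemma line_card (A : {fset pt}) (x0 y0 : int) t : (forall x y : int, ((x, y) \in A) = (x == x0) && (y0 <= y <= y0 + t%:Z)) ->
  #|` A| = t.+1.
Proof.
move=> E; have -> : A = [fset (x0, y0 + k%:Z) | k in iota 0 t.+1].
  apply/fsetP => -[x y]; rewrite E; apply/andP/imfsetP => [[/eqP -> yr]|[k kt [-> ->]]].
    exists `|y - y0|%N; last by congr pair; clear - yr; lia.
    by rewrite -[_ \in _]/(_ \in iota 0 t.+1) mem_iota; clear - yr; lia.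
  have {}kt : k \in iota 0 t.+1 by [].
  by rewrite mem_iota in kt; split=> //; clear - kt; lia.
rewrite card_imfset; last by move=> i j [/addrI []].
by rewrite -[LHS]/(size (undup (iota 0 t.+1))) undup_id ?iota_uniq ?size_iota.
Qed.

Lemma rep_line n (a : Omega n) A C : valid n A -> valid n C -> isline A -> isline C ->
  rep a A -> rep a C.
Proof.
move=> [cA _ _] [cC _ _] [x0 [y0 [t EA]]] [x1 [y1 [t' EC]]] [v Ev].
have tt : t' = t by apply/eq_add_S; rewrite -(line_card EA) -(line_card EC) cA.
exists (v + (x1 - x0, y1 - y0)) => -[x y]; rewrite Ev.
case: v {Ev} => v1 v2; rewrite !ptD EA EC tt /=; clear.
by apply/idP/idP => /andP[/eqP e yr]; apply/andP; split; [apply/eqP| |apply/eqP|]; lia.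
Qed.

(** * Transition kernel and uniqueness of the stationary distribution *)

Section Kernel.
Variables (R : realType) (lam : R) (n : nat).
Hypothesis lam0 : 0 < lam.
Implicit Types s t : Omega n.

Let tr s := ntri (cells (val s)).
Let W s : R := lam ^+ tr s.

Let W0 s : 0 < W s. Proof. exact: exprn_gt0. Qed.

Lemma Mkernel_moves s t : s != t ->
  Mkernel lam s t = ((6 * n)%:R)^-1 * Num.min 1 (lam ^ ((tr t)%:Z - (tr s)%:Z)) * #|moves s t|%:R.
Proof.
move=> st; rewrite /Mkernel -sum1_card natr_sum mulr_sumr.
rewrite pair_big_dep /= [RHS]big_mkcond /= [LHS]big_mkcond /=.
apply: eq_bigr => -[q i] _ /=; rewrite andbT.
have E : ((q, i) \in moves s t) = [&& q \in val s,
     moveok (occ (val s)) (emb q) (addp (emb q) (dir i)) &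
     sameconf (val t) (moved (occ (val s)) (emb q) (addp (emb q) (dir i)))] by rewrite inE.
case: (boolP ((q, i) \in moves s t)) => [xm|].
  have xm' := moves_tri xm; rewrite /= in xm'; rewrite xm'.
  by move: xm; rewrite E => /and3P[-> -> ->]; rewrite (negbTE st) mulr0 addr0 !mulr1.
rewrite E (negbTE st); case: (q \in val s); last by [].
by case: (moveok _ _ _); case: (sameconf _ _) => //= _; rewrite !mulr0 ?addr0 ?mulr0.
Qed.

(** For distinct states both sides are the proposal probability times the minimum of the two
    weights. *)
Lemma detailed_balance s t : W s * Mkernel lam s t = W t * Mkernel lam t s.
Proof.
have [->//|st] := eqVneq s t.
rewrite !Mkernel_moves // 1?eq_sym // (card_moves_sym t s).
have E a b : W a * Num.min 1 (lam ^ ((tr b)%:Z - (tr a)%:Z)) = Num.min (W a) (W b).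
  rewrite minr_pMr ?ltW // mulr1; congr Num.min.
  rewrite /W -[lam ^+ tr a]/(lam ^ (tr a)%:Z) -expfzDr ?lt0r_neq0 //.
  by rewrite addrCA subrr addr0.
by rewrite !mulrA -!(mulrA _ _ (Num.min _ _)) !(mulrCA (W _)) !E minC.
Qed.

Lemma Mkernel_ge0 s t : 0 <= Mkernel lam s t.
Proof.
rewrite /Mkernel; apply: sumr_ge0 => q _; apply: sumr_ge0 => i _.
apply: mulr_ge0; first by rewrite invr_ge0 ler0n.
cbv zeta; case: ifP => _; last exact: ler0n.
have a0 (z : int) : 0 <= Num.min 1 (lam ^ z) by rewrite le_min ler01 exprz_ge0 ?ltW.
by rewrite addr_ge0 // mulr_ge0 ?ler0n // subr_ge0 ge_min lexx.
Qed.

Lemma sum_sameconf_le1 (o : pt -> bool) : \sum_(t : Omega n) (sameconf (val t) o)%:R <= 1 :> R.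
Proof.
have [[t0 h0]|no] := pselect (exists t : Omega n, sameconf (val t) o); last first.
  rewrite big1 ?ler01 // => t _; case: (boolP (sameconf _ _)) => // st.
  by exfalso; apply: no; exists t.
rewrite (bigD1 t0) //= big1 ?addr0; first by case: sameconf; rewrite ?ler01.
move=> t tt0; case: (boolP (sameconf (val t) o)) => // /asboolP[v E].
move/asboolP: h0 => [v0 E0]; case/eqP: tt0.
apply: (@rep_unique n t t0 (cells (val t0))); last exact: rep_self.
by exists (v - v0) => p; rewrite !mem_cells E E0 !addpE -addrA subrK.
Qed.

Lemma Mkernel_sum_le1 s : (0 < n)%N -> \sum_t Mkernel lam s t <= 1.
Proof.
move=> n0; rewrite /Mkernel.
have cs : #|val s| = n by have /and4P[/eqP] := valP s.
have S1 : \sum_(q in val s) \sum_(i < 6) ((6 * n)%:R)^-1 = 1 :> R.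
  rewrite sumr_const cs sumr_const card_ord -mulrnA -[_ *+ _]mulr_natr mulVf //.
  by rewrite pnatr_eq0 muln_eq0 negb_or /= -lt0n.
rewrite exchange_big -[X in _ <= X]S1; apply: ler_sum => q _; rewrite exchange_big; apply: ler_sum => i _.
rewrite -mulr_sumr -[X in _ <= X]mulr1; apply: ler_wpM2l; first by rewrite invr_ge0 ler0n.
cbv zeta; have one : \sum_t (s == t)%:R = 1 :> R.
  by rewrite (bigD1 s) //= eqxx big1 ?addr0 // => t; rewrite eq_sym => /negbTE ->.
have main (b : bool) (a : R) o : 0 <= a -> a <= 1 ->
    \sum_t (if b then a * (sameconf (val t) o)%:R + (1 - a) * (s == t)%:R else (s == t)%:R) <= 1.
  move=> a0 a1; case: b; last by rewrite one.
  rewrite big_split /= -!mulr_sumr one mulr1 -lerBrDr opprB addrCA subrr addr0.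
  by rewrite -[X in _ <= X]mulr1; apply: ler_wpM2l => //; exact: sum_sameconf_le1.
by apply: main; [rewrite le_min ler01 exprz_ge0 ?ltW | rewrite ge_min lexx].
Qed.

Lemma Mkernel_gt0 s t x : s != t -> x \in moves s t -> 0 < Mkernel lam s t.
Proof.
move=> st xm; rewrite Mkernel_moves //.
have n0 : (0 < n)%N by case: x {xm} => -[a _] _; exact: leq_ltn_trans (leq0n a) (ltn_ord a).
rewrite !mulr_gt0 ?invr_gt0 ?ltr0n ?muln_gt0 //.
  by rewrite lt_min ltr01 exprz_gt0.
by apply/card_gt0P; exists x.
Qed.

(** Irreducibility as an induction principle: both states reach vertical lines, these are translates
    of each other, and moves can be reversed. *)
Lemma moves_pos (Pr : Omega n -> Prop) : (0 < n)%N ->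
  (forall s t x, s != t -> x \in moves s t -> Pr s -> Pr t) ->
  forall s t, Pr s -> Pr t.
Proof.
move=> n0 step.
have sym s t x : s != t -> x \in moves s t -> Pr t -> Pr s.
  move=> st xm; have : (0 < #|moves t s|)%N by rewrite -card_moves_sym; apply/card_gt0P; exists x.
  by case/card_gt0P => y; apply: step; rewrite eq_sym.
have along A B : reach A B -> valid n A -> forall s t, rep s A -> rep t B -> Pr s <-> Pr t.
  elim=> [{}A _ s t sA tA|{}A {}B l i rAB IH lB l'B ok v vA s t sA tB].
    by rewrite (rep_unique sA tA).
  have vB := reach_valid vA rAB; have [u uB] := rep_exists vB n0.
  rewrite (IH vA s u sA uB); have [<-//|ut] := eqVneq u t.
  have [w Ew] := uB; have [z Ez] := tB.
  have /imfsetP[q /= qu eq] : l - w \in cells (val u) by rewrite Ew subrK.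
  have xm : (q, inord (i %% 6)%N) \in moves u t.
    rewrite inE /= qu /= dir_inord addpE -eq; apply/andP; split.
      have oE p : occ (val u) p = (p + w \in B) by rewrite -mem_cells.
      apply: ring_ok_moveok; first by rewrite oE addrAC subrK.
      rewrite (@ring_ok_eq _ (fun k => ring8 l i k \in B)) // => k k8.
      rewrite oE; suff -> : ring8 (l - w) i k + w = ring8 l i k by [].
      by case: k k8 => [|[|[|[|[|[|[|[|k]]]]]]]] // _; rewrite /ring8 /=;
        rewrite addrAC ?(addrAC (l - w) _ w) subrK.
    apply/asboolP; exists (z - w) => p; rewrite /moved.
    have e : p + (z - w) + w = p + z by rewrite -addrA subrK.
    rewrite addpE -!mem_cells Ew Ez in_swap e.
    have -> : (p + (z - w) == l - w + dir i) = (p + z == l + dir i).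
      by rewrite -(inj_eq (addIr w)) e addrAC subrK.
    by have -> : (p + (z - w) == l - w) = (p + z == l) by rewrite -(inj_eq (addIr w)) e subrK.
  by split; [exact: step ut xm | exact: sym ut xm].
have line (s : Omega n) : exists A, reach (cells (val s)) A /\ isline A.
  exact: reach_line (Omega_valid s) n0.
move=> s t Ps; have [A [sA lA]] := line s; have [C [tC lC]] := line t.
have vA := reach_valid (Omega_valid s) sA; have vC := reach_valid (Omega_valid t) tC.
have [a ra] := rep_exists vA n0; have [c rc] := rep_exists vC n0.
have Pa : Pr a by apply/(along _ _ sA (Omega_valid s) s a (rep_self s) ra).
apply/(along _ _ tC (Omega_valid t) t c (rep_self t) rc).
suff -> : c = a by [].
by apply: (rep_unique rc); exact: rep_line vA vC lA lC ra.
Qed.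

(** Detailed balance makes the density [h] of [pi] against the weights harmonic; its maximum spreads
    along moves, so it is constant. *)
Theorem stationary_gibbs (pi : Omega n -> R) : stationary lam pi ->
  forall s t, pi s * W t = pi t * W s.
Proof.
move=> [pi0 pi1 st].
have [t0|no] := pickP (fun _ : Omega n => true); last by move=> s; have := no s.
move=> _ ; have n0 : (0 < n)%N.
  have /and4P[_ /andP[/existsP[q _] _] _ _] := valP t0.
  by case: q => -[a] *; exact: leq_ltn_trans (leq0n a) _.
pose h s := pi s / W s.
have hE s : pi s = h s * W s by rewrite /h divfK // gt_eqF.
have harm t : \sum_s Mkernel lam t s * h s = h t.
  apply: (mulIf (lt0r_neq0 (W0 t))); rewrite -hE -st mulr_suml; apply: eq_bigr => s _.
  by rewrite mulrAC (mulrC _ (W t)) -detailed_balance (hE s); rewrite mulrC mulrA mulrC.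
pose m := [arg max_(s > t0) h s]%O.
have hm s : h s <= h m by rewrite /m; case: arg_maxP => // k _ /(_ s); apply.
have step s t x : s != t -> x \in moves s t -> h s = h m -> h t = h m.
  move=> stn xm hs; apply/eqP; rewrite eq_sym -subr_eq0.
  have K0 := Mkernel_gt0 stn xm.
  (* With a nonnegative maximum, row sums bounded by 1 suffice for the maximum principle. *)
  have hm0 : 0 <= h m by apply: le_trans (hm t0); rewrite divr_ge0 // ltW.
  have : \sum_u Mkernel lam s u * (h m - h u) <= 0.
    rewrite (eq_bigr (fun u => Mkernel lam s u * h m - Mkernel lam s u * h u)); last by move=> u _; rewrite mulrBr.
    rewrite sumrB -mulr_suml harm hs subr_le0 -[leRHS]mul1r ler_wpM2r //.
    exact: Mkernel_sum_le1.
  rewrite (bigD1 t) //= => le0.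
  have ge0 : 0 <= \sum_(u | u != t) Mkernel lam s u * (h m - h u).
    by apply: sumr_ge0 => u _; rewrite mulr_ge0 ?Mkernel_ge0 // subr_ge0.
  have le1 : Mkernel lam s t * (h m - h t) <= 0 by apply: le_trans le0; rewrite lerDl.
  by rewrite eq_le subr_ge0 hm andbT -(pmulr_rle0 _ K0).
have all s : h s = h m by apply: (moves_pos n0 step (s := m)).
by move=> s t; rewrite !hE !all -!mulrA (mulrC (W s)).
Qed.

End Kernel.

(** * Configurations with a short boundary *)

(** Sixths of a full turn from direction [c] counterclockwise to the next occupied one; 6 means a
    return to [c] itself, 7 that no neighbour is occupied. *)
Definition turn (o : pt -> bool) (p : pt) (c : nat) : nat :=
  (find (fun k => o (p + dir (c + k))) (iota 1 6)).+1.

Lemma turn_le (o : pt -> bool) (p : pt) c k : (0 < k <= 6)%N -> o (p + dir (c + k)) -> (turn o p c <= k)%N.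
Proof.
case/andP=> k0 k6 ok; rewrite /turn leqNgt ltnS; apply/negP => kt.
have := @before_find _ 0%N (fun k => o (p + dir (c + k))) (iota 1 6) k.-1.
rewrite nth_iota; last by clear - k0 k6; lia.
by rewrite add1n prednK // ok => /(_ kt).
Qed.

Lemma turn_occ (o : pt -> bool) (p : pt) c j : o (p + dir j) -> o (p + dir (c + turn o p c)) /\ (turn o p c <= 6)%N.
Proof.
(* [k] represents [j - c] modulo 6 in the range 1..6, with [5 * j] standing for [- j]. *)
move=> oj; pose k := (6 - (c + 5 * j) %% 6)%N.
have kk : (0 < k <= 6)%N by rewrite /k; have := ltn_mod (c + 5 * j) 6; clear; lia.
have ek : dir (c + k) = dir j.
  rewrite /dir; congr nth; apply/eqP; rewrite -(eqn_modDr (5 * j)) addnAC.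
  rewrite -modnDml /k subnKC; last by rewrite ltnW // ltn_mod.
  by rewrite -mulSn modnMr.
have t6 := turn_le kk (_ : o (p + dir (c + k))); rewrite ek in t6.
have {}t6 : (turn o p c <= 6)%N by apply: leq_trans (t6 oj) _; case/andP: kk.
split=> //; have h : has (fun k => o (p + dir (c + k))) (iota 1 6) by rewrite has_find size_iota.
by have := nth_find 0%N h; rewrite nth_iota // -size_iota -has_find.
Qed.

Lemma turn1 (o : pt -> bool) (p : pt) c : o (p + dir (c + 1)) -> turn o p c = 1%N.
Proof. by rewrite /turn /= => ->. Qed.

Lemma turnS (o : pt -> bool) (p : pt) c j : o (p + dir j) -> ~~ o (p + dir (c + 1)) ->
  turn o p c = (turn o p (c + 1)).+1.
Proof.
move=> oj o1; have [ot t6] := turn_occ c oj; have [ot' t'6] := turn_occ (c + 1) oj.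
have t1 : turn o p c != 1%N by apply: contraNneq o1 => e; rewrite -e.
have t0 : (0 < turn o p c)%N by [].
have t'0 : (0 < turn o p (c + 1))%N by [].
have h1 : (turn o p (c + 1) <= (turn o p c).-1)%N.
  apply: turn_le; first by clear - t0 t1 t6; lia.
  by rewrite -addnA add1n prednK.
have t'5 : (turn o p (c + 1) <= 5)%N by clear - h1 t6; lia.
have h2 : (turn o p c <= (turn o p (c + 1)).+1)%N.
  by apply: turn_le; [clear - t'5; lia | rewrite -add1n addnA].
by clear - h1 h2 t0; lia.
Qed.

Definition dnext (o : pt -> bool) (p : pt) (c : nat) : nat := ((c + turn o p c) %% 6)%N.

Lemma dnext_mod (o : pt -> bool) (p : pt) c : dnext o p (c %% 6) = dnext o p c.
Proof.
rewrite /dnext modnDml; congr ((_ + _) %% 6)%N.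
by rewrite /turn; congr S; apply: eq_find => k; rewrite /= -dir_modr.
Qed.

(** Cyclic succession permutes the occupied directions: turning from [b] stops at [c] at the latest,
    and turning from [c] stops at [b] at the latest. *)
Lemma dnext_inj (o : pt -> bool) (p : pt) b c : (b < 6)%N -> (c < 6)%N -> o (p + dir b) -> o (p + dir c) ->
  dnext o p b = dnext o p c -> b = c.
Proof.
wlog bc : b c / (b <= c)%N.
  move=> W b6 c6 ob oc e; have [bc|/ltnW cb] := leqP b c; first exact: W.
  by apply/esym; apply: W.
move=> b6 c6 ob oc; rewrite leq_eqVlt in bc; case/orP: bc => [/eqP //|bc] e; exfalso.
have t1 : (turn o p b <= c - b)%N.
  by apply: turn_le; [clear - bc b6 c6; lia | rewrite subnKC // ltnW].
have t2 : (turn o p c <= 6 - (c - b))%N.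
  apply: turn_le; first by clear - bc b6 c6; lia.
  by have -> : (c + (6 - (c - b)) = b + 6)%N; [clear - bc c6; lia | rewrite dirD6].
have p1 : (0 < turn o p b)%N by []. have p2 : (0 < turn o p c)%N by [].
by move: e; rewrite /dnext; clear - t1 t2 p1 p2 bc b6 c6; lia.
Qed.

(** * The boundary walk on darts *)

Section Walk.
Variables (n : nat) (S : {set B n}).
Let o := occ S.

Lemma occ_emb q : o (emb q) = (q \in S).
Proof. by rewrite /o -mem_cells emb_cells. Qed.

Lemma occE p : o p -> exists2 q, q \in S & p = emb q.
Proof. by rewrite /o -mem_cells => /imfsetP[q /= qS ->]; exists q. Qed.

Lemma boxpt_emb q : boxpt n (emb q) = Some q.
Proof.
rewrite /boxpt; case: pickP => [r /eqP /emb_inj -> //|/(_ q)].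
by rewrite eqxx.
Qed.

Definition dart (d : B n * 'I_6) : bool := (d.1 \in S) && o (emb d.1 + dir d.2).

Lemma step_dart (v u : B n) i : u \in S -> emb u + dir i = emb v -> v \in S ->
  step S (u, inord (i %% 6)%N) = (v, inord (dnext o (emb v) (i + 3))).
Proof.
move=> uS uv vS; rewrite /step /= inordK ?ltn_mod // addpE -dir_mod uv boxpt_emb vS.
congr (_, inord _).
suff <- : dnext o (emb v) (i %% 6 + 3) = dnext o (emb v) (i + 3) by [].
by rewrite -[LHS]dnext_mod modnDml dnext_mod.
Qed.

(* Unlike [step], [vstep] is injective, so that its orbits are cycles. *)
Definition vstep (d : B n * 'I_6) := if dart d then step S d else d.

Lemma dart_next d : dart d -> exists2 v : B n, v \in S & emb d.1 + dir d.2 = emb v /\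
  step S d = (v, inord (dnext o (emb v) (d.2 + 3))).
Proof.
case: d => u i /= /andP[uS /occE[v vS e]]; exists v => //; split=> //.
by rewrite -(step_dart uS e vS) modn_small ?ltn_ord // inord_val.
Qed.

Lemma dart_back d (v : B n) : dart d -> emb d.1 + dir d.2 = emb v -> o (emb v + dir (d.2 + 3)).
Proof. by case/andP=> dS _ <-; rewrite dir_opp addrK occ_emb. Qed.

Lemma dart_dnext (v : B n) c j : v \in S -> o (emb v + dir j) -> dart (v, inord (dnext o (emb v) c)).
Proof.
move=> vS oj; rewrite /dart /= vS inordK ?ltn_mod // /dnext -dir_mod.
by have [] := turn_occ c oj.
Qed.

Lemma dart_step d : dart d -> dart (step S d).
Proof.
move=> dd; have [v vS [ev ->]] := dart_next dd.
by apply: dart_dnext => //; exact: (dart_back dd ev).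
Qed.

Lemma vstep_inj : injective vstep.
Proof.
move=> d1 d2; rewrite /vstep; case: (boolP (dart d1)) => D1; case: (boolP (dart d2)) => D2 //.
- have [v vS [ev ->]] := dart_next D1; have [w wS [ew ->]] := dart_next D2.
  move=> [evw]; subst w => /(congr1 (@nat_of_ord 6)); rewrite !inordK ?ltn_mod //.
  have b1 := dart_back D1 ev; have b2 := dart_back D2 ew.
  rewrite -(dnext_mod _ _ (d1.2 + 3)) -(dnext_mod _ _ (d2.2 + 3)).
  move=> /dnext_inj - /(_ (ltn_mod _ _) (ltn_mod _ _)); rewrite -!dir_mod => /(_ b1 b2) e.
  case: d1 d2 D1 D2 ev ew e {b1 b2} => [u i] [u' i'] /= _ _ ev ew e.
  have ii : i = i' by apply: val_inj => /=; move: (ltn_ord i) (ltn_ord i') e; clear; lia.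
  by subst i'; rewrite -ew in ev; move/addIr: ev => /emb_inj ->.
- by move=> e; rewrite -e dart_step in D2.
- by move=> e; rewrite e dart_step in D1.
Qed.

Lemma iter_vstep d k : dart d -> iter k vstep d = iter k (step S) d /\ dart (iter k (step S) d).
Proof.
move=> D; elim: k => //= k [-> Dk]; rewrite /vstep Dk; split=> //.
exact: dart_step.
Qed.

Variable d0 : B n * 'I_6.
Hypothesis D0 : dart d0.

(* The corner of the empty location [v + dir c] at [v] is visited by the boundary walk of [d0]. *)
Definition seen (v : B n) (c : nat) : bool := fconnect vstep d0 (v, inord (dnext o (emb v) c)).

Lemma seen_mod v c : seen v (c %% 6) = seen v c. Proof. by rewrite /seen dnext_mod. Qed.

(** The walk passes over the empty direction [c + 1], so both corners lead to the same outgoing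
    dart. *)
Lemma seen_turn (v : B n) c j : o (emb v + dir j) -> ~~ o (emb v + dir (c + 1)) -> seen v c = seen v (c + 1).
Proof. by move=> oj oc; rewrite /seen /dnext (turnS oj oc) addnS -addSn addn1. Qed.

(** Here [v + dir c] and [w + dir (c + 5)] are the same empty location. The walk leaves its corner
    at [v] along the dart to [w], and the next turn passes its corner at [w]. *)
Lemma seen_step (v w : B n) c : v \in S -> w \in S -> emb v + dir (c + 1) = emb w ->
  ~~ o (emb v + dir c) -> seen v c = seen w (c + 5).
Proof.
move=> vS wS e nc; rewrite /seen.
have o1 : o (emb v + dir (c + 1)) by rewrite e occ_emb.
have -> : dnext o (emb v) c = ((c + 1) %% 6)%N by rewrite /dnext turn1.
have E : vstep (v, inord ((c + 1) %% 6)%N) = (w, inord (dnext o (emb w) (c + 5))).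
  rewrite /vstep (_ : dart _ = true); last by rewrite /dart /= vS inordK ?ltn_mod // -dir_mod.
  rewrite (step_dart vS e wS); congr (_, inord _).
  have back : o (emb w + dir (c + 4)).
    by rewrite -e -[4%N]/(1 + 3)%N addnA dir_opp addrK occ_emb.
  have [-> e5] : (c + 1 + 3 = c + 4)%N /\ (c + 4 + 1 = c + 5)%N by rewrite -!addnA.
  rewrite /dnext (turnS back) e5; first by rewrite addnS -addSn -[(c + 4).+1]addn1 e5.
  apply: contra nc; suff -> : emb w + dir (c + 5) = emb v + dir c by [].
  rewrite -e -addrA; congr (_ + _); move: (c) => c'; dir_cases c'.
by rewrite -E; apply/idP/idP => h; [apply: connect_trans h (fconnect1 _ _)|
  apply: connect_trans h _; rewrite (fconnect_sym vstep_inj) fconnect1].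
Qed.

End Walk.

(** * Visited boundary edges as a cochain modulo 2 *)

Section Cut.
Variables (n : nat) (S : {set B n}).
Let o := occ S.
Variable d0 : B n * 'I_6.
Hypothesis nbS : forall v, v \in S -> exists j, o (emb v + dir j).

Definition seenp (p : pt) (c : nat) : bool := [exists v : B n, (emb v == p) && seen S d0 v c].

Lemma seenp_emb v c : seenp (emb v) c = seen S d0 v c.
Proof.
apply/existsP/idP => [[w /andP[/eqP /emb_inj ->]] //|h].
by exists v; rewrite eqxx.
Qed.

Lemma seenp_mod p c : seenp p (c %% 6) = seenp p c.
Proof. by apply: eq_existsb => v; rewrite seen_mod. Qed.

(* The visited edges between occupied and empty locations form a cochain which vanishes on
   triangles ([tri_cut0]), hence is the coboundary of [side_of]. As [side_of] is constant on the
   configuration and on its complement, one walk visits all or none of these edges. *)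
Definition cut (p : pt) (c : nat) : bool :=
  if o p then ~~ o (p + dir c) && seenp p c
  else o (p + dir c) && seenp (p + dir c) (c + 3).

Lemma cut_mod (p : pt) c : cut p (c %% 6) = cut p c.
Proof.
by rewrite /cut -dir_mod seenp_mod -(seenp_mod _ (_ %% 6 + 3)) modnDml seenp_mod.
Qed.

Lemma cut_sym (p : pt) c : cut (p + dir c) (c + 3) = cut p c.
Proof.
rewrite /cut dir_opp addrK -addnA -(seenp_mod p (c + 6)) modnDr seenp_mod.
by case: (o p); case: (o (p + dir c)).
Qed.

Lemma seenp_turn (p : pt) c : o p -> ~~ o (p + dir (c + 1)) -> seenp p c = seenp p (c + 1).
Proof.
by case/occE => v vS -> h; rewrite !seenp_emb; have [j oj] := nbS vS; exact: seen_turn oj h.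
Qed.

Lemma seenp_step (p : pt) c : o p -> o (p + dir (c + 1)) -> ~~ o (p + dir c) ->
  seenp p c = seenp (p + dir (c + 1)) (c + 5).
Proof.
by case/occE => v vS -> /occE[w wS ew] h; rewrite ew !seenp_emb; exact: seen_step h.
Qed.

Definition tri_cut (p : pt) c := cut p c (+) cut p (c + 1) (+) cut (p + dir c) (c + 2).

Lemma tri_rot (p : pt) c : tri_cut (p + dir c) (c + 2) = tri_cut p c.
Proof.
have e : p + dir c + dir (c + 2) = p + dir (c + 1) by rewrite -addrA dir_step.
rewrite /tri_cut e -addnA cut_sym -(cut_sym p (c + 1)) -!addnA.
by case: (cut p c); case: (cut _ _); case: (cut _ _).
Qed.

(** After rotation the vertex that may differ in occupation from the other two is [q]. The two mixed
    edges then have equal values by [seenp_turn] if [q] is occupied and by [seenp_step] if it is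
    empty. *)
Lemma tri_cut0 (p : pt) c : tri_cut p c = false.
Proof.
have e (q : pt) d : q + dir d + dir (d + 2) = q + dir (d + 1) by rewrite -addrA dir_step.
have key (q : pt) d : o (q + dir d) = o (q + dir (d + 1)) -> tri_cut q d = false.
  move=> oo; rewrite /tri_cut {3}/cut e oo; case: (boolP (o q)) => oq.
    rewrite {1 2}/cut oq oo; case: (boolP (o (q + dir (d + 1)))) => //= h.
    by rewrite (seenp_turn oq h) addbb.
  rewrite {1 2}/cut (negbTE oq) oo; case: (boolP (o (q + dir (d + 1)))) => //= h.
  have b : q + dir (d + 1) + dir (d + 4) = q by rewrite -[4%N]/(1 + 3)%N addnA dir_opp addrK.
  have b' : q + dir (d + 1) + dir (d + 4 + 1) = q + dir d.
    rewrite -addrA -[(d + 4 + 1)%N]addnA; congr (_ + _); move: (d) => d'; clear; dir_cases d'.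
  have := @seenp_step (q + dir (d + 1)) (d + 4) h; rewrite b b' oo h => /(_ isT oq).
  rewrite -!addnA => ->; rewrite -(seenp_mod _ (d + 9)) (_ : d + 9 = d + 3 + 6)%N ?modnDr ?seenp_mod.
    by rewrite addbF addbb.
  by rewrite -addnA.
case: (boolP (o (p + dir c) == o (p + dir (c + 1)))) => [/eqP /key //|h].
have [h1|h1] := eqVneq (o (p + dir (c + 1))) (o p).
  rewrite -tri_rot; apply: key; rewrite e -addnA; rewrite h1.
  by rewrite dir_opp addrK.
rewrite -tri_rot -tri_rot; apply: key; rewrite (e p c) (_ : c + 2 + 2 = c + 4)%N -?addnA // addnA.
have e1 : p + dir (c + 1) + dir (c + 4) = p by rewrite -[4%N]/(1 + 3)%N addnA dir_opp addrK.
have e2 : p + dir (c + 1) + dir (c + 4 + 1) = p + dir c.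
  rewrite -addrA -[(c + 4 + 1)%N]addnA; congr (_ + _); move: (c) => d'; clear; dir_cases d'.
by rewrite e1 e2; case: (o p) (o (p + dir c)) (o (p + dir (c + 1))) h h1 => [] [] [].
Qed.

(** Potential of [cut], obtained by summing along the horizontal ray to the left of [p] and
    truncated after [K] edges. *)
Definition ray_parity (K : nat) (p : pt) : bool :=
  \big[addb/false]_(k < K) cut (p + dir 3 *+ k) 3.

Lemma ray_parityS K p : ray_parity K.+1 p = cut p 3 (+) ray_parity K (p + dir 3).
Proof.
rewrite /ray_parity big_ord_recl mulr0n addr0; congr (_ (+) _).
by apply: eq_bigr => k _; rewrite /= mulrS addrA.
Qed.

(** The strip between the two parallel rays is cut into triangles, two per step; their vanishing
    sums leave only the two end edges. *)
Lemma ray_parity_up K (p : pt) :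
  ray_parity K p (+) ray_parity K (p + dir 1) = cut p 1 (+) cut (p + dir 3 *+ K) 1.
Proof.
elim: K p => [|K IH] p; first by rewrite /ray_parity !big_ord0 mulr0n addr0 !addbb.
rewrite !ray_parityS mulrS addrA (addrAC p (dir 1)).
have t1 : tri_cut p 1 = false := tri_cut0 p 1.
have t2 : tri_cut p 2 = false := tri_cut0 p 2.
move: (IH (p + dir 3)) t1 t2; rewrite /tri_cut.
have -> : p + dir 2 = p + dir 3 + dir 1 by rewrite -addrA -[dir 3 + dir 1]/(dir 2).
rewrite (cut_sym (p + dir 3) 1).
by case: (ray_parity _ _); case: (ray_parity _ _); case: (cut p 1); case: (cut _ _);
  case: (cut _ _); case: (cut _ _); case: (cut _ _); case: (cut _ _).
Qed.

Lemma occ_box (p : pt) : o p -> (0 <= p.1 < n%:Z) /\ (0 <= p.2 < n%:Z).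
Proof.
case/occE => q _ ->; rewrite /= !ltz_nat; split; [exact: ltn_ord | exact: ltn_ord].
Qed.

Lemma cut0 (p : pt) c : ~~ o p -> ~~ o (p + dir c) -> cut p c = false.
Proof. by rewrite /cut => /negbTE -> /negbTE ->. Qed.

Lemma ptD1 (p q : pt) : (p + q).1 = p.1 + q.1. Proof. by []. Qed.
Lemma ptD2 (p q : pt) : (p + q).2 = p.2 + q.2. Proof. by []. Qed.

Lemma dir3_mul k : dir 3 *+ k = (- k%:Z, 0).
Proof.
elim: k => [|k IH]; first by rewrite mulr0n.
by rewrite mulrS IH [LHS]surjective_pairing ptD1 ptD2 /=; congr pair; clear; lia.
Qed.

Lemma cut_left (p : pt) c : p.1 < -1 -> cut p c = false.
Proof.
move=> h; apply: cut0; apply/negP => /occ_box [].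
  by clear - h; lia.
have : (dir c).1 <= 1 by dir_cases c.
by rewrite ptD1; clear - h; lia.
Qed.

(** This length takes the ray past the left side of the box, so longer rays give the same value. *)
Definition side_of (p : pt) : bool := ray_parity (`|p.1| + 2)%N p.

Lemma ray_parity_side K p : (`|p.1| + 2 <= K)%N -> ray_parity K p = side_of p.
Proof.
move=> pK; rewrite -(subnK pK); elim: (K - _)%N => [//|m IH]; rewrite addSn -{}IH.
rewrite /ray_parity big_ord_recr /= cut_left ?addbF // dir3_mul ptD1 /=.
by clear; lia.
Qed.

Lemma side3 p : side_of p (+) side_of (p + dir 3) = cut p 3.
Proof.
rewrite -(@ray_parity_side (`|p.1| + 4)%N p) -?(@ray_parity_side (`|p.1| + 3)%N (p + dir 3)).
- by rewrite addnS ray_parityS addbK.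
- by rewrite ptD1 /=; clear; lia.
- by clear; lia.
Qed.

Lemma side1 p : side_of p (+) side_of (p + dir 1) = cut p 1.
Proof.
rewrite -(@ray_parity_side (`|p.1| + 4)%N p) -?(@ray_parity_side (`|p.1| + 4)%N (p + dir 1)).
- rewrite ray_parity_up [X in _ (+) X]cut_left ?addbF // dir3_mul ptD1 /=.
  by clear; lia.
- by rewrite ptD1 /=; clear; lia.
- by clear; lia.
Qed.

Lemma side_cut p c : side_of p (+) side_of (p + dir c) = cut p c.
Proof.
have opp q d : side_of (q + dir d) (+) side_of (q + dir d + dir (d + 3)) = cut (q + dir d) (d + 3) ->
    side_of q (+) side_of (q + dir d) = cut q d.
  by rewrite cut_sym dir_opp addrK addbC.
have s2 q : side_of q (+) side_of (q + dir 2) = cut q 2.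
  move: (side1 q) (side3 (q + dir 1)) (tri_cut0 q 1); rewrite /tri_cut /=.
  rewrite -addrA -[dir 1 + dir 3]/(dir 2) => <- <-.
  by case: (side_of _); case: (side_of _); case: (side_of _); case: (cut _ _).
rewrite -cut_mod dir_mod; have : (c %% 6 < 6)%N by rewrite ltn_mod.
case: (c %% 6)%N => [|[|[|[|[|[|]]]]]] // _.
- by apply: opp; exact: side3.
- exact: side1.
- exact: side3.
- by apply: opp; rewrite -cut_mod dir_mod; exact: side1.
- by apply: opp; rewrite -cut_mod dir_mod; exact: s2.
Qed.

Lemma side_far (p : pt) : ~~ ((0 <= p.1 < n%:Z) && (0 <= p.2 < n%:Z)) -> side_of p = false.
Proof.
have row (q : pt) : (q.2 < 0) || (n%:Z <= q.2) -> side_of q = false.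
  move=> h; apply: big1 => k _; apply: cut0; apply/negP => /occ_box []; rewrite dir3_mul !ptD2 /=.
    by clear - h; lia.
  by clear - h; lia.
(* To the right of the box, steps in direction 1 meet no particle and end in a row above the box,
   where the ray is empty. *)
have right k (q : pt) : n%:Z <= q.1 -> n%:Z <= q.2 + k%:Z -> side_of q = false.
  elim: k q => [|k IH] q q1 q2; first by apply: row; clear - q2; lia.
  have n1 : ~~ o q by apply/negP => /occ_box []; clear - q1; lia.
  have n2 : ~~ o (q + dir 1) by apply/negP => /occ_box []; rewrite ptD1 /=; clear - q1; lia.
  have e : side_of (q + dir 1) = false.
    by apply: IH; rewrite ?ptD1 ?ptD2 /=; clear - q1 q2; lia.
  by move: (side_cut q 1); rewrite (cut0 n1 n2) e addbF.
move=> h; have [h2|/negbTE h2] := boolP ((p.2 < 0) || (n%:Z <= p.2)); first exact: row.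
have [p1|p1] := lerP 0 p.1.
  by apply: (right (absz (n%:Z - p.2)%R)); clear - h h2 p1; lia.
apply: big1 => k _; apply: cut0; apply/negP => /occ_box []; rewrite dir3_mul !ptD1 /=.
  by clear - p1; lia.
by clear - p1; lia.
Qed.

End Cut.

Section Outer.
Variables (n : nat) (S : {set B n}).
Let o := occ S.
Variable d0 : B n * 'I_6.
Hypothesis nbS : forall v, v \in S -> exists j, o (emb v + dir j).
Hypothesis hS : holefree (cells S).
Hypothesis cS : connected (cells S).

(** [side_of] is constant along a path of empty locations, and the norm [2 * n + 2] lies beyond the
    box, where it vanishes. *)
Lemma side_out (p : pt) : ~~ o p -> side_of S d0 p = false.
Proof.
move=> np; have [|q pq Nq] := hS (p := p) _ (2 * n + 2)%N; first by rewrite mem_cells.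
have [<- _] : side_of S d0 q = side_of S d0 p /\ ~~ o q.
  apply: (@conn_ind _ (fun z => side_of S d0 z = side_of S d0 p /\ ~~ o z) _ _ _ _ pq) => [u v [<- nu] nv /adjP[c _ ev]|]; last by [].
  rewrite mem_cells in nv; split=> //; subst v.
  by have := side_cut d0 nbS u c; rewrite cut0 //; case: (side_of _ _ _); case: (side_of _ _ _).
apply: side_far => //; move: Nq; rewrite /norm1; clear; lia.
Qed.

(** Across an edge to an empty location [side_of] drops to 0, so its value at the particle tells
    whether that edge is visited. It is constant on the connected configuration, so one visited edge
    forces all. *)
Lemma seen_all u : u \in S -> ~~ o (emb u + dir 1) -> seen S d0 u 1 ->
  forall v c, v \in S -> ~~ o (emb v + dir c) -> seen S d0 v c.
Proof.
move=> uS nu su.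
have cutE v c : v \in S -> ~~ o (emb v + dir c) -> side_of S d0 (emb v) = seen S d0 v c.
  move=> vS nv; have := side_cut d0 nbS (emb v) c; rewrite (side_out nv) addbF => ->.
  by rewrite /cut occ_emb vS nv seenp_emb.
move=> v c vS nv; rewrite -cutE //.
suff -> : side_of S d0 (emb v) = side_of S d0 (emb u) by rewrite (cutE u 1%N).
have uP : emb u \in cells S by rewrite emb_cells.
have vP : emb v \in cells S by rewrite emb_cells.
pose K (z : pt) := side_of S d0 z = side_of S d0 (emb u) /\ z \in cells S.
suff [-> _] : K (emb v) by [].
have := cS uP vP; apply: (@conn_ind (fun z => z \in cells S) K) => [x y [ex xS] yS /adjP[d _ ey]|]; last by [].
split=> //; rewrite -ex; subst y; have := side_cut d0 nbS x d; rewrite mem_cells in xS; rewrite mem_cells in yS.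
by rewrite /cut xS yS; case: (side_of _ _ _); case: (side_of _ _ _).
Qed.

End Outer.

Lemma start_spec n (S : {set B n}) : S != set0 ->
  exists2 u, start S = Some u & u \in S /\ ~~ occ S (emb u + dir 1).
Proof.
move=> /set0Pn [q0 q0S].
pose m (q : B n) := (q.1 * n + q.2)%N.
have [u [uS um]] : exists u, u \in S /\ forall q, q \in S -> (m q <= m u)%N.
  by case: (arg_maxnP (P := fun q => q \in S) m q0S) => u uS um; exists u.
have lex q : q \in S -> ((q.1 : nat) < u.1)%N || (((q.1 : nat) == u.1) && ((q.2 : nat) <= u.2)%N).
  move=> /um; rewrite /m; have [//|h|/val_inj <-] := ltngtP (q.1 : nat) u.1; last by rewrite leq_add2l.
  have : (u.1.+1 * n <= q.1 * n)%N by rewrite leq_mul2r h orbT.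
  rewrite mulSn; move: (ltn_ord u.2) => u2 H1 H2; exfalso; move: u2 H1 H2.
  by move: (nat_of_ord q.2) (nat_of_ord u.2) (_ * _)%N (_ * _)%N; clear; lia.
rewrite /start; case: pickP => [v /andP[vS /forallP vm]|/(_ u)]; last first.
  by rewrite uS /=; move/negP; case; apply/forallP => q; apply/implyP; exact: lex.
exists v => //; split=> //; apply/negP => /occE[w wS ew].
have e1 : (w.1 : nat)%:Z = (v.1 : nat)%:Z + 0 by exact: (congr1 fst (esym ew)).
have e2 : (w.2 : nat)%:Z = (v.2 : nat)%:Z + 1 by exact: (congr1 snd (esym ew)).
by have /implyP/(_ wS) := vm w; move: e1 e2; clear; lia.
Qed.

Lemma Omega_nbr n (s : Omega n) v : (1 < n)%N -> v \in val s -> exists j, occ (val s) (emb v + dir j).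
Proof.
move=> n1 vS; have [cA cn _] := Omega_valid s.
have vP : emb v \in cells (val s) by rewrite emb_cells.
have [x xP xv] : exists2 x, x \in cells (val s) & x != emb v.
  have : (0 < #|` cells (val s) `\ emb v|)%N by move: (cardfsD1 (emb v) (cells (val s))); rewrite vP cA; clear - n1; lia.
  by rewrite cardfs_gt0 => /fset0Pn[x]; rewrite !inE => /andP[xv xP]; exists x.
have [[|y t] [/= pt Pt e]] := cn _ _ vP xP; first by rewrite e eqxx in xv.
move: pt Pt => /andP[/adjP[j _ ey] _] /andP[]; rewrite mem_cells ey => yP _.
by exists j.
Qed.

Definition walk n (S : {set B n}) (d : B n * 'I_6) K : B n * 'I_6 := iter K (step S) d.

Definition start_dart n (S : {set B n}) (u : B n) : B n * 'I_6 := (u, inord (dnext (occ S) (emb u) 1)).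

(** The starting dart is the first one after the empty direction 1 at [u], so that corner is visited
    and [seen_all] applies; on darts the orbits of [vstep] and [step] agree. *)
Lemma perim_start n (s : Omega n) : (1 < n)%N ->
  exists2 u, start (val s) = Some u &
   [/\ dart (val s) (start_dart (val s) u),
       perim (val s) = order (step (val s)) (start_dart (val s) u) &
       forall v c, v \in val s -> ~~ occ (val s) (emb v + dir c) ->
         exists2 k, (k < perim (val s))%N & v = (walk (val s) (start_dart (val s) u) k).1].
Proof.
move=> n1; have [cA cn hn] := Omega_valid s; set S := val s in cA cn hn *.
have [|u eu [uS nu]] := @start_spec n S.
  by rewrite -card_gt0 -card_cells cA ltnW.
exists u => //; have nb v : v \in S -> exists j, occ S (emb v + dir j) := @Omega_nbr n s v n1.
have [j uj] := nb u uS.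
have dd : dart S (start_dart S u) by exact: (dart_dnext 1 uS uj).
have pe : perim S = order (step S) (start_dart S u).
  rewrite /perim eu; set j' := (_ %% 6)%N.
  have ej : j' = dnext (occ S) (emb u) 1 by [].
  rewrite ej ifT // addpE /dnext -dir_mod.
  by have [] := turn_occ 1 uj.
split=> // v c vS nv.
have su : seen S (start_dart S u) u 1 by exact: connect0.
have := seen_all nb hn cn uS nu su vS nv; rewrite /seen.
set d := (v, _) => h; have ed := iter_findex h.
have [e _] := iter_vstep (findex (vstep S) (start_dart S u) d) dd; rewrite e in ed.
have h' : fconnect (step S) (start_dart S u) d by rewrite -ed fconnect_iter.
exists (findex (step S) (start_dart S u) d); first by rewrite pe findex_max.
by rewrite /walk iter_findex.
Qed.

Lemma walk_in n (S : {set B n}) d k : dart S d -> (walk S d k).1 \in S.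
Proof. by move=> dd; have [_ /andP[]] := iter_vstep k dd. Qed.

Lemma walk_code n (S S' : {set B n}) d d' K : dart S d -> dart S' d' -> d.1 = d'.1 ->
  (forall k, (k < K)%N -> (walk S d k).2 = (walk S' d' k).2) ->
  forall k, (k < K)%N -> (walk S d k).1 = (walk S' d' k).1.
Proof.
move=> D D' e E; elim=> [//|k IH] kK; have kK' := ltnW kK.
have [_ Dk] := iter_vstep k D; have [_ Dk'] := iter_vstep k D'.
have [v _ [ev sv]] := dart_next Dk; have [v' _ [ev' sv']] := dart_next Dk'.
have -> : (walk S d k.+1).1 = v by rewrite -[walk _ _ _]/(step S (walk S d k)) sv.
have -> : (walk S' d' k.+1).1 = v' by rewrite -[walk _ _ _]/(step S' (walk S' d' k)) sv'.
apply: emb_inj; rewrite -ev -ev'.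
by rewrite -[iter k _ d]/(walk S d k) -[iter k _ d']/(walk S' d' k) IH // E.
Qed.

(* The vertices of the walk determine the configuration: a path to infinity that avoids [t] and
   starts in [s] would leave [s] at a vertex of the walk, and these all lie in [t]. *)
Lemma walk_subset n (s t : Omega n) u u' : (1 < n)%N ->
  start (val s) = Some u -> start (val t) = Some u' ->
  (forall k, (k < perim (val s))%N -> (walk (val s) (start_dart (val s) u) k).1 \in val t) ->
  val s \subset val t.
Proof.
move=> n1 es et W; have [v ev [_ _ H]] := perim_start s n1.
move: ev; rewrite es => -[ev]; subst v.
apply/subsetP => q qS; apply/negPn/negP => qT.
have [_ _ ht] := Omega_valid t.
have [|z qz Nz] := ht (emb q) _ (2 * n + 2)%N; first by rewrite mem_cells occ_emb.
have [zS _] : occ (val s) z /\ ~~ occ (val t) z.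
  apply: (@conn_ind _ (fun z => occ (val s) z /\ ~~ occ (val t) z) _ _ _ _ qz) => [x y [xs xt] yt /adjP[c _ ey]|]; last by rewrite !occ_emb.
  rewrite mem_cells in yt; split=> //; apply: contraT => ys; subst y.
  case/occE: xs => w wS ew; subst x.
  have [k kp ek] := H w c wS ys.
  by move: xt; rewrite occ_emb ek W.
have [] := occ_box zS; move: Nz; rewrite /norm1; clear; lia.
Qed.

(** The code is the starting particle and the first [K] outgoing directions, a shorter walk
    continuing around its cycle. Equal codes give equal vertices, and [walk_subset] applied both
    ways gives equal configurations. *)
Lemma card_perim_le n K : (1 < n)%N ->
  (#|[set s : Omega n | (perim (val s) <= K)%N]| <= n * n * 6 ^ K)%N.
Proof.
move=> n1; have n0 : (0 < n)%N := ltnW n1.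
pose q0 : B n := (Ordinal n0, Ordinal n0).
pose st (s : Omega n) := odflt q0 (start (val s)).
pose code (s : Omega n) : B n * {ffun 'I_K -> 'I_6} :=
  (st s, [ffun k : 'I_K => (walk (val s) (start_dart (val s) (st s)) k).2]).
have -> : (n * n * 6 ^ K)%N = #|{: B n * {ffun 'I_K -> 'I_6}}|.
  by rewrite !card_prod card_ffun !card_ord.
rewrite -(card_in_imset (f := code)) ?max_card // => s t.
rewrite !inE => ps pt [est ec]; apply: val_inj; apply/eqP; rewrite eqEsubset.
have [u es [ds _ _]] := perim_start s n1; have [u' et [dt _ _]] := perim_start t n1.
have eu : st s = u by rewrite /st es. have eu' : st t = u' by rewrite /st et.
rewrite eu eu' in est ec; rewrite -est in et dt ec.
have E k : (k < K)%N -> (walk (val s) (start_dart (val s) u) k).2 = (walk (val t) (start_dart (val t) u) k).2.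
  by move=> kK; move/ffunP: ec => /(_ (Ordinal kK)); rewrite !ffunE.
have V := walk_code ds dt erefl E.
apply/andP; split.
  by apply: (walk_subset n1 es et) => k kp; rewrite (V _ (leq_trans kp ps)) walk_in.
by apply: (walk_subset n1 et es) => k kp; rewrite -(V _ (leq_trans kp pt)) walk_in.
Qed.

(** * Lower bound for the partition function *)

Definition hrow (l y : int) (b : nat) : seq pt := [seq (l + k%:Z, y) | k <- iota 0 b].

Lemma mem_hrow (l y : int) b (x z : int) : ((x, z) \in hrow l y b) = (z == y) && (l <= x < l + b%:Z).
Proof.
apply/mapP/andP => [[k]|[/eqP -> /andP[lx xl]]].
  by rewrite mem_iota => kb [-> ->]; split=> //; clear - kb; lia.
exists (absz (x - l)%R); first by rewrite mem_iota; clear - lx xl; lia.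
by congr pair; clear - lx; lia.
Qed.

Lemma uniq_hrow (l y : int) b : uniq (hrow l y b).
Proof. by rewrite map_inj_uniq ?iota_uniq // => j k [/addrI []]. Qed.

(* A stack of horizontal rows: [(d, b)] puts a row of length [b] whose left end is
   displaced by [d] from the left end of the row below it. *)
Fixpoint stack (l y : int) (s : seq (int * nat)) : {fset pt} :=
  if s is (d, b) :: s' then [fset p in hrow (l + d) y b] `|` stack (l + d) (y + 1) s' else fset0.

(** A location touches the row above at its own abscissa and one to the left; the bounds on [d] say
    that the upper row meets the range from -1 to [b - 1], that is, touches the row below. *)
Fixpoint stack_ok (b : nat) (s : seq (int * nat)) : bool :=
  if s is (d, b') :: s' then [&& (0 < b')%N, - b'%:Z <= d, d < b%:Z & stack_ok b' s'] else true.

Lemma in_stack (l y : int) d b s (p : pt) :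
  (p \in stack l y ((d, b) :: s)) = (p \in hrow (l + d) y b) || (p \in stack (l + d) (y + 1) s).
Proof. by rewrite /= in_fsetU in_fset. Qed.

Lemma stack_height (l y : int) s (x z : int) : (x, z) \in stack l y s -> y <= z.
Proof.
elim: s l y => [|[d b] s IH] l y //; rewrite in_stack mem_hrow => /orP[|/IH].
  by clear; lia.
by clear; lia.
Qed.

Lemma stack_row0 (l y : int) d b s (x : int) :
  ((x, y) \in stack l y ((d, b) :: s)) = (l + d <= x < l + d + b%:Z).
Proof.
rewrite in_stack mem_hrow eqxx; case: (boolP (_ \in _)) => [/stack_height|_]; last by rewrite orbF.
by clear; lia.
Qed.

Lemma stack_rest (l y : int) d b s (x z : int) : z != y ->
  ((x, z) \in stack l y ((d, b) :: s)) = ((x, z) \in stack (l + d) (y + 1) s).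
Proof. by move=> zy; rewrite in_stack mem_hrow (negbTE zy). Qed.

Lemma stack_inj b0 b0' (l y : int) s s' : stack_ok b0 s -> stack_ok b0' s' ->
  stack l y s =i stack l y s' -> s = s'.
Proof.
elim: s b0 b0' l y s' => [|[d b] s IH] b0 b0' l y [|[d' b'] s'] //.
- by move=> _ /and4P[b'0 _ _ _] /(_ (l + d', y)); rewrite stack_row0 in_fset0; clear - b'0; lia.
- by move=> /and4P[b'0 _ _ _] _ /(_ (l + d, y)); rewrite stack_row0 in_fset0; clear - b'0; lia.
move=> /and4P[bp _ _ sok] /and4P[b'p _ _ s'ok] E.
have E1 x : (l + d <= x < l + d + b%:Z) = (l + d' <= x < l + d' + b'%:Z).
  by move: (E (x, y)); rewrite !stack_row0.
have ed : d = d' by move: (E1 (l + d)) (E1 (l + d')); clear - bp b'p; lia.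
subst d'; have eb : b = b'.
  by move: (E1 (l + d + b%:Z - 1)) (E1 (l + d + b'%:Z - 1)); clear - bp b'p; lia.
subst b'; congr (_ :: _); apply: (IH b b (l + d) (y + 1)) => // -[x z].
have [->|zy] := eqVneq z y; last by move: (E (x, z)); rewrite !stack_rest.
by apply/idP/idP => /stack_height; clear; lia.
Qed.

Lemma hrow_conn (P : pred pt) (l y : int) b (x x' : int) :
  (forall p, p \in hrow l y b -> P p) -> (x, y) \in hrow l y b -> (x', y) \in hrow l y b ->
  conn P (x, y) (x', y).
Proof.
move=> rP; wlog xx : x x' / x <= x'.
  move=> W xr x'r; have [h|/ltW h] := lerP x x'; first exact: W.
  by apply: conn_sym; [exact: rP | exact: W].
move=> xr x'r.
have [k ek] : exists k : nat, x' = x + k%:Z by exists (absz (x' - x)%R); clear - xx; lia.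
subst x'; elim: k x'r {xx} => [|k IH] h; first by rewrite addr0; exact: conn_refl.
have h' : (x + k%:Z, y) \in hrow l y b by move: h xr; rewrite !mem_hrow; clear; lia.
apply: conn_trans (IH h') _; apply: conn1; last exact: rP.
by rewrite adj_pt /=; clear; lia.
Qed.

Lemma stack_conn (l y : int) d b s : (0 < b)%N -> stack_ok b s ->
  forall p, p \in stack l y ((d, b) :: s) ->
    conn (fun q => q \in stack l y ((d, b) :: s)) (l + d, y) p.
Proof.
elim: s l y d b => [|[d' b'] s IH] l y d b bp sok [x z]; rewrite in_stack => /orP[pr|].
- have ez : z = y by move: pr; rewrite mem_hrow => /andP[/eqP].
  subst z; apply: hrow_conn pr => [q qr|]; first by rewrite in_stack qr.
  by rewrite mem_hrow; clear - bp; lia.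
- by rewrite in_fset0.
- have ez : z = y by move: pr; rewrite mem_hrow => /andP[/eqP].
  subst z; apply: hrow_conn pr => [q qr|]; first by rewrite in_stack qr.
  by rewrite mem_hrow; clear - bp; lia.
move: sok => /and4P[b'p d1 d2 sok] ps.
have sub q : q \in stack (l + d) (y + 1) ((d', b') :: s) -> q \in stack l y [:: (d, b), (d', b') & s].
  by move=> qs; rewrite in_stack qs orbT.
have C := conn_mono sub (IH (l + d) (y + 1) d' b' b'p sok (x, z) ps).
apply: conn_trans C.
(* [v] in the lower row and [u] in the upper one are adjacent; both are measured from the left end
   of the lower row. *)
pose u := if d' < 0 then -1 else d'. pose v := if d' < 0 then 0 else d'.
have uv : [/\ d' <= u, u < d' + b'%:Z, 0 <= v, v < b%:Z & (v == u) || (v == u + 1)].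
  by rewrite /u /v; case: ifP => h; clear - h d1 d2 b'p bp; split; lia.
have [u1 u2 v1 v2 av] := uv.
apply: (conn_trans (y := (l + d + v, y))).
  apply: (@hrow_conn _ (l + d) y b) => [q qr||]; first by rewrite in_stack qr.
    by rewrite mem_hrow; clear - bp; lia.
  by rewrite mem_hrow; clear - v1 v2; lia.
apply: (conn_trans (y := (l + d + u, y + 1))).
  apply: conn1; first by rewrite adj_pt /=; clear - av; lia.
  by apply: sub; rewrite stack_row0; clear - u1 u2; lia.
apply: (@hrow_conn _ (l + d + d') (y + 1) b') => [q qr||].
- by apply: sub; rewrite in_stack qr.
- by rewrite mem_hrow; clear - u1 u2; lia.
- by rewrite mem_hrow; clear - b'p; lia.
Qed.

Lemma stack_connected (l y : int) d b s : (0 < b)%N -> stack_ok b s ->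
  connected (stack l y ((d, b) :: s)).
Proof.
move=> bp sok p q pS qS; have C := stack_conn bp sok.
apply: conn_trans (C l y d q qS); apply: conn_sym (C l y d p pS).
by rewrite stack_row0; clear - bp; lia.
Qed.

Lemma stack_interval (l y : int) s (z : int) :
  exists a b : int, forall x : int, ((x, z) \in stack l y s) = (a <= x < b).
Proof.
elim: s l y => [|[d b] s IH] l y.
  by exists 0, 0 => x; rewrite in_fset0; clear; lia.
have [->|zy] := eqVneq z y.
  by exists (l + d), (l + d + b%:Z) => x; rewrite stack_row0.
have [a [c E]] := IH (l + d) (y + 1).
by exists a, c => x; rewrite stack_rest.
Qed.

Lemma interval_rows_holefree (A : {fset pt}) :
  (forall z : int, exists a b : int, forall x : int, ((x, z) \in A) = (a <= x < b)) -> holefree A.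
Proof.
move=> H [x z] nA N; have [a [b E]] := H z.
have go (e : int) : `|e| = 1 -> (forall k : nat, (x + e * k%:Z, z) \notin A) ->
    exists2 q, conn (fun p => p \notin A) (x, z) q & (N <= norm1 q)%N.
  move=> e1 out; exists (x + e * (N + `|x|)%N%:Z, z); last by rewrite /norm1 /=; clear - e1; nia.
  elim: (N + _)%N => [|k IH]; first by rewrite mulr0 addr0; exact: conn_refl.
  apply: conn_trans IH _; apply: conn1; last exact: out.
  by rewrite adj_pt /=; clear - e1; nia.
have [xa|ax] := ltrP x a.
  by apply: (go (-1)) => // k; rewrite E; clear - xa; lia.
apply: (go 1) => // k; rewrite E; move: nA; rewrite E; clear - ax; lia.
Qed.

Lemma stack_perm (l y : int) d b s :
  perm_eq (stack l y ((d, b) :: s)) (hrow (l + d) y b ++ stack (l + d) (y + 1) s).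
Proof.
apply: uniq_perm; first exact: fset_uniq.
  rewrite cat_uniq uniq_hrow fset_uniq andbT; apply/hasPn => -[x z] /= /stack_height h.
  by rewrite mem_hrow; clear - h; lia.
by move=> p; rewrite mem_cat in_stack.
Qed.

(** The faces that [ntri] counts at the particles of a row of length [b] lying under the row
    [(d, b')]. *)
Definition row_tri (b : nat) (d : int) (b' : nat) : nat :=
  (\sum_(k <- iota 0 b) (((k.+1 < b) && (d <= k%:Z < d + b'%:Z)%R) +
     ((d <= k%:Z < d + b'%:Z)%R && (d <= k%:Z - 1 < d + b'%:Z)%R)))%N.

(* The number of triangles that a stack lacks with respect to two per particle, apart from
   its first row. *)
Fixpoint excess (b : nat) (s : seq (int * nat)) : nat :=
  if s is (d, b') :: s' then (2 * b' - row_tri b d b' + excess b' s')%N else 0%N.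

Lemma card_stack (l y : int) s : #|` stack l y s| = sumn (unzip2 s).
Proof.
elim: s l y => [|[d b] s IH] l y; first by rewrite cardfs0.
by rewrite (perm_size (stack_perm l y d b s)) size_cat IH size_map size_iota.
Qed.

(** Faces counted at a row are set against the two per particle due for the row above it; hence the
    term [2 * b] for the bottom row. *)
Lemma ntri_stack (l y : int) d b s :
  (2 * sumn (unzip2 ((d, b) :: s)) <= ntri (stack l y ((d, b) :: s)) + excess b s + 2 * b)%N.
Proof.
elim: s l y d b => [|[d' b'] s IH] l y d b; first by rewrite /= addn0 addn0 leq_addl.
set S := stack l y _; set S' := stack (l + d) (y + 1) ((d', b') :: s).
have sub p : p \in S' -> p \in S by move=> pS; rewrite /S in_stack pS orbT.
suff : (row_tri b d' b' + ntri S' <= ntri S)%N.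
  have := IH (l + d) (y + 1) d' b'; rewrite -/S' [excess b _]/= [sumn _]/= [sumn (unzip2 (_ :: _ :: _))]/=.
  by move: (ntri S) (ntri S') (row_tri _ _ _) (excess _ _) (sumn _); clear; lia.
rewrite {2}/ntri (perm_big _ (stack_perm l y d b ((d', b') :: s))) big_cat big_map /=.
apply: leq_add; last first.
  apply: leq_sum => p _; have su := sub.
  apply: leq_add.
    by case: (boolP (p + dir 0 \in S')) => // /sub ->; case: (boolP (p + dir 1 \in S')) => // /sub ->.
  by case: (boolP (p + dir 1 \in S')) => // /sub ->; case: (boolP (p + dir 2 \in S')) => // /sub ->.
rewrite /row_tri big_seq [leqRHS]big_seq; apply: leq_sum => k; rewrite mem_iota => /andP[_ kb].
have up (j : int) : d' <= j < d' + b'%:Z -> (l + d + j, y + 1) \in S.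
  by move=> h; apply: sub; rewrite stack_row0; clear - h; lia.
have e1 : (l + d + k%:Z, y) + dir 1 = (l + d + k%:Z, y + 1) :> pt.
  by rewrite [LHS]surjective_pairing; congr pair; rewrite /= ?addr0.
have e2 : (l + d + k%:Z, y) + dir 2 = (l + d + (k%:Z - 1), y + 1) :> pt.
  by rewrite [LHS]surjective_pairing; congr pair; rewrite /= addrA.
have e0 : (k.+1 < b)%N -> (l + d + k%:Z, y) + dir 0 \in S.
  move=> h; have -> : (l + d + k%:Z, y) + dir 0 = (l + d + k%:Z + 1, y) :> pt.
    by rewrite [LHS]surjective_pairing; congr pair; rewrite /= ?addr0.
  by rewrite stack_row0; clear - h; lia.
rewrite e1 e2; apply: leq_add.
  by case: (boolP (k.+1 < b)%N) => //= /e0 ->; case: (boolP (_ <= _ < _)) => // /up ->.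
by case: (boolP (_ <= k%:Z < _)) => //= /up ->; case: (boolP (_ <= _ < _)) => // /up ->.
Qed.

Lemma stack_valid n s : stack_ok 1 s -> sumn (unzip2 s) = n -> valid n.+1 (stack 0 0 ((0, 1%N) :: s)).
Proof.
move=> sok sn; split; first by rewrite card_stack /= sn.
  exact: stack_connected.
by apply: interval_rows_holefree; exact: stack_interval.
Qed.

Lemma stack_translate s s' (v : pt) : stack_ok 1 s -> stack_ok 1 s' ->
  (forall p, (p \in stack 0 0 ((0, 1%N) :: s)) = (p + v \in stack 0 0 ((0, 1%N) :: s'))) -> s = s'.
Proof.
move=> sok s'ok E.
have o t : ((0, 0) : pt) \in stack 0 0 ((0, 1%N) :: t) by rewrite stack_row0.
have o1 := o s; rewrite E in o1.
have o2 := o s'; rewrite -[(0, 0)](subrK v) -E in o2.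
have h1 : 0 <= v.2 by rewrite [_ + v]surjective_pairing in o1; move/stack_height: o1; rewrite /= add0r.
have h2 : v.2 <= 0.
  by rewrite [_ - v]surjective_pairing in o2; move/stack_height: o2; rewrite /= sub0r oppr_ge0.
have v2 : v.2 = 0 by apply/eqP; rewrite eq_le h1 h2.
have v1 : v.1 = 0.
  have e : ((0, 0) : pt) + v = (v.1, 0) by rewrite [LHS]surjective_pairing; congr pair; rewrite /= ?add0r.
  by move: o1; rewrite e stack_row0; clear; lia.
have v0 : v = 0 by rewrite [v]surjective_pairing v1 v2.
suff /(congr1 behead) : (0 : int, 1%N) :: s = (0, 1%N) :: s' by [].
by apply: (@stack_inj 1 1 0 0) => // p; rewrite E v0 addr0.
Qed.

(** A selection of the admissible next rows of length at most 3, large enough for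
    [transfer_super]. *)
Definition steps (b : nat) : seq (int * nat) :=
  nth [::] [:: [::];
    [:: (0, 1%N); (-1, 1%N); (-1, 2%N); (0, 2%N); (-2, 2%N); (-1, 3%N); (-2, 3%N)];
    [:: (0, 1%N); (1, 1%N); (-1, 1%N); (0, 2%N); (-1, 2%N); (-1, 3%N); (0, 3%N); (-2, 3%N)];
    [:: (0, 1%N); (1, 1%N); (0, 2%N); (1, 2%N); (-1, 2%N); (0, 3%N); (-1, 3%N)]] b.

(* The pairs (number of missing triangles, length of the new row) of the steps. *)
Definition costs (b : nat) : seq (nat * nat) :=
  nth [::] [:: [::];
    [:: (2, 1); (2, 1); (3, 2); (4, 2); (4, 2); (5, 3); (5, 3)];
    [:: (1, 1); (2, 1); (2, 1); (2, 2); (2, 2); (3, 3); (4, 3); (4, 3)];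
    [:: (1, 1); (1, 1); (1, 2); (2, 2); (2, 2); (2, 3); (2, 3)]]%N b.

Lemma costs_steps b : (0 < b <= 3)%N ->
  [seq ((2 * x.2 - row_tri b x.1 x.2)%N, x.2) | x <- steps b] = costs b.
Proof. by case: b => [|[|[|[|]]]] // _; rewrite /row_tri /steps /costs /= unlock. Qed.

Lemma steps_ok b : all (fun x => [&& (0 < x.2 <= 3)%N, - x.2%:Z <= x.1 & x.1 < b%:Z]) (steps b).
Proof. by case: b => [|[|[|[|[|]]]]]. Qed.

Lemma uniq_steps b : uniq (steps b).
Proof. by case: b => [|[|[|[|[|]]]]]. Qed.

Section Tails.
Variable R : realType.
Let r : R := 5%:R / 11%:R.
Let c : R := 51%:R / 50%:R.
Let K : R := 100%:R^-1.
(* An approximate Perron eigenvector of the transfer matrix given by [costs]. *)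
Let u (b : nat) : R := nth 0 [:: 0; 1; 264%:R / 100%:R; 484%:R / 100%:R] b.

Lemma transfer_super b : (0 < b <= 3)%N ->
  c ^+ 3 * u b <= \sum_(x <- costs b) r ^+ x.1 * u x.2.
Proof.
by case: b => [|[|[|[|]]]] // _; rewrite /costs /= !big_cons big_nil /u /= /c /r; lra.
Qed.

Lemma u_ge0 b : 0 <= u b.
Proof. by case: b => [|[|[|[|b]]]]; rewrite /u /= ?nth_nil //; lra. Qed.

Let r0 : 0 < r. Proof. by rewrite /r; lra. Qed.
Let c0 : 0 < c. Proof. by rewrite /c; lra. Qed.
Let c1 : 1 <= c. Proof. by rewrite /c; lra. Qed.

Lemma tails_bound m b : (0 < b <= 3)%N -> exists L : seq (seq (int * nat)),
  [/\ uniq L, {in L, forall s, stack_ok b s /\ sumn (unzip2 s) = m} &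
      K * c ^+ m * u b <= \sum_(s <- L) r ^+ excess b s].
Proof.
elim/ltn_ind: m b => m IH b b3; have [m3|m3] := ltnP m 3.
  (* For [m < 3] a single straight column suffices, because [K] is as small as 1/100. *)
  exists [:: nseq m (0, 1%N)]; split=> //.
    move=> s; rewrite inE => /eqP ->.
    by case: m m3 {IH} => [|[|[|]]] // _; case: b b3 => [|[|[|[|]]]].
  rewrite big_seq1.
  have e2 : row_tri 2 0 1 = 1%N by rewrite /row_tri /= unlock.
  have e3 : row_tri 3 0 1 = 1%N by rewrite /row_tri /= unlock.
  have e1 : row_tri 1 0 1 = 0%N by rewrite /row_tri /= unlock.
  by case: m m3 {IH} => [|[|[|]]] // _; case: b b3 => [|[|[|[|]]]] // _;
    rewrite /= ?e1 ?e2 ?e3 /u /= /K /c /r; lra.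
have IHb b' : exists L : seq (seq (int * nat)), (0 < b' <= 3)%N ->
  [/\ uniq L, {in L, forall s, stack_ok b' s /\ sumn (unzip2 s) = (m - b')%N} &
      K * c ^+ (m - b') * u b' <= \sum_(s <- L) r ^+ excess b' s].
  have [h|] := boolP (0 < b' <= 3)%N; last by exists [::].
  by have [|L HL] := IH (m - b')%N _ b' h; [clear - h m3; lia | exists L].
have [T HT] := choice IHb.
have st3 x : x \in steps b -> [&& (0 < x.2 <= 3)%N, - x.2%:Z <= x.1 & x.1 < b%:Z].
  by move: x; apply/allP; exact: steps_ok.
exists [seq x :: s | x <- steps b, s <- T x.2]; split.
- apply: allpairs_uniq_dep; first exact: uniq_steps.
    by move=> x /st3/and3P[x3 _ _]; have [] := HT _ x3.
  by move=> [x s] [y t] _ _ /= [-> ->].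
- move=> s /allpairsPdep[[d b'] [t [xs tT ->]]]; have /and3P[/= x3 d1 d2] := st3 _ xs.
  have [_ /(_ _ tT)[tok tm] _] := HT _ x3; rewrite /= d1 d2 tok tm; split.
    by case/andP: x3 => ->.
  by rewrite subnKC //; clear - x3 m3; lia.
rewrite big_allpairs_dep /=.
(* A new row uses at most three particles, so [c ^+ (m - 3)] is a lower bound common to all steps;
   this is why [transfer_super] has [c ^+ 3]. *)
apply: (@le_trans _ _ (\sum_(x <- steps b) r ^+ (2 * x.2 - row_tri b x.1 x.2) * (K * c ^+ (m - 3) * u x.2))); last first.
  rewrite big_seq [leRHS]big_seq; apply: ler_sum => -[d b'] xs; have /and3P[/= x3 d1 d2] := st3 _ xs.
  have [_ _ H] := HT _ x3.
  rewrite (eq_bigr (fun s => r ^+ (2 * b' - row_tri b d b') * r ^+ excess b' s)); last first.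
    by move=> s _; rewrite exprD.
  rewrite -mulr_sumr ler_wpM2l ?exprn_ge0 ?(ltW r0) //; apply: le_trans H.
  rewrite ler_wpM2r ?u_ge0 // ler_wpM2l ?ler_weXn2l ?invr_ge0 ?ler0n //.
  by clear - x3 m3; lia.
have := transfer_super b3; rewrite -(costs_steps b3) big_map /= => H.
rewrite (eq_bigr (fun x => K * c ^+ (m - 3) * (r ^+ (2 * x.2 - row_tri b x.1 x.2) * u x.2))); last first.
  by move=> x _; rewrite mulrCA.
rewrite -mulr_sumr -{1}(subnK m3) exprD mulrA -(mulrA (K * _)) ler_wpM2l //.
by rewrite mulr_ge0 ?invr_ge0 ?ler0n // exprn_ge0 // ltW.
Qed.

(** Distinct tails on a single bottom particle give distinct states. As [r * lam <= 1], each missing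
    triangle costs at most a factor [r]; the factor [r ^+ 2] pays for the bottom particle. *)
Lemma partition_lower (lam : R) n : 1 <= lam -> lam <= 11%:R / 5%:R ->
  K * r ^+ 2 * c ^+ n * lam ^+ (2 * n.+1) <= \sum_(s : Omega n.+1) lam ^+ ntri (cells (val s)).
Proof.
move=> lam1 lam2; have lam0 : 0 < lam by apply: lt_le_trans lam1.
have [L [uL okL bL]] := @tails_bound n 1 isT.
have repL s : exists w : option (Omega n.+1), s \in L -> exists2 w', w = Some w' & rep w' (stack 0 0 ((0, 1%N) :: s)).
  have [sL|] := boolP (s \in L); last by exists None.
  have [ok sn] := okL s sL; have [w hw] := rep_exists (stack_valid ok sn) (ltn0Sn n).
  by exists (Some w) => _; exists w.
have [f Hf] := choice repL.
have finj : {in L &, injective f}.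
  move=> s t sL tL; have [w ew [v Ev]] := Hf s sL; have [z ez [x Ex]] := Hf t tL.
  rewrite ew ez => -[wz]; subst z.
  apply: (@stack_translate s t (x - v)); [by case: (okL s sL)|by case: (okL t tL)|move=> p].
  by rewrite addrA addrAC -Ex Ev subrK.
pose F (w : Omega n.+1) : R := lam ^+ ntri (cells (val w)).
have wt s : s \in L -> r ^+ 2 * lam ^+ (2 * n.+1) * r ^+ excess 1 s <= oapp F 0 (f s).
  move=> sL; have [w -> [v Ev]] := Hf s sL; rewrite /= /F (ntri_translate Ev).
  have [ok sn] := okL s sL.
  have := ntri_stack 0 0 0 1 s; rewrite /= sn add1n -/(stack _ _ _) => H.
  set S := (_ `|` _)%fset in H *.
  have lr : r * lam <= 1 by rewrite /r; lra.
  rewrite mulrAC -exprD.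
  apply: (@le_trans _ _ (r ^+ (2 + excess 1 s) * lam ^+ (2 + excess 1 s + ntri S))).
    by rewrite ler_wpM2l ?exprn_ge0 ?(ltW r0) // ler_weXn2l //; clear - H; lia.
  rewrite (exprD lam (2 + _)) mulrA -exprMn ler_piMl ?exprn_ge0 ?(ltW lam0) //.
  by rewrite exprn_ile1 // mulr_ge0 // ltW.
have sumF : \sum_(s <- L) oapp F 0 (f s) <= \sum_w F w.
  pose L' := pmap f L.
  have uL' : uniq L'.
    have : uniq [seq f s | s <- L] by rewrite map_inj_in_uniq.
    rewrite /L'; elim: (L) => //= s L0 IH /andP[fs u0].
    rewrite /oapp; case e: (f s) fs => [w|] fs /=; rewrite IH ?andbT //.
    by apply: contra fs; rewrite mem_pmap.
  have -> : \sum_(s <- L) oapp F 0 (f s) = \sum_(w <- L') F w.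
    rewrite /L'; elim: (L) => [|s L0 IH]; first by rewrite !big_nil.
    by rewrite big_cons IH /=; case: (f s) => [w|] /=; rewrite ?big_cons ?add0r.
  rewrite big_uniq // [leRHS](bigID (fun w => w \in L')) /= lerDl sumr_ge0 // => w _.
  by rewrite exprn_ge0 // ltW.
apply: le_trans sumF; apply: (@le_trans _ _ (\sum_(s <- L) r ^+ 2 * lam ^+ (2 * n.+1) * r ^+ excess 1 s)).
  rewrite -mulr_sumr (_ : u 1 = 1) // mulr1 in bL *.
  rewrite [leLHS](_ : _ = r ^+ 2 * lam ^+ (2 * n.+1) * (K * c ^+ n)); last by ring.
  by rewrite ler_wpM2l // mulr_ge0 ?exprn_ge0 // ltW.
by rewrite big_seq [leRHS]big_seq; apply: ler_sum.
Qed.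

End Tails.

(** * Numerical bounds and the final estimate *)

Lemma N50_bound (R : realType) : 2 * N50 R <= (11%:R / 5%:R) ^+ 100.
Proof. rewrite /N50 /=. lra. Qed.

Lemma bias_le (R : realType) (lam : R) : 1 <= lam -> lam < (2 * N50 R) `^ (100%:R)^-1 ->
  lam <= 11%:R / 5%:R.
Proof.
move=> lam1 /ltW /le_trans; apply.
have r0 : 0 <= 11%:R / 5%:R :> R by lra.
have N0 : 0 <= 2 * N50 R by rewrite /N50 /=; lra.
have -> : 11%:R / 5%:R = ((11%:R / 5%:R) ^+ 100) `^ (100%:R)^-1 :> R.
  by rewrite -powR_mulrn // -powRrM divff ?powRr1 // pnatr_eq0.
by apply: ge0_ler_powR; rewrite ?nnegrE ?invr_ge0 ?ler0n ?exprn_ge0 // N50_bound.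
Qed.

Lemma bernoulli (R : realFieldType) (x : R) n : 0 <= x -> 1 + n%:R * x <= (1 + x) ^+ n.
Proof.
move=> x0; elim: n => [|n IH]; first by rewrite mul0r addr0 expr0.
rewrite exprS; apply: (@le_trans _ _ ((1 + x) * (1 + n%:R * x))); last first.
  by rewrite ler_wpM2l // addr_ge0.
have : 0 <= x * (n%:R * x) by rewrite !mulr_ge0 ?ler0n.
by rewrite -natr1; lra.
Qed.

Section Tail.
Variable R : realType.
Let e : R := 201%:R / 200%:R.
Let e1 : 1 <= e. Proof. by rewrite /e; lra. Qed.
Let e0 : 0 < e. Proof. exact: lt_le_trans e1. Qed.

(** Bernoulli's inequality gives at least 2 for the exponent 200, and the cube of 2 is 8. *)
Lemma six_le : 6%:R <= e ^+ 600.
Proof.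
have h : 2%:R <= e ^+ 200.
  have -> : e = 1 + 200%:R^-1 by rewrite /e; lra.
  apply: le_trans (bernoulli 200 _); last by rewrite invr_ge0 ler0n.
  by rewrite mulfV ?pnatr_eq0 //; lra.
rewrite -[600%N]/(200 * 3)%N exprM; apply: (@le_trans _ _ (2%:R ^+ 3)); first by lra.
by rewrite lerXn2r ?nnegrE ?ler0n ?exprn_ge0 // ltW.
Qed.

(** Bernoulli's inequality with exponent [n %/ 3] bounds [e ^+ n] below by the cube of n/600. *)
Lemma expr_beats_square (C : R) : 0 < C -> exists m : nat, forall n, (m < n)%N ->
  C * n%:R ^+ 2 < e ^+ n.
Proof.
move=> C0; exists (Num.bound (600%:R ^+ 3 * C)) => n mn.
have nC : 600%:R ^+ 3 * C < n%:R.
  apply: lt_le_trans (archi_boundP _) _; first by rewrite mulr_ge0 ?exprn_ge0 ?ler0n // ltW.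
  by rewrite ler_nat ltnW.
have n0 : 0 < n%:R :> R by rewrite ltr0n; exact: leq_ltn_trans mn.
have h : n%:R / 600%:R <= e ^+ (n %/ 3).
  have -> : e = 1 + 200%:R^-1 by rewrite /e; lra.
  apply: le_trans (bernoulli _ _); last by rewrite invr_ge0 ler0n.
  have : (n%:R <= (n %/ 3)%:R * 3%:R + 2%:R :> R).
    by rewrite -natrM -natrD ler_nat; clear; lia.
  by move: (n %/ 3)%:R => q; lra.
apply: (@lt_le_trans _ _ (e ^+ (n %/ 3 * 3))); last by rewrite ler_weXn2l // leq_trunc_div.
rewrite exprM; apply: (@lt_le_trans _ _ ((n%:R / 600%:R) ^+ 3)); last first.
  by rewrite lerXn2r ?nnegrE ?divr_ge0 ?ler0n ?exprn_ge0 // ltW.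
rewrite (_ : (n%:R / 600%:R) ^+ 3 = n%:R / 600%:R ^+ 3 * n%:R ^+ 2); last by field.
by rewrite ltr_pM2r ?exprn_gt0 // ltr_pdivlMr ?exprn_gt0 ?ltr0n // mulrC.
Qed.

(** No weight exceeds [lam ^+ (2 * n.+1)], so [partition_lower] bounds each single probability by
    [D^-1]; the rest is counting. *)
Lemma prob_bound (lam : R) n (pi : Omega n.+1 -> R) k : 1 <= lam -> lam <= 11%:R / 5%:R ->
  (0 < n)%N -> stationary lam pi ->
  \sum_(s : Omega n.+1 | (perim (val s) <= k)%N) pi s <=
    (n.+1 * n.+1 * 6 ^ k)%:R / (100%:R^-1 * (5%:R / 11%:R) ^+ 2 * (51%:R / 50%:R) ^+ n).
Proof.
move=> lam1 lam2 n0 st; have lam0 : 0 < lam by apply: lt_le_trans lam1.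
have G := stationary_gibbs lam0 st; have [pi0 pi1 _] := st.
set D := 100%:R^-1 * _ * _.
have D0 : 0 < D by rewrite /D !mulr_gt0 ?exprn_gt0 ?invr_gt0 ?ltr0n //; lra.
have one s : pi s <= D^-1.
  have Z := partition_lower n lam1 lam2; rewrite -/D in Z.
  have E : pi s * \sum_(t : Omega n.+1) lam ^+ ntri (cells (val t)) = lam ^+ ntri (cells (val s)).
    rewrite mulr_sumr (eq_bigr (fun t => pi t * lam ^+ ntri (cells (val s)))) => [|t _].
      by rewrite -mulr_suml pi1 mul1r.
    exact: G.
  have T : lam ^+ ntri (cells (val s)) <= lam ^+ (2 * n.+1).
    rewrite ler_weXn2l //; have [cs _ _] := Omega_valid s.
    by rewrite -[X in (_ <= 2 * X)%N]cs ntri_le.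
  have L0 : 0 < lam ^+ (2 * n.+1) by rewrite exprn_gt0.
  rewrite -[leRHS]mul1r ler_pdivlMr // -(ler_pM2r L0) mul1r -mulrA.
  apply: le_trans T; rewrite -E ler_wpM2l //.
apply: (@le_trans _ _ (\sum_(s : Omega n.+1 | (perim (val s) <= k)%N) D^-1)).
  by apply: ler_sum => s _.
rewrite sumr_const -[leLHS]mulr_natl ler_wpM2r ?invr_ge0 ?(ltW D0) // ler_nat.
by rewrite -cardsE card_perim_le.
Qed.

End Tail.

Theorem theorem4 (R : realType) (lam : R) :
  1 <= lam -> lam < (2 * N50 R) `^ (100%:R)^-1 ->
  exists beta : R, 0 < beta < 1 /\
  exists (nstar : nat) (gamma : R), 0 < gamma < 1 /\
  forall n : nat, (nstar < n)%N ->
  forall pi : Omega n -> R, stationary lam pi ->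
    \sum_(s : Omega n | (perim (val s))%:R <= beta * (pmax n)%:R) pi s
      < gamma `^ Num.sqrt (n%:R).
Proof.
(* For n + 1 particles [pmax] is 2n, so this choice bounds the perimeter by n/600, which matches
   [six_le]. *)
move=> lam1 /(bias_le lam1) lam2; exists (1200%:R^-1); split.
  by rewrite invr_gt0 ltr0n invf_lt1 ?ltr0n // ltr1n.
pose e : R := 201%:R / 200%:R.
have e1 : 1 <= e by rewrite /e; lra.
have e0 : 0 < e := lt_le_trans ltr01 e1.
pose D : R := 100%:R^-1 * (5%:R / 11%:R) ^+ 2.
have D0 : 0 < D by rewrite /D mulr_gt0 ?exprn_gt0 ?invr_gt0 ?ltr0n //; lra.
have [m Hm] := @expr_beats_square R (e ^+ 3 / D) (divr_gt0 (exprn_gt0 _ e0) D0).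
exists m.+1, e^-1; split; first by rewrite invr_gt0 e0 invf_lt1 // /e; lra.
move=> [|n] // mn pi st.
have n0 : (0 < n)%N := leq_ltn_trans (leq0n m) mn.
have k600 (s : Omega n.+1) : ((perim (val s))%:R <= 1200%:R^-1 * (pmax n.+1)%:R :> R) =
    ((perim (val s))%:R <= 1200%:R^-1 * (pmax n.+1)%:R :> R) && (perim (val s) <= n %/ 600)%N.
  rewrite [RHS]andbC; apply/idP/andP => [h|[]//]; split=> //.
  move: h; rewrite mulrC ler_pdivlMr ?ltr0n // -natrM ler_nat /pmax leq_divRL //.
  by clear; lia.
have [pi0 _ _] := st.
apply: (@le_lt_trans _ _ (\sum_(s : Omega n.+1 | (perim (val s) <= n %/ 600)%N) pi s)).
  rewrite (eq_bigl _ _ k600) [leRHS](bigID (fun s : Omega n.+1 => (perim (val s))%:R <= 1200%:R^-1 * (pmax n.+1)%:R :> R)) /=.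
  rewrite (eq_bigl (fun s : Omega n.+1 => (perim (val s) <= n %/ 600)%N && ((perim (val s))%:R <= 1200%:R^-1 * (pmax n.+1)%:R :> R))); last by move=> s; rewrite andbC.
  by rewrite lerDl sumr_ge0.
apply: le_lt_trans (prob_bound (n %/ 600) lam1 lam2 n0 st) _; rewrite -/D.
have s1 : Num.sqrt (n.+1%:R) <= n.+1%:R :> R.
  rewrite -[leRHS]ger0_norm // -sqrtr_sqr ler_wsqrtr // -natrX ler_nat.
  by rewrite expnS expn1 leq_pmulr.
have g01 : 0 < e^-1 <= 1 by rewrite invr_gt0 e0 invf_le1.
apply: lt_le_trans (ger_powR g01 s1).
rewrite powR_mulrn ?invr_ge0 ?(ltW e0) // exprVn.
have X0 : 0 < e ^+ n by rewrite exprn_gt0.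
have cX : (e ^+ n) ^+ 3 <= (51%:R / 50%:R) ^+ n.
  rewrite exprAC lerXn2r ?nnegrE ?exprn_ge0 ?(ltW e0) //; first by lra.
  by rewrite /e; lra.
have kX : (6 ^ (n %/ 600))%:R <= e ^+ n.
  rewrite natrX; apply: (@le_trans _ _ ((e ^+ 600) ^+ (n %/ 600))).
    by rewrite lerXn2r ?nnegrE ?ler0n ?exprn_ge0 ?(ltW e0) // six_le.
  by rewrite -exprM ler_weXn2l // mulnC leq_trunc_div.
(* Of the three factors [e ^+ n] below [c ^+ n], one pays for the walk codes, one for the decay, and
   the third absorbs the polynomial factor here. *)
have N2 : n.+1%:R ^+ 2 * e ^+ 2 < D * e ^+ n.
  have h := Hm n.+1 (ltnW mn); rewrite -(ltr_pM2l D0) in h; rewrite -(ltr_pM2l e0).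
  suff [-> ->] : e * (n.+1%:R ^+ 2 * e ^+ 2) = D * (e ^+ 3 / D * n.+1%:R ^+ 2) /\
    e * (D * e ^+ n) = D * e ^+ n.+1 by [].
  by split; [field; rewrite lt0r_neq0 | rewrite exprS; ring].
have Dc : 0 < D * (51%:R / 50%:R) ^+ n by rewrite mulr_gt0 // exprn_gt0 //; lra.
rewrite ltr_pdivrMr //.
rewrite mulrC ltr_pdivlMr ?exprn_gt0 // natrM natrM -expr2 (exprS e n).
apply: lt_le_trans (_ : D * (e ^+ n) ^+ 3 <= _); last by rewrite ler_wpM2l // ltW.
apply: (@le_lt_trans _ _ (n.+1%:R ^+ 2 * e ^+ 2 * (e ^+ n) ^+ 2)); last first.
  by rewrite (exprS (e ^+ n) 2) [ltRHS]mulrA ltr_pM2r // exprn_gt0.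
rewrite -[leLHS]mulrA -[leRHS]mulrA ler_wpM2l ?exprn_ge0 ?ler0n //.
rewrite [leRHS](_ : _ = e ^+ n * (e ^+ 2 * e ^+ n)); last by rewrite [RHS]mulrCA -(expr2 (e ^+ n)).
apply: ler_pM => //; first by rewrite mulr_ge0 // ltW.
by rewrite ler_wpM2r ?(ltW X0) // expr2 ler_peMl // ltW.
Qed.
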